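(* Let $\Gamma,H,t,\tau_1,\tau_2,\tau_3,\mathrm T,\mathscr C$ satisfy the standing assumptions in the context, let $z,w:\mathscr C\to\mathbb C$ be non-constant meromorphic with $z(\gamma\mathrm T)=z(\mathrm T)$ and $w(\gamma\mathrm T)=\chi(\gamma)\det(C\mathrm T+D)w(\mathrm T)$ for all $\gamma=\begin{pmatrix}A&B\\ C&D\end{pmatrix}\in\Gamma$ ($\chi$ a character), and let $p_1,p_2,p_3$ be as defined in the context. Write $w_0=w$, $w_j=\tau_jw$ for $j=1,2,3$, and $w_4=(\tau_1\tau_3-\tau_2^2)w$. Then the four functions $$\begin{vmatrix}w_0&\theta w_0\\ w_1&\theta w_1\end{vmatrix}^{1/2},\quad\begin{vmatrix}w_0&\theta w_0\\ w_3&\theta w_3\end{vmatrix}^{1/2},\quad\begin{vmatrix}w_1&\theta w_1\\ w_4&\theta w_4\end{vmatrix}^{1/2},\quad\begin{vmatrix}w_3&\theta w_3\\ w_4&\theta w_4\end{vmatrix}^{1/2},$$ viewed as functions of $z=z(\mathrm T)$, satisfy a fourth order linear differential equation whose coefficients are polynomials in the $p_i$ and their derivatives. Moreover, the projective monodromy group of this equation contains $\Gamma$.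
   Context: Standing assumptions: $\Gamma$ is a discrete subgroup of $\mathrm{Sp}_4(\mathbb R)$; $H$ a connected domain in the upper half-plane; $t:H\to\mathbb C$ meromorphic; $\tau_1=\tau$, $\tau_2=-\int_{c_1}^{\tau}t\,\mathrm d\tau$, $\tau_3=\int_{c_2}^{\tau}t^2\,\mathrm d\tau$, $\mathrm T(\tau)=\begin{pmatrix}\tau_1&\tau_2\\ \tau_2&\tau_3\end{pmatrix}$; for each residue $r$ of $t$ the matrix $\begin{pmatrix}1&0&0&2\pi ir\\0&1&2\pi ir&0\\0&0&1&0\\0&0&0&1\end{pmatrix}\in\Gamma$, and for each residue $s$ of $t^2$ the matrix $\begin{pmatrix}1&0&0&0\\0&1&0&2\pi is\\0&0&1&0\\0&0&0&1\end{pmatrix}\in\Gamma$; $\mathscr C=\{\mathrm T(\tau):\tau\in H\}$ with all branches, and $\gamma\mathrm T=(A\mathrm T+B)(C\mathrm T+D)^{-1}$ defines a group action of $\Gamma$ on $\mathscr C$. Notation: $'=\mathrm d/\mathrm d\tau$, $\theta=z\,\mathrm d/\mathrm dz$; $v=\mathrm dt/\mathrm d\tau$, $G_1=z'/z$, $G_2=w'/w$, $G_3=v'/v$; $p_1=\frac{2G_1'-G_1(G_2+G_3)}{2G_1^2}$, $p_2=\frac{24G_3'-20(G_2+G_3)'+5(G_2+G_3)^2-8G_3^2}{20G_1^2}$, $p_3=\frac{-10G_3'''+40G_3G_3''+21(G_3')^2-54G_3^2G_3'+9G_3^4}{50G_1^4}$. The projective monodromy group refers to the monodromy of the four solutions (as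 functions of $z$) acting on the ordered basis consisting of these four functions up to sign and scalar. *)

(* Defs.v *)
From HB Require Import structures.
From mathcomp Require Import all_boot all_order all_algebra all_fingroup.
From mathcomp Require Import all_classical all_reals all_analysis.
From mathcomp Require Import complex.
From mathcomp Require mpoly.

Set Implicit Arguments.
Unset Strict Implicit.
Unset Printing Implicit Defensive.

Import Order.TTheory GRing.Theory Num.Theory.
Import numFieldNormedType.Exports.

Local Open Scope classical_set_scope.
Local Open Scope ring_scope.

(* The definitions are made over any numClosedFieldType C, whose topology is
   that of its norm and for which derive1 is the complex derivative; they are
   meant for C = cplx R, i.e. R[i]. *)

Section FunctionTheory.
Variables (R : realType) (C : numClosedFieldType).
Implicit Types (f g G : C -> C) (a r : C) (U : set C).

Definition analytic_at f a :=
  exists c : nat -> C,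
    \forall x \near a, [series c k * (x - a) ^+ k]_k @ \oo --> f x.

Definition pole_at f a :=
  exists (n : nat) g, [/\ (0 < n)%N, analytic_at g a, g a != 0
    & \forall x \near a^', f x = g x / (x - a) ^+ n].

(* A meromorphic function is represented by the total function that takes the
   value 0 at the poles; its values at all other points are its true values. *)
Definition meromorphic_at f a :=
  analytic_at f a \/ (pole_at f a /\ f a = 0).

(* The Laurent series of f at a is \sum_k c_k (x - a)^(k - n - 1), so that the
   coefficient of (x - a)^-1 is c_n. *)
Definition residue_at f a r :=
  exists (n : nat) (c : nat -> C), r = c n /\
    \forall x \near a^',
      [series c k * (x - a) ^+ k]_k @ \oo --> f x * (x - a) ^+ n.+1.

Definition primitive_at f G a :=
  analytic_at G a /\ \forall x \near a, derive1 G x = f x.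

Implicit Types (alpha : R -> C).

Definition path_in U alpha :=
  {within `[0, 1], continuous alpha} /\
  forall s : R, 0 <= s <= 1 -> U (alpha s).

(* I = \int_alpha f(x) dx along a path that is only continuous: F is a
   primitive of f along alpha, i.e. is locally of the form G \o alpha with G a
   primitive of f. *)
Definition integral_along f alpha (I : C) :=
  exists F : R -> C,
    (forall s : R, 0 <= s <= 1 -> exists G, primitive_at f G (alpha s) /\
       \forall s' \near s, 0 <= s' <= 1 -> F s' = G (alpha s')) /\
    I = F 1 - F 0.

(* The germ of g at alpha 1 is the analytic continuation along alpha of the
   germ of f at alpha 0; Phi s is the germ at alpha s. *)
Definition continues_along alpha f g :=
  exists Phi : R -> C -> C,
    [/\ \forall x \near alpha 0, Phi 0 x = f x,
        \forall x \near alpha 1, Phi 1 x = g x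
      & forall s : R, 0 <= s <= 1 -> analytic_at (Phi s) (alpha s) /\
          \forall s' \near s, 0 <= s' <= 1 ->
            \forall x \near alpha s', Phi s' x = Phi s x].

End FunctionTheory.

Definition cplx (R : realType) : numClosedFieldType := R[i]%C.

Definition RtoC (R : realType) : {rmorphism R -> cplx R} := real_complex R.

Section Symplectic.
(* iota is the embedding of R into C, e.g. RtoC R. *)
Variables (R : realType) (C : numClosedFieldType) (iota : {rmorphism R -> C}).
Implicit Types (Gamma : set 'M[R]_(2 + 2)) (g : 'M[R]_(2 + 2)).
Implicit Types (T : 'M[C]_2) (CC : set 'M[C]_2).

Definition Jmx : 'M[R]_(2 + 2) := block_mx 0 1%:M (- 1%:M) 0.

Definition Sp4 : set 'M[R]_(2 + 2) := [set g | g^T *m Jmx *m g = Jmx].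

Definition discrete_subgroup_Sp4 Gamma :=
  [/\ Gamma `<=` Sp4,
      Gamma 1%:M,
      forall g h, Gamma g -> Gamma h -> Gamma (g *m h),
      forall g, Gamma g -> Gamma (invmx g)
    & Gamma `<=` isolated Gamma].

Definition toC m n (A : 'M[R]_(m, n)) : 'M[C]_(m, n) :=
  map_mx iota A.

(* C T + D for g = block_mx A B C D *)
Definition aut_den g T : 'M[C]_2 := toC (dlsubmx g) *m T + toC (drsubmx g).

(* (A T + B) (C T + D)^-1 *)
Definition aut_act g T : 'M[C]_2 :=
  (toC (ulsubmx g) *m T + toC (ursubmx g)) *m invmx (aut_den g T).

(* Under this condition aut_act is automatically a group action on CC. *)
Definition acts_on Gamma CC :=
  forall g T, Gamma g -> CC T -> aut_den g T \in unitmx /\ CC (aut_act g T).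

Definition is_character Gamma (chi : 'M[R]_(2 + 2) -> C) :=
  (forall g, Gamma g -> chi g != 0) /\
  (forall g h, Gamma g -> Gamma h -> chi (g *m h) = chi g * chi h).

(* the symmetric matrix with rows (a, b) and (b, c) *)
Definition sym2 (a b c : C) : 'M[C]_2 :=
  \matrix_(i, j) [:: a; b; c]`_(i + j).

Definition translation (S : 'M[C]_2) : 'M[C]_(2 + 2) :=
  block_mx 1%:M S 0 1%:M.

Definition twopii : C := iota (2 * pi) * 'i.

End Symplectic.

Section Curve.
Variables (R : realType) (C : numClosedFieldType) (iota : {rmorphism R -> C}).
Implicit Types (H : set C) (t : C -> C) (T : 'M[C]_2) (z w f : 'M[C]_2 -> C).
Implicit Types (CC : set 'M[C]_2) (F : C -> 'M[C]_2) (phi : C -> C).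

(* H without the poles of t *)
Definition regular_part H t : set C := [set x | H x /\ analytic_at t x].

(* All the branches of T = (tau1, tau2; tau2, tau3) over H, obtained by
   continuing one initial branch simultaneously in all its entries along all
   paths alpha.  The paths start at c1, where tau2 = 0; k3 is the initial value
   of tau3 there, i.e. \int_(c2)^(c1) t^2. *)
Definition curve H t (c1 k3 : C) : set 'M[C]_2 :=
  [set T | exists (alpha : R -> C) (I2 I3 : C),
     [/\ path_in (regular_part H t) alpha, alpha 0 = c1,
         integral_along t alpha I2,
         integral_along (fun x => t x ^+ 2) alpha I3
       & T = sym2 (alpha 1) (- I2) (k3 + I3)]].

Record standing_assumptions (Gamma : set 'M[R]_(2 + 2)) H t
    (c1 c2 : C) (delta : R -> C) (k3 : C) : Prop := StandingAssumptions {
  Gamma_discrete : discrete_subgroup_Sp4 Gamma;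
  H_nonempty : H !=set0;
  H_open : open H;
  H_connected : connected H;
  H_upper : forall x, H x -> 0 < 'Im x;
  t_meromorphic : forall a, H a -> meromorphic_at t a;
  (* Otherwise v = 0 and G3, p2, p3 are not defined. *)
  t_nonconstant : exists x y, [/\ H x, H y & t x != t y];
  (* delta is a path from c2 to c1 that relates the two constants of
     integration. *)
  delta_path : path_in (regular_part H t) delta;
  delta_start : delta 0 = c2;
  delta_end : delta 1 = c1;
  delta_integral : integral_along (fun x => t x ^+ 2) delta k3;
  residues_t : forall a r, H a -> residue_at t a r ->
    [set toC iota g | g in Gamma]
      (translation (sym2 0 (twopii iota * r) 0));
  residues_t2 : forall a s, H a -> residue_at (fun x => t x ^+ 2) a s ->
    [set toC iota g | g in Gamma]
      (translation (sym2 0 0 (twopii iota * s)));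
  Gamma_acts : acts_on iota Gamma (curve H t c1 k3) }.

(* F is the branch tau |-> T(tau) near tau = T0 0 0 that passes through T0. *)
Definition branch_at t T0 F :=
  [/\ F (T0 0 0) = T0,
      \forall x \near T0 0 0, F x = sym2 x (F x 0 1) (F x 1 1),
      primitive_at (fun x => - t x) (fun x => F x 0 1) (T0 0 0)
    & primitive_at (fun x => t x ^+ 2) (fun x => F x 1 1) (T0 0 0)].

(* tau = T 0 0 is a local coordinate on the curve of all branches. *)
Definition meromorphic_on_curve t CC f :=
  forall T0 F, CC T0 -> branch_at t T0 F -> meromorphic_at (f \o F) (T0 0 0).

Definition nonconstant_on CC f := exists T T', [/\ CC T, CC T' & f T != f T'].

(* T0 is a point at which z and w are finite, z is a local coordinate, and the
   denominators z, z', w, v of the formulas below do not vanish; F is the branch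
   through T0 and phi the local inverse of tau |-> z (T (tau)), so that
   f \o F \o phi is the function f "viewed as a function of z" near z T0. *)
Definition regular_point t CC z w T0 F phi :=
  [/\ CC T0, branch_at t T0 F,
      analytic_at (z \o F) (T0 0 0) /\ analytic_at (w \o F) (T0 0 0),
      [/\ z T0 != 0, w T0 != 0, derive1 (z \o F) (T0 0 0) != 0
        & derive1 t (T0 0 0) != 0]
    & [/\ analytic_at phi (z T0), phi (z T0) = T0 0 0
        & \forall x \near z T0, z (F (phi x)) = x]].

Section Invariants.
(* z, w, t as functions of tau *)
Variables z w t : C -> C.

Definition G1 : C -> C := fun x => derive1 z x / z x.
Definition G2 : C -> C := fun x => derive1 w x / w x.
Definition v : C -> C := derive1 t.
Definition G3 : C -> C := fun x => derive1 v x / v x.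
Definition G23 : C -> C := fun x => G2 x + G3 x.

Definition p1 : C -> C := fun x =>
  (2 * derive1 G1 x - G1 x * G23 x) / (2 * G1 x ^+ 2).

Definition p2 : C -> C := fun x =>
  (24 * derive1 G3 x - 20 * derive1 G23 x + 5 * G23 x ^+ 2 - 8 * G3 x ^+ 2)
  / (20 * G1 x ^+ 2).

Definition p3 : C -> C := fun x =>
  (- 10 * derive1n 3 G3 x + 40 * G3 x * derive1n 2 G3 x + 21 * derive1 G3 x ^+ 2
   - 54 * G3 x ^+ 2 * derive1 G3 x + 9 * G3 x ^+ 4) / (50 * G1 x ^+ 4).

Definition pfun (i : 'I_3) : C -> C := nth p1 [:: p1; p2; p3] i.

End Invariants.

(* z d/dz *)
Definition theta (f : C -> C) : C -> C := fun x => x * derive1 f x.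

(* w_0 = w, w_j = tau_j w, w_4 = (tau1 tau3 - tau2 ^ 2) w *)
Definition wfun w (j : nat) T : C :=
  [:: 1; T 0 0; T 0 1; T 1 1; T 0 0 * T 1 1 - T 0 1 ^+ 2]`_j * w T.

Definition wronskian (f g : C -> C) : C -> C :=
  fun x => f x * theta g x - theta f x * g x.

(* The four 2 x 2 determinants, as functions of z. *)
Definition det_fun w F phi (i : 'I_4) : C -> C :=
  let ab := nth (0, 0)%N [:: (0, 1); (0, 3); (1, 4); (3, 4)]%N i in
  wronskian (wfun w ab.1 \o F \o phi) (wfun w ab.2 \o F \o phi).

(* y is a branch of f^(1/2) near a. *)
Definition sqrt_branch (f y : C -> C) (a : C) :=
  analytic_at y a /\ \forall x \near a, y x ^+ 2 = f x.

(* The value of the polynomial P in the variables theta^k p_i, i < 3, k < N. *)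
Definition diff_poly_eval N (P : mpoly.mpoly (3 * N) C)
    (p : 'I_3 -> C -> C) : C -> C := fun x =>
  mpoly.meval
    (fun l => mxvec (\matrix_(i < 3, k < N) iter k theta (p i) x) 0 l) P.

(* theta^4 y + c_3 theta^3 y + ... + c_0 y = 0 near a *)
Definition solves_lde (c : 'I_4 -> C -> C) (y : C -> C) (a : C) :=
  \forall x \near a,
    iter 4 theta y x + \sum_(k < 4) c k x * iter k theta y x = 0.

Definition lin_indep_at (Y : 'I_4 -> C -> C) (a : C) :=
  forall b : 'I_4 -> C,
    (\forall x \near a, \sum_(i < 4) b i * Y i x = 0) -> forall i, b i = 0.

(* The monodromy group, with respect to the basis Y of the solutions near a, of
   the equation with coefficients c: the loops based at a are those in C \ {0}
   along which the equation has analytic continuation and returns to itself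
   (its coefficients need not be single-valued functions of z), and the matrix
   of a loop is that of the continuation of the column Y. *)
Definition monodromy_group (c Y : 'I_4 -> C -> C) (a : C) : set 'M[C]_4 :=
  [set M | exists beta : R -> C,
     [/\ path_in [set x | x != 0] beta, beta 0 = a, beta 1 = a,
         forall k, continues_along beta (c k) (c k)
       & forall i, continues_along beta (Y i)
                     (fun x => \sum_(j < 4) M i j * Y j x)]].

Definition projective_monodromy_contains (c Y : 'I_4 -> C -> C) (a : C)
    (Gamma : set 'M[R]_(2 + 2)) :=
  forall g, Gamma g ->
    exists2 b : C, b != 0 & monodromy_group c Y a (b *: toC iota g).

End Curve.

Arguments theta {C} f x.

(* Main.v *)
(** The four functions are, up to sign, s u with s^2 = w^2 / z' and u one of 1, t,
    t tau + tau2, t tau2 + tau3. The chain of derivatives u' = t' q1, q1' = q2,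
    q2' = t' q3 writes theta^k (s u) as a combination of u, q1, q2, q3 whose
    coefficients are polynomials in the logarithmic z d/dz-derivatives a, m, n of
    z', w, t'; the equation is then a polynomial identity in a, m, n and their
    derivatives.

    With e = (t, 1) the four u are the entries of the vector (T e; e). Comparing
    T' = (1, -t) (1, -t)^T at T and at g T shows that (C T + D) e is a multiple of
    the vector e at g T, so g maps the vector (s u) at T to a scalar multiple of
    the one at g T. The curve is connected, and a path in it from T to g T can
    avoid the isolated points that are not regular; its image under z is a loop
    with monodromy g. Around it the coefficients of the equation return to
    themselves, since they are determined by the span of the solutions. That g
    maps a branch of the curve into a branch follows from the countability of the
    fibres of the curve over tau.

    Analyticity is handled through the completion of the polynomials for the norm
    sum_i |p_i| r^i, in which composition and local inversion are limits of
    polynomials. *)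

Require Import Defs.
From HB Require Import structures.
From mathcomp Require Import all_boot all_order all_algebra all_fingroup.
From mathcomp Require Import all_classical all_reals all_analysis.
From mathcomp Require Import complex.
From mathcomp Require Import ring lra.
From mathcomp Require mpoly.

Set Implicit Arguments.
Unset Strict Implicit.
Unset Printing Implicit Defensive.

Import Order.TTheory GRing.Theory Num.Theory.
Import numFieldNormedType.Exports.

Local Open Scope classical_set_scope.
Local Open Scope ring_scope.

(** * Analytic functions *)

(** The scalar in the monodromy comes out of a cancellation. If (C T + D) e = lambda e at g T and
    h(tau) is the tau-coordinate of g T, the tangent comparison also yields lambda^2 = det(C T +
    D)^2 h'. Passing to g T multiplies w^2 by chi(g)^2 det(C T + D)^2 and divides z' by h', so s is
    multiplied by chi(g) lambda up to sign, while u is multiplied by g / lambda. Hence s u becomes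
    chi(g) g (s u) up to sign; the sign of the square root is never tracked, since the group is
    projective.

    The hypothesis on the action is pointwise: each g T lies in a set of matrices, and nothing says
    that g T(tau) stays on one sheet as tau moves. Only after countability has excluded jumps
    between sheets is the derivative of g T(tau) known to have the shape of T'.

    No path from T to g T is ever written down: continuation is proved by induction over locally
    constant properties, and the curve gets its topology from its branches alone. Reachability by
    continuation is such a property on the regular points, and it passes an isolated bad point
    because a punctured disc is connected. *)

Section ComplexNorm.
Variable R : realType.
Local Notation C := (cplx R).
Implicit Types x y z : C.

(** The norm on [cplx R] has its values in [cplx R]; as an element of [R] it is open to real
    arithmetic. *)
Definition nrm x : R := complex.Re `|x|.

Lemma RtoC_nrm x : `|x| = RtoC R (nrm x).
Proof. by rewrite /nrm -{1}(RRe_real (normr_real x)). Qed.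

Lemma RtoC_le (a b : R) : (RtoC R a <= RtoC R b) = (a <= b).
Proof. exact: lecR. Qed.

Lemma RtoC_lt (a b : R) : (RtoC R a < RtoC R b) = (a < b).
Proof. exact: ltcR. Qed.

Lemma RtoC_inj : injective (RtoC R).
Proof. exact: fmorph_inj. Qed.

Lemma nrm_ge0 x : 0 <= nrm x.
Proof. by rewrite -RtoC_le -RtoC_nrm rmorph0. Qed.

Lemma nrm0 : nrm 0 = 0.
Proof. by apply: RtoC_inj; rewrite -RtoC_nrm normr0 rmorph0. Qed.

Lemma nrm1 : nrm 1 = 1.
Proof. by apply: RtoC_inj; rewrite -RtoC_nrm normr1 rmorph1. Qed.

Lemma nrm_eq0 x : (nrm x == 0) = (x == 0).
Proof. by rewrite -(inj_eq RtoC_inj) -RtoC_nrm rmorph0 normr_eq0. Qed.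

Lemma nrm_gt0 x : (0 < nrm x) = (x != 0).
Proof. by rewrite lt_def nrm_ge0 andbT nrm_eq0. Qed.

Lemma nrmM x y : nrm (x * y) = nrm x * nrm y.
Proof. by apply: RtoC_inj; rewrite rmorphM /= -!RtoC_nrm normrM. Qed.

Lemma nrmV x : nrm x^-1 = (nrm x)^-1.
Proof. by apply: RtoC_inj; rewrite fmorphV /= -!RtoC_nrm normfV. Qed.

Lemma nrmX x n : nrm (x ^+ n) = nrm x ^+ n.
Proof. by apply: RtoC_inj; rewrite rmorphXn /= -!RtoC_nrm normrX. Qed.

Lemma nrmN x : nrm (- x) = nrm x.
Proof. by apply: RtoC_inj; rewrite -!RtoC_nrm normrN. Qed.

Lemma nrmD x y : nrm (x + y) <= nrm x + nrm y.
Proof. by rewrite -RtoC_le rmorphD /= -!RtoC_nrm ler_normD. Qed.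

Lemma nrmB x y : nrm (x - y) <= nrm x + nrm y.
Proof. by rewrite (le_trans (nrmD _ _))// nrmN. Qed.

Lemma nrm_distC x y : nrm (x - y) = nrm (y - x).
Proof. by rewrite -nrmN opprB. Qed.

Lemma nrm_dist_tri x y z : nrm (x - z) <= nrm (x - y) + nrm (y - z).
Proof. by rewrite (le_trans _ (nrmD _ _))// addrA subrK. Qed.

Lemma nrm_RtoC (a : R) : nrm (RtoC R a) = `|a|.
Proof.
apply: RtoC_inj; rewrite -RtoC_nrm.
rewrite /RtoC normc_def /= expr0n /= addr0 sqrtr_sqr//.
Qed.

Lemma nrm_RtoC_ge0 (a : R) : 0 <= a -> nrm (RtoC R a) = a.
Proof. by move=> a0; rewrite nrm_RtoC ger0_norm. Qed.

Lemma Re_le_nrm x : `|complex.Re x| <= nrm x.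
Proof. by have := normc_ge_Re x; rewrite RtoC_nrm RtoC_le. Qed.

Lemma Im_le_nrm x : `|complex.Im x| <= nrm x.
Proof.
have := @Re_le_nrm (x * 'i); rewrite nrmM.
have -> : nrm 'i = 1 by apply: RtoC_inj; rewrite -RtoC_nrm normCi rmorph1.
rewrite mulr1; congr (_ <= _).
have -> : 'i = Complex 0 1 :> C by [].
by case: x => a b /=; rewrite mulr0 mulr1 sub0r normrN.
Qed.

Lemma nrm_le_ReIm x : nrm x <= `|complex.Re x| + `|complex.Im x|.
Proof.
have {1}-> : x = RtoC R (complex.Re x) + 'i * RtoC R (complex.Im x).
  exact: complexE.
have n1 : nrm 'i = 1 by apply: RtoC_inj; rewrite -RtoC_nrm normCi rmorph1.
by rewrite (le_trans (nrmD _ _))// nrmM n1 mul1r !nrm_RtoC.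
Qed.

Lemma near_nrm (a : C) (P : C -> Prop) :
  (\forall x \near a, P x) <->
  exists2 e : R, 0 < e & forall x, nrm (x - a) < e -> P x.
Proof.
split.
  move=> /nbhs_ballP[e e0 aeP].
  (* Radii of balls are elements of [cplx R]; a positive one is real. *)
  have er : e = RtoC R (complex.Re e).
    by rewrite -{1}(RRe_real (gtr0_real e0)).
  exists (complex.Re e).
    by move: e0; rewrite /= er -(rmorph0 (RtoC R)) RtoC_lt.
  move=> x xae; apply: aeP; rewrite /ball /= distrC RtoC_nrm er RtoC_lt//.
move=> [e e0 aeP]; apply/nbhs_ballP; exists (RtoC R e).
  by rewrite /= -(rmorph0 (RtoC R)) RtoC_lt.
by move=> x; rewrite /ball /= distrC RtoC_nrm RtoC_lt; exact: aeP.
Qed.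

Lemma near_self (a : C) (P : C -> Prop) : (\forall x \near a, P x) -> P a.
Proof. exact: nbhs_singleton. Qed.

Lemma dnear_nrm (a : C) (P : C -> Prop) :
  (\forall x \near a^', P x) <->
  exists2 e : R, 0 < e & forall x, 0 < nrm (x - a) < e -> P x.
Proof.
rewrite /dnbhs /within /=; split.
  move=> /near_nrm[e e0 H]; exists e => // x /andP[x0 xe]; apply: H => //.
  by move: x0; rewrite nrm_gt0 subr_eq0.
move=> [e e0 H]; apply/near_nrm; exists e => // x xe xa; apply: H.
by rewrite xe nrm_gt0 subr_eq0 xa.
Qed.

Lemma cvgn_nrm (u : nat -> C) (l : C) :
  (u @ \oo --> l) <->
  forall e : R, 0 < e -> exists N, forall n, (N <= n)%N -> nrm (u n - l) < e.
Proof.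
split.
  move=> ul e e0.
  have /ul [N _ NP] : nbhs l [set x | nrm (x - l) < e] by apply/near_nrm; exists e.
  by exists N.
move=> H A /near_nrm[e e0 AP]; have [N NP] := H e e0.
by exists N => // n /= Nn; apply: AP; exact: NP.
Qed.

Lemma expr_half_lt (K e : R) : 0 < e -> exists N, forall n, (N <= n)%N ->
  K * (2^-1) ^+ n < e.
Proof.
move=> e0.
have H : (fun n => K * (2^-1) ^+ n) @ \oo --> (K * 0 : R).
  by apply: cvgMr; apply: cvg_expr; rewrite gtr0_norm ?invr_gt0// invf_lt1 ?ltr1n.
rewrite mulr0 in H.
have /H [N _ NP] : nbhs (0 : R) [set x | x < e].
  exact: lt_nbhsl.
by exists N => n Nn; exact: NP.
Qed.

Lemma nrm_limit_unique (u : nat -> C) (l l' : C) :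
  u @ \oo --> l -> u @ \oo --> l' -> l = l'.
Proof. by move=> h h'; apply: (cvg_unique _ h h'). Qed.

Lemma nrm_le_lim (u : nat -> C) (l b : C) (k : R) :
  u @ \oo --> l -> (forall n, nrm (u n - b) <= k) -> nrm (l - b) <= k.
Proof.
move=> /cvgn_nrm ul uk; apply/ler_addgt0Pr => e e0.
have [N /(_ _ (leqnn N)) HN] := ul _ e0.
rewrite (le_trans (nrm_dist_tri _ (u N) _))// addrC lerD// nrm_distC ltW//.
Qed.

(** Telescoping turns [u] into a series dominated by a geometric one. *)
Lemma fastR_limit (u : nat -> R) (K : R) :
  (forall n, `|u n.+1 - u n| <= K * (2^-1) ^+ n) -> cvgn u.
Proof.
move=> uK.
have K0 : 0 <= K by have := uK 0%N; rewrite expr0 mulr1; exact: le_trans.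
have c1 : cvgn (series (geometric K (2^-1 : R))).
  by apply: is_cvg_geometric_series; rewrite gtr0_norm ?invr_gt0// invf_lt1 ?ltr1n.
have c2 : cvgn (series (fun n => u n.+1 - u n)).
  apply: normed_cvg; apply: series_le_cvg c1 => n /=.
  - exact: normr_ge0.
  - by rewrite mulr_ge0// exprn_ge0// invr_ge0.
  - exact: uK.
have E : u = (fun n => u 0%N + series (fun n => u n.+1 - u n) n).
  by apply/funext => n; rewrite /series /= telescope_sumr// addrC subrK.
by rewrite E; apply: is_cvgD => //; exact: is_cvg_cst.
Qed.

Lemma fast_limit (u : nat -> C) (K : R) :
  (forall n, nrm (u n.+1 - u n) <= K * (2^-1) ^+ n) -> exists l : C, u @ \oo --> l.
Proof.
move=> uK.
have reB (x y : C) : complex.Re (x - y) = complex.Re x - complex.Re y.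
  by case: x y => [a b] [c d].
have imB (x y : C) : complex.Im (x - y) = complex.Im x - complex.Im y.
  by case: x y => [a b] [c d].
have /cvg_ex[a ha] : cvgn (fun n => complex.Re (u n)).
  by apply: (@fastR_limit _ K) => n; rewrite -reB (le_trans (Re_le_nrm _)).
have /cvg_ex[b hb] : cvgn (fun n => complex.Im (u n)).
  by apply: (@fastR_limit _ K) => n; rewrite -imB (le_trans (Im_le_nrm _)).
exists (Complex a b); apply/cvgn_nrm => e e0.
have e2 : 0 < e / 2 by rewrite divr_gt0.
have [N1 _ H1] : \forall n \near \oo, `|a - complex.Re (u n)| < e / 2.
  by have /cvgrPdist_lt := ha; apply.
have [N2 _ H2] : \forall n \near \oo, `|b - complex.Im (u n)| < e / 2.
  by have /cvgrPdist_lt := hb; apply.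
exists (maxn N1 N2) => n; rewrite geq_max => /andP[n1 n2].
rewrite (le_lt_trans (nrm_le_ReIm _))// reB imB /= [e]splitr ltrD// distrC.
  exact: H1.
exact: H2.
Qed.

End ComplexNorm.

(** * Weighted norms on polynomials *)

Section PolyNorm.
Variable R : realType.
Local Notation C := (cplx R).
Implicit Types (p q : {poly C}) (r s : R) (x y c : C).

Definition pnorm r p : R := \sum_(i < size p) nrm p`_i * r ^+ i.

Lemma pnorm_widen r p n : (size p <= n)%N ->
  pnorm r p = \sum_(i < n) nrm p`_i * r ^+ i.
Proof.
move=> pn; rewrite /pnorm (big_ord_widen n (fun i => nrm p`_i * r ^+ i))//.
rewrite big_mkcond /=; apply: eq_bigr => i _; case: ltnP => // h.
by rewrite nth_default// nrm0 mul0r.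
Qed.

(** Horner's scheme for the norm; with [poly_ind] it drives the inductive estimates of this
    section. *)
Lemma pnormE r p c : pnorm r (p * 'X + c%:P) = r * pnorm r p + nrm c.
Proof.
have sz : (size (p * 'X + c%:P)%R <= (size p).+1)%N.
  by rewrite size_MXaddC; case: ifP.
rewrite (pnorm_widen _ sz) big_ord_recl /= addrC; congr (_ + _).
  rewrite /pnorm mulr_sumr; apply: eq_bigr => i _.
  rewrite coefD coefMX coefC /= addr0 exprS; ring.
by rewrite coefD coefMX coefC /= add0r mulr1.
Qed.

Lemma pnorm_ge0 r p : 0 <= r -> 0 <= pnorm r p.
Proof. by move=> r0; apply: sumr_ge0 => i _; rewrite mulr_ge0 ?nrm_ge0 ?exprn_ge0. Qed.

Lemma pnorm0 r : pnorm r 0 = 0.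
Proof. by rewrite /pnorm size_poly0 big_ord0. Qed.

Lemma pnormC r c : pnorm r c%:P = nrm c.
Proof. by have := pnormE r 0 c; rewrite mul0r add0r pnorm0 mulr0 add0r. Qed.

Lemma pnormX r : pnorm r 'X = r.
Proof.
by have := pnormE r 1 0; rewrite mul1r addr0 nrm0 addr0 -polyC1 pnormC nrm1 mulr1.
Qed.

Lemma pnormD r p q : 0 <= r -> pnorm r (p + q) <= pnorm r p + pnorm r q.
Proof.
move=> r0; set n := maxn (size p) (size q).
rewrite !(@pnorm_widen _ _ n) ?leq_maxl ?leq_maxr ?size_polyD// -big_split /=.
apply: ler_sum => i _; rewrite -mulrDl coefD ler_wpM2r ?exprn_ge0// nrmD//.
Qed.

Lemma pnormN r p : pnorm r (- p) = pnorm r p.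
Proof. by rewrite /pnorm size_polyN; apply: eq_bigr => i _; rewrite coefN nrmN. Qed.

Lemma pnormB r p q : 0 <= r -> pnorm r (p - q) <= pnorm r p + pnorm r q.
Proof. by move=> r0; rewrite (le_trans (pnormD _ _ r0))// pnormN. Qed.

Lemma pnormMC r p c : 0 <= r -> pnorm r (p * c%:P) = nrm c * pnorm r p.
Proof.
move=> r0; rewrite mulrC mul_polyC (@pnorm_widen _ _ (size p)) ?size_scale_leq//.
by rewrite /pnorm mulr_sumr; apply: eq_bigr => i _; rewrite coefZ nrmM mulrA.
Qed.

Lemma pnormM r p q : 0 <= r -> pnorm r (p * q) <= pnorm r p * pnorm r q.
Proof.
move=> r0; elim/poly_ind: p => [|p c IH]; first by rewrite mul0r !pnorm0 mul0r.
rewrite mulrDl pnormE (le_trans (pnormD _ _ r0))// mulrDl lerD//.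
  have := pnormE r (p * q) 0; rewrite addr0 nrm0 addr0 => E.
  by rewrite mulrAC E -mulrA ler_wpM2l.
by rewrite mulrC pnormMC.
Qed.

Lemma pnorm_monotone r s p : 0 <= r -> r <= s -> pnorm r p <= pnorm s p.
Proof.
move=> r0 rs; apply: ler_sum => i _; rewrite ler_wpM2l ?nrm_ge0//.
by rewrite lerXn2r ?nnegrE// (le_trans r0).
Qed.

Lemma coef_pnorm r p i : 0 <= r -> nrm p`_i * r ^+ i <= pnorm r p.
Proof.
move=> r0; have [ip|pi] := ltnP i (size p); last first.
  by rewrite nth_default// nrm0 mul0r pnorm_ge0.
rewrite /pnorm (bigD1 (Ordinal ip))//= lerDl; apply: sumr_ge0 => j _.
by rewrite mulr_ge0 ?nrm_ge0 ?exprn_ge0.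
Qed.

Lemma horner_pnorm r p x : nrm x <= r -> nrm p.[x] <= pnorm r p.
Proof.
move=> xr; have r0 : 0 <= r := le_trans (nrm_ge0 _) xr.
elim/poly_ind: p => [|p c IH]; first by rewrite horner0 nrm0 pnorm0.
rewrite hornerMXaddC pnormE (le_trans (nrmD _ _))// lerD2r nrmM mulrC.
by rewrite ler_pM ?nrm_ge0.
Qed.

Lemma pnorm_comp r s p q : 0 <= s -> pnorm s q <= r ->
  pnorm s (p \Po q) <= pnorm r p.
Proof.
move=> s0 qr; have r0 : 0 <= r := le_trans (pnorm_ge0 _ s0) qr.
elim/poly_ind: p => [|p c IH]; first by rewrite comp_poly0 !pnorm0.
rewrite comp_poly_MXaddC pnormE (le_trans (pnormD _ _ s0))// pnormC lerD2r.
by rewrite (le_trans (pnormM _ _ s0))// mulrC ler_pM ?pnorm_ge0.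
Qed.

(** The common step of the inductions whose bound is K = [pnorm s p / (s - r)]: passing to
    [p * 'X + c%:P] costs r K + [pnorm s p], which equals [(s / (s - r)) * pnorm s p]. *)
Lemma pnorm_le_div r s p c : 0 <= r -> r < s ->
  (s / (s - r)) * pnorm s p <= pnorm s (p * 'X + c%:P) / (s - r).
Proof.
move=> r0 rs; have s0 : 0 <= s := le_trans r0 (ltW rs).
rewrite mulrAC ler_wpM2r ?invr_ge0 ?subr_ge0 ?(ltW rs)// pnormE lerDl nrm_ge0//.
Qed.

Lemma pnorm_div_ge0 r s p : 0 <= r -> r < s -> 0 <= pnorm s p / (s - r).
Proof.
by move=> r0 rs; rewrite divr_ge0 ?pnorm_ge0 ?(le_trans r0 (ltW rs))// subr_ge0 ltW.
Qed.

(** A Cauchy estimate for divided differences, at the price of the larger radius [s']. Constant [q]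
    and [q'] give [horner_lip]; general ones make composition continuous and the iteration for the
    inverse function a contraction. *)
Lemma pnorm_comp_lip r s s' p q q' : 0 <= s -> r < s' ->
  pnorm s q <= r -> pnorm s q' <= r ->
  pnorm s ((p \Po q) - (p \Po q')) <= pnorm s' p / (s' - r) * pnorm s (q - q').
Proof.
move=> s0 rs qr q'r; have r0 : 0 <= r := le_trans (pnorm_ge0 _ s0) qr.
have d0 : 0 < s' - r by rewrite subr_gt0.
elim/poly_ind: p => [|p c IH].
  by rewrite !comp_poly0 subr0 !pnorm0 !mul0r.
apply: le_trans (ler_wpM2r (pnorm_ge0 _ s0) (pnorm_le_div p c r0 rs)).
rewrite !comp_poly_MXaddC.
have -> : (p \Po q) * q + c%:P - ((p \Po q') * q' + c%:P) =
    ((p \Po q) - (p \Po q')) * q + (p \Po q') * (q - q') by ring.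
rewrite (le_trans (pnormD _ _ s0))//.
rewrite (le_trans (lerD (pnormM _ _ s0) (pnormM _ _ s0)))//.
set d := pnorm s (q - q') in IH *.
have h1 : pnorm s ((p \Po q) - (p \Po q')) * pnorm s q
    <= pnorm s' p / (s' - r) * d * r by rewrite ler_pM ?pnorm_ge0.
have h2 : pnorm s (p \Po q') * d <= pnorm s' p * d.
  rewrite ler_wpM2r ?pnorm_ge0// (le_trans (pnorm_comp _ s0 q'r))//.
  by rewrite pnorm_monotone// ltW.
rewrite (le_trans (lerD h1 h2))// le_eqVlt; apply/orP; left; apply/eqP.
by field; rewrite gt_eqF.
Qed.

Lemma pnorm_deriv r s p : 0 <= r -> r < s ->
  pnorm r p^`() <= pnorm s p / (s - r).
Proof.
move=> r0 rs; have d0 : 0 < s - r by rewrite subr_gt0.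
elim/poly_ind: p => [|p c IH]; first by rewrite deriv0 !pnorm0 mul0r.
apply: le_trans (pnorm_le_div p c r0 rs).
rewrite derivD derivM derivX derivC addr0 mulr1 (le_trans (pnormD _ _ r0))//.
have := pnormE r p^`() 0; rewrite addr0 nrm0 addr0 => ->.
rewrite (le_trans (lerD (ler_wpM2l r0 IH) (pnorm_monotone _ r0 (ltW rs))))//.
rewrite le_eqVlt; apply/orP; left; apply/eqP.
by field; rewrite gt_eqF.
Qed.

Lemma horner_lip r s p x y : nrm x <= r -> nrm y <= r -> r < s ->
  nrm (p.[x] - p.[y]) <= pnorm s p / (s - r) * nrm (x - y).
Proof.
move=> xr yr rs; have r0 : 0 <= r := le_trans (nrm_ge0 _) xr.
have := @pnorm_comp_lip r 0 s p x%:P y%:P (lexx _) rs.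
rewrite -polyCB !pnormC => /(_ xr yr); apply: le_trans.
by rewrite !comp_polyCr -polyCB pnormC.
Qed.

(** The bound depends on [p] only through its norm, so it survives limits; derivatives of limits of
    polynomials are found in this way. *)
Lemma horner_taylor2 r s p x h : nrm x <= r -> nrm (x + h) <= r -> r < s ->
  nrm (p.[x + h] - p.[x] - h * p^`().[x])
    <= pnorm s p / (s - r) ^+ 2 * nrm h ^+ 2.
Proof.
move=> xr yr rs; have r0 : 0 <= r := le_trans (nrm_ge0 _) xr.
have d0 : 0 < s - r by rewrite subr_gt0.
elim/poly_ind: p => [|p c IH].
  by rewrite deriv0 !horner0 mulr0 !subrr nrm0 pnorm0 !mul0r.
have st : s / (s - r) * pnorm s p / (s - r) * nrm h ^+ 2
    <= pnorm s (p * 'X + c%:P) / (s - r) ^+ 2 * nrm h ^+ 2.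
  rewrite ler_wpM2r ?exprn_ge0 ?nrm_ge0// expr2 invfM mulrA.
  by rewrite ler_wpM2r ?invr_ge0 ?(ltW d0)// pnorm_le_div.
apply: le_trans st.
rewrite derivD derivM derivX derivC addr0 mulr1 !(hornerD, hornerM, hornerX, hornerC).
have -> : p.[x + h] * (x + h) + c - (p.[x] * x + c) - h * (p^`().[x] * x + p.[x])
  = (p.[x + h] - p.[x] - h * p^`().[x]) * x + h * (p.[x + h] - p.[x]) by ring.
rewrite (le_trans (nrmD _ _))// !nrmM.
have h1 := ler_pM (nrm_ge0 _) (nrm_ge0 _) IH xr.
have h2 := ler_wpM2l (nrm_ge0 h) (horner_lip p yr xr rs).
rewrite (le_trans (lerD h1 h2))// [x + h - x]addrAC subrr add0r.
rewrite le_eqVlt; apply/orP; left; apply/eqP.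
by field; rewrite gt_eqF.
Qed.

End PolyNorm.

(* The completion of the polynomials for pnorm r: its elements are the functions
   with a power series that is absolutely convergent on the disc of radius r. *)
Section FastSequences.
Variable R : realType.
Local Notation C := (cplx R).
Implicit Types (p q : nat -> {poly C}) (r s : R) (x y c : C).

(** A geometric rate instead of a bare Cauchy condition: the operations below keep it with explicit
    constants, and completeness is needed only for geometric series. *)
Definition fast r p := exists2 K : R, 0 <= K &
  forall n, pnorm r (p n.+1 - p n) <= K * (2^-1) ^+ n.

Lemma half_ge0 n : 0 <= (2^-1 : R) ^+ n.
Proof. by rewrite exprn_ge0// invr_ge0. Qed.

Lemma fast_bounded r p : 0 <= r -> fast r p ->
  exists2 B : R, 0 <= B & forall n, pnorm r (p n) <= B.
Proof.
move=> r0 [K K0 pK]; exists (pnorm r (p 0%N) + 2 * K).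
  by rewrite addr_ge0 ?pnorm_ge0// mulr_ge0.
(* The bound is strengthened by the tail of the geometric series, to make the induction go
   through. *)
move=> n; suff : pnorm r (p n) <= pnorm r (p 0%N) + 2 * K - 2 * K * (2^-1) ^+ n.
  move=> /le_trans; apply; rewrite gerDl oppr_le0.
  by rewrite mulr_ge0 ?mulr_ge0 ?half_ge0.
elim: n => [|n IHn]; first by rewrite expr0 mulr1 addrK.
have -> : p n.+1 = (p n.+1 - p n) + p n by rewrite subrK.
rewrite (le_trans (pnormD _ _ r0))// (le_trans (lerD (pK n) IHn))// exprS.
by set y := _ ^+ n; lra.
Qed.

Lemma fast_cst r (P : {poly C}) : fast r (fun=> P).
Proof. by exists 0 => // n; rewrite subrr pnorm0 mul0r. Qed.

Lemma fastD r p q : 0 <= r -> fast r p -> fast r q -> fast r (fun n => p n + q n).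
Proof.
move=> r0 [K K0 pK] [L L0 qL]; exists (K + L); first exact: addr_ge0.
move=> n; rewrite opprD addrACA mulrDl (le_trans (pnormD _ _ r0))// lerD//.
Qed.

Lemma fastN r p : fast r p -> fast r (fun n => - p n).
Proof. by move=> [K K0 pK]; exists K => // n; rewrite -opprD pnormN. Qed.

Lemma fastM r p q : 0 <= r -> fast r p -> fast r q -> fast r (fun n => p n * q n).
Proof.
move=> r0 hp hq; have [A A0 pA] := fast_bounded r0 hp.
have [B B0 qB] := fast_bounded r0 hq; move: hp hq => [K K0 pK] [L L0 qL].
exists (K * B + A * L); first by rewrite addr_ge0 ?mulr_ge0.
move=> n; have -> : p n.+1 * q n.+1 - p n * q n
  = (p n.+1 - p n) * q n.+1 + p n * (q n.+1 - q n) by ring.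
rewrite (le_trans (pnormD _ _ r0))//.
rewrite (le_trans (lerD (pnormM _ _ r0) (pnormM _ _ r0)))//.
have h1 := ler_pM (pnorm_ge0 _ r0) (pnorm_ge0 _ r0) (pK n) (qB n.+1).
have h2 := ler_pM (pnorm_ge0 _ r0) (pnorm_ge0 _ r0) (pA n) (qL n).
by rewrite (le_trans (lerD h1 h2))// mulrDl mulrAC mulrA.
Qed.

Lemma fast_monotone r s p : 0 <= r -> r <= s -> fast s p -> fast r p.
Proof.
move=> r0 rs [K K0 pK]; exists K => // n.
by rewrite (le_trans (pnorm_monotone _ r0 rs)).
Qed.

Lemma fast_deriv r s p : 0 <= r -> r < s -> fast s p ->
  fast r (fun n => (p n)^`()).
Proof.
move=> r0 rs [K K0 pK]; exists (K / (s - r)).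
  by rewrite divr_ge0// subr_ge0 ltW.
move=> n; rewrite -derivB (le_trans (pnorm_deriv _ r0 rs))// mulrAC.
by rewrite ler_wpM2r// invr_ge0 subr_ge0 ltW.
Qed.

Lemma fast_comp r s s' p q : 0 <= s -> r < s' -> fast s' p -> fast s q ->
  (forall n, pnorm s (q n) <= r) -> fast s (fun n => p n \Po q n).
Proof.
move=> s0 rs hp [L L0 qL] qr.
have r0 : 0 <= r := le_trans (pnorm_ge0 _ s0) (qr 0%N).
have [A A0 pA] := fast_bounded (le_trans r0 (ltW rs)) hp.
move: hp => [K K0 pK]; exists (K + A / (s' - r) * L).
  by rewrite addr_ge0// mulr_ge0// divr_ge0// subr_ge0 ltW.
move=> n.
have -> : (p n.+1 \Po q n.+1) - (p n \Po q n) =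
  ((p n.+1 - p n) \Po q n.+1) + ((p n \Po q n.+1) - (p n \Po q n)).
  by rewrite comp_polyB; ring.
rewrite (le_trans (pnormD _ _ s0))// mulrDl lerD//.
  rewrite (le_trans (pnorm_comp _ s0 (qr _)))//.
  by rewrite (le_trans (pnorm_monotone _ r0 (ltW rs))).
rewrite (le_trans (pnorm_comp_lip _ s0 rs (qr _) (qr _)))// -[leRHS]mulrA.
rewrite ler_pM ?pnorm_div_ge0 ?pnorm_ge0//.
by rewrite ler_wpM2r// invr_ge0 subr_ge0 ltW.
Qed.

Lemma fast_horner r p x : nrm x <= r -> fast r p -> exists2 K : R, 0 <= K &
  forall n, nrm ((p n.+1).[x] - (p n).[x]) <= K * (2^-1) ^+ n.
Proof.
move=> xr [K K0 pK]; exists K => // n.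
by rewrite -hornerN -hornerD (le_trans (horner_pnorm _ xr)).
Qed.

Lemma fast_cvg r p x : nrm x <= r -> fast r p ->
  exists l : C, (fun n => (p n).[x]) @ \oo --> l.
Proof. by move=> xr /(fast_horner xr)[K K0 /fast_limit]. Qed.

End FastSequences.

(** * Analytic germs as limits of polynomials *)

Section Representation.
Variable R : realType.
Local Notation C := (cplx R).
Implicit Types (f g : C -> C) (p q : nat -> {poly C}) (r s : R) (a x y c : C).

Lemma pnorm_drop r s (P : {poly C}) n : 0 <= r -> r <= s -> 0 < s ->
  pnorm r (P - take_poly n P) <= (r / s) ^+ n * pnorm s P.
Proof.
move=> r0 rs s0.
have sz : (size (P - take_poly n P)%R <= size P)%N.
  by apply/leq_sizeP => j hj; rewrite coefB coef_take_poly nth_default// if_same subrr.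
rewrite (pnorm_widen _ sz) /pnorm mulr_sumr; apply: ler_sum => -[i ip] _ /=.
rewrite coefB coef_take_poly; case: ltnP => ni.
  rewrite subrr nrm0 mul0r !mulr_ge0 ?nrm_ge0 ?exprn_ge0 ?(ltW s0)//.
  by rewrite divr_ge0 ?(ltW s0).
rewrite subr0 mulrCA ler_wpM2l ?nrm_ge0// -(subnK ni) !exprD expr_div_n.
set k := (i - n)%N.
have -> : r ^+ n / s ^+ n * (s ^+ k * s ^+ n) = s ^+ k * r ^+ n.
  by field; rewrite expf_neq0// gt_eqF.
by rewrite ler_wpM2r ?exprn_ge0// lerXn2r ?nnegrE ?(ltW s0).
Qed.

(** The analogue of the Schwarz lemma for this norm: each zero at the centre gains a factor
    [r / s]. *)
Lemma pnorm_shrink r s (P : {poly C}) n : 0 <= r -> r <= s -> 0 < s ->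
  (forall i, (i < n)%N -> P`_i = 0) -> pnorm r P <= (r / s) ^+ n * pnorm s P.
Proof.
move=> r0 rs s0 P0; have := @pnorm_drop r s P n r0 rs s0.
suff -> : take_poly n P = 0 by rewrite subr0.
by apply/polyP => i; rewrite coef_take_poly coef0; case: ltnP => // /P0.
Qed.

(** Any fast sequence is allowed, since products and composites of partial sums of power series are
    in general no partial sums; and, unlike in [analytic_at], the radius is explicit. *)
Definition rep f a r p := [/\ 0 < r, fast r p & forall x, nrm (x - a) <= r ->
  (fun n => (p n).[x - a]) @ \oo --> f x].

Lemma rep_shrink f a r s p : 0 < s -> s <= r -> rep f a r p -> rep f a s p.
Proof.
move=> s0 sr [r0 hp hf]; split; first exact: s0.
  by apply: fast_monotone hp; [exact: ltW|].
by move=> x xs; apply: hf; exact: le_trans xs sr.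
Qed.

Lemma analytic_near_eq f g a : (\forall x \near a, f x = g x) ->
  analytic_at f a -> analytic_at g a.
Proof.
by move=> fg [c hc]; exists c; apply: filterS2 fg hc => x ->.
Qed.

(** The Taylor coefficients are the limits of the coefficients of [p n]. At half the radius the
    terms of degree at least N contribute at most 2^-N times the common bound of the norms. *)
Lemma rep_analytic f a r p : rep f a r p -> analytic_at f a.
Proof.
move=> [r0 hp hf].
have [B B0 pB] := fast_bounded (ltW r0) hp.
have /choice[c hc] k : exists l : C, (fun n => (p n)`_k) @ \oo --> l.
  case: hp => K K0 pK; apply: (@fast_limit _ _ (K / r ^+ k)) => n.
  rewrite mulrAC ler_pdivlMr ?exprn_gt0// (le_trans _ (pK n))//.
  by rewrite -coefB coef_pnorm// ltW.
exists c; apply/near_nrm; exists (r / 2); first by rewrite divr_gt0.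
move=> x xr; set y := x - a in xr *.
have bound N : nrm (f x - \sum_(0 <= k < N) c k * y ^+ k) <= (2^-1) ^+ N * B.
  rewrite -[_ - _]subr0.
  have lim : (fun n => (p n - take_poly N (p n)).[y]) @ \oo
      --> f x - \sum_(0 <= k < N) c k * y ^+ k.
    under eq_fun do rewrite hornerD hornerN /take_poly horner_poly
      -(big_mkord xpredT (fun k => _`_k * y ^+ k)).
    apply: cvgB.
      by apply: hf; rewrite -/y; lra.
    elim: N => [|N IHN].
      rewrite [X in _ --> X]big_geq//.
      under eq_fun do rewrite big_geq//.
      exact: cvg_cst.
    rewrite [X in _ --> X](big_nat_recr _ _ _ (leq0n N)).
    under eq_fun do rewrite (big_nat_recr _ _ _ (leq0n N)).
    by apply: cvgD; [exact: IHN|apply: cvgMl; exact: hc].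
  apply: (nrm_le_lim lim) => n; rewrite subr0.
  rewrite (le_trans (horner_pnorm _ (ltW xr)))//.
  have r20 : 0 <= r / 2 by lra.
  have r2r : r / 2 <= r by lra.
  rewrite (le_trans (pnorm_drop _ _ r20 r2r r0))//.
  by rewrite mulrAC divff ?gt_eqF// mul1r ler_wpM2l ?half_ge0.
apply/cvgn_nrm => e e0; have [N HN] := expr_half_lt B e0; exists N => n Nn.
by rewrite /series /= nrm_distC (le_lt_trans (bound n))// mulrC HN.
Qed.

(** Abel's lemma: convergence at one point at distance s bounds all terms c_k s^k, and at radius s /
    2 the partial sums then converge at a geometric rate. *)
Lemma analytic_rep f a : analytic_at f a -> exists r p, rep f a r p.
Proof.
move=> [c /near_nrm[e e0 hc]]; set s := e / 2.
have s0 : 0 < s by rewrite divr_gt0.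
have se : s < e by rewrite /s; lra.
have ns : nrm (RtoC R s) = s by rewrite nrm_RtoC_ge0// ltW.
have := hc (a + RtoC R s); rewrite addrAC subrr add0r ns => /(_ se).
set l := f _ => hl.
have [M M0 hM] : exists2 M : R, 0 <= M & forall k, nrm (c k) * s ^+ k <= M.
  move/cvgn_nrm: hl => /(_ 1 ltr01)[N HN].
  (* Each term is the difference of two partial sums within distance 1 of the limit. *)
  have big k : (N <= k)%N -> nrm (c k) * s ^+ k <= 2.
    move=> Nk; have h1 := HN _ Nk; have h2 := HN _ (leqW Nk).
    have -> : nrm (c k) * s ^+ k = nrm (c k * RtoC R s ^+ k) by rewrite nrmM nrmX ns.
    move: h1 h2; rewrite /series /= big_nat_recr//=.
    set S := \sum_(_ <= _ < _) _; set T := c k * _ => h1 h2.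
    have -> : T = (S + T - l) - (S - l) by ring.
    by have := nrmB (S + T - l) (S - l); lra.
  exists (\sum_(0 <= k < N) nrm (c k) * s ^+ k + 2).
    by rewrite addr_ge0// sumr_ge0// => k _; rewrite mulr_ge0 ?nrm_ge0 ?exprn_ge0 ?ltW.
  have pos (P : pred nat) : 0 <= \sum_(0 <= k < N | P k) nrm (c k) * s ^+ k.
    by rewrite sumr_ge0// => k _; rewrite mulr_ge0 ?nrm_ge0 ?exprn_ge0 ?ltW.
  move=> k; have [Nk|kN] := leqP N k; first by rewrite (le_trans (big _ Nk))// lerDr.
  rewrite (bigD1_seq k) ?mem_index_iota ?iota_uniq//= -addrA lerDl addr_ge0//.
have sr0 : 0 <= s / 2 by lra.
exists (s / 2), (fun n => \poly_(k < n) c k); split; first by rewrite divr_gt0.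
  exists M => // n.
  have -> : \poly_(k < n.+1) c k - \poly_(k < n) c k = c n *: 'X^n.
    apply/polyP => i; rewrite coefB !coef_poly coefZ coefXn ltnS leq_eqVlt.
    by case: ltngtP => [h|h|->]; rewrite ?subrr ?subr0 ?mulr0 ?mulr1//= ?subrr.
  rewrite -mul_polyC [_%:P * _]mulrC pnormMC//.
  have -> : pnorm (s / 2) ('X^n : {poly C}) = (s / 2) ^+ n.
    elim: n => [|n IH]; first by rewrite !expr0 -polyC1 pnormC nrm1.
    have := pnormE (s / 2) ('X^n : {poly C}) 0; rewrite addr0 nrm0 addr0 -exprSr => ->.
    by rewrite IH exprS.
  by rewrite exprMn mulrA ler_wpM2r ?half_ge0.
move=> x xs; have := hc x.
have h : nrm (x - a) < e.
  by lra.
move=> /(_ h).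
have -> : [series c k * (x - a) ^+ k]_k = (fun n => (\poly_(k < n) c k).[x - a]).
  by apply/funext => n; rewrite horner_poly /series /= big_mkord.
exact.
Qed.

End Representation.

(** * Operations on represented functions *)

Section Closure.
Variable R : realType.
Local Notation C := (cplx R).
Implicit Types (f g : C -> C) (p q : nat -> {poly C}) (r s : R) (a b x y c : C).

Lemma rep_pointwise f a r p x : rep f a r p -> nrm (x - a) <= r ->
  (fun n => (p n).[x - a]) @ \oo --> f x.
Proof. by case=> _ _ hf; exact: hf. Qed.

Lemma rep_at f a r p : rep f a r p -> (fun n => (p n).[0]) @ \oo --> f a.
Proof.
move=> h; have := rep_pointwise (x := a) h; rewrite subrr nrm0; apply.
by case: h => /ltW.
Qed.

Lemma rep_cst c a r : 0 < r -> rep (fun=> c) a r (fun=> c%:P).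
Proof.
move=> r0; split; [exact: r0|exact: fast_cst|] => x _.
under eq_fun do rewrite hornerC.
exact: cvg_cst.
Qed.

Lemma rep_id a r : 0 < r -> rep id a r (fun=> 'X + a%:P).
Proof.
move=> r0; split; [exact: r0|exact: fast_cst|] => x _.
under eq_fun do rewrite !hornerE subrK.
exact: cvg_cst.
Qed.

Lemma repD f g a r p q : rep f a r p -> rep g a r q ->
  rep (fun x => f x + g x) a r (fun n => p n + q n).
Proof.
move=> [r0 hp hf] [_ hq hg]; split; first exact: r0.
  by apply: fastD; [exact: ltW|exact: hp|exact: hq].
move=> x xr; under eq_fun do rewrite hornerD.
by apply: cvgD; [exact: hf|exact: hg].
Qed.

Lemma repN f a r p : rep f a r p -> rep (fun x => - f x) a r (fun n => - p n).
Proof.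
move=> [r0 hp hf]; split; [exact: r0|exact: fastN|] => x xr.
under eq_fun do rewrite hornerN.
by apply: cvgN; exact: hf.
Qed.

Lemma repM f g a r p q : rep f a r p -> rep g a r q ->
  rep (fun x => f x * g x) a r (fun n => p n * q n).
Proof.
move=> [r0 hp hf] [_ hq hg]; split; first exact: r0.
  by apply: fastM; [exact: ltW|exact: hp|exact: hq].
move=> x xr; under eq_fun do rewrite hornerM.
by apply: cvgM; [exact: hf|exact: hg].
Qed.

Lemma rep_common f g a r s p q : rep f a r p -> rep g a s q ->
  exists2 t : R, 0 < t & rep f a t p /\ rep g a t q.
Proof.
move=> hf hg; have r0 : 0 < r by case: hf.
have s0 : 0 < s by case: hg.
exists (Num.min r s); first by rewrite lt_min r0.
split; [apply: rep_shrink hf|apply: rep_shrink hg].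
- by rewrite lt_min r0.
- by rewrite ge_min lexx.
- by rewrite lt_min r0.
- by rewrite ge_min lexx orbT.
Qed.

Lemma nrm_cvg (u v : nat -> C) (l m : C) (b : R) : u @ \oo --> l -> v @ \oo --> m ->
  (forall n, nrm (u n - v n) <= b) -> nrm (l - m) <= b.
Proof.
move=> hu hv huv; have huv' : (fun n => u n - v n) @ \oo --> l - m.
  by apply: cvgB; [exact: hu|exact: hv].
by rewrite -[_ - _]subr0; apply: (nrm_le_lim huv') => n; rewrite subr0; exact: huv.
Qed.

(** The estimate [horner_taylor2] passes to the limit because the norms are bounded; limit and
    derivative need not be interchanged. *)
Lemma rep_taylor f a r p x : rep f a r p -> nrm (x - a) < r ->
  exists2 l : C, (fun n => (p n)^`().[x - a]) @ \oo --> l &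
  exists2 K : R, 0 <= K & exists2 e : R, 0 < e &
    forall h, nrm h < e -> nrm (f (x + h) - f x - h * l) <= K * nrm h ^+ 2.
Proof.
move=> hf xr; have [r0 hp _] := hf.
set s := (nrm (x - a) + r) / 2.
have sr : s < r by rewrite /s; lra.
have xs : nrm (x - a) < s by rewrite /s; lra.
have s0 : 0 <= s by have := nrm_ge0 (x - a); lra.
have [l hl] := fast_cvg (ltW xs) (fast_deriv s0 sr hp).
exists l; first exact: hl.
have [B B0 pB] := fast_bounded (ltW r0) hp.
have d0 : 0 < r - s by rewrite subr_gt0.
exists (B / (r - s) ^+ 2); first by rewrite divr_ge0// exprn_ge0// ltW.
exists (s - nrm (x - a)); first by rewrite subr_gt0.
move=> h hh.
have E : x + h - a = x - a + h by rewrite addrAC.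
have hs : nrm (x - a + h) <= s by have := nrmD (x - a) h; lra.
have c1 : (fun n => (p n).[x - a + h]) @ \oo --> f (x + h).
  by rewrite -E; apply: (rep_pointwise hf); rewrite E; lra.
have c2 : (fun n => (p n).[x - a] + h * (p n)^`().[x - a]) @ \oo --> f x + h * l.
  apply: cvgD; first by apply: (rep_pointwise hf); exact: ltW.
  by apply: cvgMr; exact: hl.
rewrite -addrA -opprD; apply: (nrm_cvg c1 c2) => n.
rewrite opprD addrA (le_trans (horner_taylor2 _ (ltW xs) hs sr))//.
by rewrite ler_wpM2r ?exprn_ge0 ?nrm_ge0// ler_wpM2r// invr_ge0 exprn_ge0// ltW.
Qed.

Lemma derive1_taylor f x (l : C) (K e : R) : 0 < e ->
  (forall h, nrm h < e -> nrm (f (x + h) - f x - h * l) <= K * nrm h ^+ 2) ->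
  derive1 f x = l.
Proof.
move=> e0 H; rewrite /derive1; apply: cvg_lim; first exact: norm_hausdorff.
move=> A /near_nrm[d d0 hA]; apply/dnear_nrm.
have K1 : 0 < `|K| + 1 by rewrite ltr_wpDl.
exists (Num.min e (d / (`|K| + 1))); first by rewrite lt_min e0 divr_gt0.
move=> h; rewrite subr0 lt_min => /andP[h0 /andP[he hd]]; apply: hA.
have -> : h^-1 *: (f (h + x) - f x) - l = h^-1 * (f (x + h) - f x - h * l).
  rewrite mulrBr mulKf; last by rewrite -nrm_gt0.
  by rewrite [h + x]addrC.
rewrite nrmM nrmV mulrC ltr_pdivrMr// (le_lt_trans (H h he))//.
rewrite expr2 mulrA ltr_pM2r//.
move: hd; rewrite ltr_pdivlMr// mulrDr mulr1 [nrm h * _]mulrC.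
have : K * nrm h <= `|K| * nrm h by rewrite ler_wpM2r ?nrm_ge0// ler_norm.
lra.
Qed.

Lemma rep_derive1 f a r p x : rep f a r p -> nrm (x - a) < r ->
  (fun n => (p n)^`().[x - a]) @ \oo --> derive1 f x.
Proof.
move=> hf xr; have [l hl [K K0 [e e0 H]]] := rep_taylor hf xr.
by rewrite (derive1_taylor e0 H); exact: hl.
Qed.

Lemma rep_deriv f a r s p : 0 < s -> s < r -> rep f a r p ->
  rep (derive1 f) a s (fun n => (p n)^`()).
Proof.
move=> s0 sr hf; have [r0 hp _] := hf; split; first exact: s0.
  by apply: fast_deriv hp; [exact: ltW|exact: sr].
by move=> x xs; apply: (rep_derive1 hf); exact: le_lt_trans sr.
Qed.

Lemma rep_shift f a r p b : rep f a r p -> nrm (b - a) < r ->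
  rep f b (r - nrm (b - a)) (fun n => p n \Po ('X + (b - a)%:P)).
Proof.
move=> hf br; have [r0 hp _] := hf; split; first by rewrite subr_gt0.
  set s := r - _; have s0 : 0 < s by rewrite subr_gt0.
  have bnd : pnorm s ('X + (b - a)%:P) <= r.
    by rewrite (le_trans (pnormD _ _ (ltW s0)))// pnormX pnormC subrK.
  case: hp => K K0 pK; exists K; first exact: K0.
  by move=> n; rewrite -comp_polyB (le_trans (pnorm_comp _ (ltW s0) bnd)).
move=> x xs.
have E n : (p n \Po ('X + (b - a)%:P)).[x - b] = (p n).[x - a].
  by rewrite horner_comp hornerD hornerX hornerC; congr (_.[_]); ring.
under eq_fun do rewrite E.
by apply: (rep_pointwise hf); have := nrm_dist_tri x b a; lra.
Qed.

(** Without its constant term each [q n] vanishes exactly at the centre, so its norm is small on a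
    small disc; the constant terms themselves tend to [g a = b]. *)
Lemma rep_comp f g a b r s p q : rep f b r p -> rep g a s q -> g a = b ->
  exists2 s' : R, 0 < s' &
    rep (f \o g) a s' (fun n => p n \Po (q n - (q n).[0]%:P)).
Proof.
move=> hf hg gab; have [r0 hp _] := hf; have [s0 hq _] := hg.
pose q' n := q n - (q n).[0]%:P.
have hq' : rep (fun x => g x - b) a s q'.
  split; first exact: s0.
    case: hq => K K0 qK; exists (2 * K); first by rewrite mulr_ge0.
    move=> n; rewrite /q' opprD addrACA -opprD -polyCB.
    rewrite (le_trans (pnormB _ _ (ltW s0)))// pnormC -hornerN -hornerD.
    have : nrm (q n.+1 - q n).[0] <= pnorm s (q n.+1 - q n).
      by apply: horner_pnorm; rewrite nrm0 ltW.
    by have := qK n; lra.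
  move=> x xs; under eq_fun do rewrite hornerD hornerN hornerC.
  by rewrite -gab; apply: cvgB; [exact: rep_pointwise hg xs|exact: rep_at hg].
have [_ fq' _] := hq'.
have [B B0 qB] := fast_bounded (ltW s0) fq'.
set rho := r / 2; have rho0 : 0 < rho by rewrite divr_gt0.
have rhor : rho < r by rewrite /rho; lra.
have B1 : 0 < B + 1 by lra.
(* By [pnorm_shrink] the norm of [q' n] at radius [s'] is at most [s' / s * B], hence at most [rho];
   B + 1 keeps the denominator positive. *)
pose s' := Num.min s (rho * s / (B + 1)).
have s'0 : 0 < s' by rewrite lt_min s0 divr_gt0// mulr_gt0.
have s's : s' <= s by rewrite ge_min lexx.
have q'rho n : pnorm s' (q' n) <= rho.
  have := @pnorm_shrink R s' s (q' n) 1 (ltW s'0) s's s0; rewrite expr1.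
  have z0 i : (i < 1)%N -> (q' n)`_i = 0.
    by case: i => // _; rewrite coefB coefC /= horner_coef0 subrr.
  move=> /(_ z0) h; rewrite (le_trans h)// (le_trans (ler_wpM2l _ (qB n)))//.
    by rewrite divr_ge0 ?(ltW s'0) ?(ltW s0).
  have : s' <= rho * s / (B + 1) by rewrite ge_min lexx orbT.
  rewrite ler_pdivlMr// => h2.
  rewrite mulrAC ler_pdivrMr// (le_trans _ h2)// ler_wpM2l ?(ltW s'0)//; lra.
exists s'; first exact: s'0.
have fc : fast s' (fun n => p n \Po q' n).
  apply: (fast_comp (ltW s'0) rhor hp) => //.
  exact: fast_monotone (ltW s'0) s's fq'.
split; [exact: s'0|exact: fc|] => x xs'.
have xs : nrm (x - a) <= s by exact: le_trans s's.
have h1 := rep_pointwise hq' xs; set u := g x - b in h1.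
have ur : nrm u <= rho.
  rewrite -[u]subr0; apply: (nrm_le_lim h1) => n; rewrite subr0.
  by rewrite (le_trans (horner_pnorm _ xs')).
have h2 : (fun n => (p n).[u]) @ \oo --> f (g x).
  by apply: (rep_pointwise hf); rewrite (le_trans ur)// ltW.
have [A A0 pA] := fast_bounded (ltW r0) hp.
apply/cvgn_nrm => e e0.
set L := A / (r - rho).
have L0 : 0 <= L by rewrite divr_ge0// subr_ge0 ltW.
have e1 : 0 < e / 2 by rewrite divr_gt0.
have e2 : 0 < e / 2 / (L + 1) by rewrite divr_gt0//; lra.
have [N1 H1] := (cvgn_nrm _ _).1 h1 _ e2.
have [N2 H2] := (cvgn_nrm _ _).1 h2 _ e1.
exists (maxn N1 N2) => n; rewrite geq_max => /andP[n1 n2].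
rewrite horner_comp; set y := (q n - _).[_].
have yr : nrm y <= rho by rewrite (le_trans (horner_pnorm _ xs'))//; exact: q'rho.
apply: le_lt_trans (nrm_dist_tri _ (p n).[u] _) _.
rewrite [e]splitr; apply: ler_ltD; last exact: H2.
have h3 : nrm (y - u) < e / 2 / (L + 1) by exact: H1.
rewrite (le_trans (horner_lip (p n) yr ur rhor))//.
have h4 : pnorm r (p n) / (r - rho) <= L by rewrite ler_wpM2r// invr_ge0 subr_ge0 ltW.
rewrite (le_trans (ler_wpM2r (nrm_ge0 _) h4))//.
move: h3; rewrite ltr_pdivlMr; last by lra.
have := nrm_ge0 (y - u); set d := nrm _ => d0 h3.
have E : d * (L + 1) = L * d + d by ring.
lra.
Qed.

End Closure.

(** * Analytic functions and their derivatives *)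

Section Analytic.
Variable R : realType.
Local Notation C := (cplx R).
Implicit Types (f g : C -> C) (a b x y c : C).

Lemma analytic_cst c a : analytic_at (fun=> c) a.
Proof. by have := rep_cst c a (@ltr01 R); exact: rep_analytic. Qed.

Lemma analytic_id a : analytic_at id a.
Proof. by have := rep_id a (@ltr01 R); exact: rep_analytic. Qed.

Lemma analyticD f g a : analytic_at f a -> analytic_at g a ->
  analytic_at (fun x => f x + g x) a.
Proof.
move=> /analytic_rep[r [p hf]] /analytic_rep[s [q hg]].
have [t t0 [hf' hg']] := rep_common hf hg.
exact: rep_analytic (repD hf' hg').
Qed.

Lemma analyticN f a : analytic_at f a -> analytic_at (fun x => - f x) a.
Proof. by move=> /analytic_rep[r [p hf]]; exact: rep_analytic (repN hf). Qed.

Lemma analyticB f g a : analytic_at f a -> analytic_at g a ->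
  analytic_at (fun x => f x - g x) a.
Proof. by move=> hf hg; apply: analyticD; [exact: hf|exact: analyticN]. Qed.

Lemma analyticM f g a : analytic_at f a -> analytic_at g a ->
  analytic_at (fun x => f x * g x) a.
Proof.
move=> /analytic_rep[r [p hf]] /analytic_rep[s [q hg]].
have [t t0 [hf' hg']] := rep_common hf hg.
exact: rep_analytic (repM hf' hg').
Qed.

Lemma analyticX f a n : analytic_at f a -> analytic_at (fun x => f x ^+ n) a.
Proof.
move=> hf; elim: n => [|n IHn]; first exact: analytic_cst.
by under eq_fun do rewrite exprS; apply: analyticM.
Qed.

Lemma analytic_comp f g a : analytic_at f (g a) -> analytic_at g a ->
  analytic_at (f \o g) a.
Proof.
move=> /analytic_rep[r [p hf]] /analytic_rep[s [q hg]].
have [t t0 h] := rep_comp hf hg erefl.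
exact: rep_analytic h.
Qed.

Lemma analytic_near f a : analytic_at f a -> \forall x \near a, analytic_at f x.
Proof.
move=> /analytic_rep[r [p hf]]; apply/near_nrm; exists r; first by case: hf.
by move=> x xr; exact: rep_analytic (rep_shift hf xr).
Qed.

Lemma analytic_derive1 f a : analytic_at f a -> analytic_at (derive1 f) a.
Proof.
move=> /analytic_rep[r [p hf]]; have r0 : 0 < r by case: hf.
have h0 : 0 < r / 2 by lra.
have h1 : r / 2 < r by lra.
exact: rep_analytic (rep_deriv h0 h1 hf).
Qed.

Lemma analytic_taylor f a : analytic_at f a ->
  exists2 K : R, 0 <= K & exists2 e : R, 0 < e & forall h, nrm h < e ->
    nrm (f (a + h) - f a - h * derive1 f a) <= K * nrm h ^+ 2.
Proof.
move=> /analytic_rep[r [p hf]].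
have aa : nrm (a - a) < r by rewrite subrr nrm0; case: hf.
have [l hl [K K0 [e e0 H]]] := rep_taylor hf aa.
exists K; first exact: K0.
by exists e; [exact: e0|rewrite (derive1_taylor e0 H)].
Qed.

Lemma analytic_lipschitz f a : analytic_at f a ->
  exists2 K : R, 0 < K & exists2 e : R, 0 < e & forall x, nrm (x - a) < e ->
    nrm (f x - f a) <= K * nrm (x - a).
Proof.
move=> /analytic_taylor[K K0 [e e0 H]].
exists (K + nrm (derive1 f a) + 1); first by have := nrm_ge0 (derive1 f a); lra.
exists (Num.min e 1); first by rewrite lt_min e0 ltr01.
move=> x; rewrite lt_min => /andP[xe x1].
have := H _ xe; rewrite [a + _]addrC subrK => h.
have -> : f x - f a = (f x - f a - (x - a) * derive1 f a) + (x - a) * derive1 f a.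
  by rewrite subrK.
rewrite (le_trans (nrmD _ _))// nrmM.
set d := nrm (x - a) in h x1 *.
have d0 : 0 <= d by exact: nrm_ge0.
have : K * d ^+ 2 <= K * d by rewrite expr2 mulrA ler_piMr ?mulr_ge0// ltW.
set D := nrm _ in h *; set E := nrm _.
have -> : (K + E + 1) * d = K * d + E * d + d by ring.
have -> : d * E = E * d by ring.
by move: h; lra.
Qed.

Lemma near_analytic f a (P : C -> Prop) : analytic_at f a ->
  (\forall y \near f a, P y) -> \forall x \near a, P (f x).
Proof.
move=> /analytic_lipschitz[K K0 [e e0 H]] /near_nrm[d d0 hP].
apply/near_nrm; exists (Num.min e (d / K)).
  by rewrite lt_min e0 divr_gt0.
move=> x; rewrite lt_min => /andP[xe xd]; apply: hP.
by rewrite (le_lt_trans (H _ xe))// mulrC -ltr_pdivlMr.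
Qed.

Lemma near_neq (a b : C) : a != b -> \forall x \near a, x != b.
Proof.
move=> ab; apply/near_nrm; exists (nrm (a - b)); first by rewrite nrm_gt0 subr_eq0.
by move=> x; apply: contraTneq => ->; rewrite nrm_distC ltxx.
Qed.

Lemma near_neq0 f a : analytic_at f a -> f a != 0 -> \forall x \near a, f x != 0.
Proof. by move=> hf f0; exact: (near_analytic (P := fun y => y != 0) hf (near_neq f0)). Qed.

Lemma near_near (P : C -> Prop) a : (\forall x \near a, P x) ->
  \forall x \near a, \forall y \near x, P y.
Proof. exact: near_join. Qed.

Lemma derive1_near f g a : (\forall x \near a, f x = g x) -> derive1 f a = derive1 g a.
Proof. by rewrite !derive1E; exact: near_eq_derive. Qed.

Lemma near_derive1 f g a : (\forall x \near a, f x = g x) ->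
  \forall x \near a, derive1 f x = derive1 g x.
Proof.
by move=> h; apply: filterS (near_near h) => x; exact: derive1_near.
Qed.

Lemma derive1_cst_fun c a : derive1 (fun=> c : C) a = 0.
Proof.
apply: (@derive1_taylor _ _ _ _ 0 1 ltr01) => h _.
by rewrite (_ : _ - _ - _ = 0) ?nrm0 ?mul0r//=; ring.
Qed.

Lemma derive1_id_fun a : derive1 (fun x : C => x) a = 1.
Proof.
apply: (@derive1_taylor _ _ _ _ 0 1 ltr01) => h _.
by rewrite (_ : _ - _ - _ = 0) ?nrm0 ?mul0r//=; ring.
Qed.

Lemma derive1D f g a : analytic_at f a -> analytic_at g a ->
  derive1 (fun x => f x + g x) a = derive1 f a + derive1 g a.
Proof.
move=> /analytic_taylor[K K0 [e e0 H]] /analytic_taylor[L L0 [d d0 G]].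
apply: (@derive1_taylor _ _ _ _ (K + L) (Num.min e d)); first by rewrite lt_min e0.
move=> h; rewrite lt_min => /andP[/H h1 /G h2].
set u := derive1 f a in h1 *; set v := derive1 g a in h2 *.
have -> : f (a + h) + g (a + h) - (f a + g a) - h * (u + v) =
  (f (a + h) - f a - h * u) + (g (a + h) - g a - h * v) by ring.
by rewrite (le_trans (nrmD _ _))// mulrDl lerD.
Qed.

Lemma derive1M f g a : analytic_at f a -> analytic_at g a ->
  derive1 (fun x => f x * g x) a = derive1 f a * g a + f a * derive1 g a.
Proof.
move=> /analytic_rep[r [p hf]] /analytic_rep[s [q hg]].
have [t t0 [hf' hg']] := rep_common hf hg.
have aa : nrm (a - a) < t by rewrite subrr nrm0.
apply: nrm_limit_unique (rep_derive1 (repM hf' hg') aa) _.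
under eq_fun do rewrite derivM hornerD !hornerM.
apply: cvgD; apply: cvgM.
- exact: rep_derive1 hf' aa.
- exact: rep_pointwise hg' (ltW aa).
- exact: rep_pointwise hf' (ltW aa).
- exact: rep_derive1 hg' aa.
Qed.

Lemma derive1N f a : analytic_at f a -> derive1 (fun x => - f x) a = - derive1 f a.
Proof.
move=> hf; have -> : (fun x => - f x) = (fun x => (fun=> -1 : C) x * f x).
  by apply/funext => x; rewrite mulN1r.
rewrite derive1M; [|exact: analytic_cst|exact: hf].
by rewrite derive1_cst_fun mul0r add0r mulN1r.
Qed.

Lemma derive1B f g a : analytic_at f a -> analytic_at g a ->
  derive1 (fun x => f x - g x) a = derive1 f a - derive1 g a.
Proof.
move=> hf hg; rewrite derive1D; [|exact: hf|exact: analyticN].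
by rewrite (derive1N hg).
Qed.

Lemma derive1Z c f a : analytic_at f a -> derive1 (fun x => c * f x) a = c * derive1 f a.
Proof.
move=> hf; rewrite (@derive1M (fun=> c)); [|exact: analytic_cst|exact: hf].
by rewrite derive1_cst_fun mul0r add0r.
Qed.

Lemma derive1X2 f a : analytic_at f a ->
  derive1 (fun x => f x ^+ 2) a = 2 * f a * derive1 f a.
Proof.
by move=> hf; under eq_fun do rewrite expr2; rewrite (derive1M hf hf); ring.
Qed.

Lemma derive1_chain f g a : analytic_at f (g a) -> analytic_at g a ->
  derive1 (f \o g) a = derive1 f (g a) * derive1 g a.
Proof.
move=> /analytic_taylor[K K0 [e e0 H]] hg.
have [M M0 [e' e'0 G']] := analytic_lipschitz hg.
have [L L0 [d d0 G]] := analytic_taylor hg.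
pose m := Num.min (Num.min d e') (e / M).
apply: (@derive1_taylor _ _ _ _ (K * M ^+ 2 + nrm (derive1 f (g a)) * L) m).
  by rewrite !lt_min d0 e'0 divr_gt0.
move=> h; rewrite !lt_min -andbA => /and3P[/G h1 he' hm].
have h2 : nrm (g (a + h) - g a) <= M * nrm h.
  by have := G' (a + h); rewrite addrAC subrr add0r; exact.
set k := g (a + h) - g a in h1 h2.
have ke : nrm k < e by rewrite (le_lt_trans h2)// mulrC -ltr_pdivlMr.
have := H _ ke; rewrite {1}/k [g a + _]addrC subrK => h3.
set u := derive1 f _ in h3 *; set v := derive1 g _ in h1 *.
have -> : (f \o g) (a + h) - (f \o g) a - h * (u * v) =
  (f (g (a + h)) - f (g a) - k * u) + u * (k - h * v) by rewrite /k /=; ring.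
rewrite (le_trans (nrmD _ _))// [leRHS]mulrDl lerD//.
  rewrite (le_trans h3)// -mulrA ler_wpM2l// -exprMn.
  by rewrite lerXn2r ?nnegrE ?nrm_ge0// (le_trans (nrm_ge0 _) h2).
by rewrite nrmM -mulrA ler_wpM2l ?nrm_ge0.
Qed.

(** The geometric series of 1 / (b + (x - b)); on the disc of radius |b| / 2 its ratio is at most
    1/2. *)
Lemma analytic_inv b : b != 0 -> analytic_at (fun x : C => x^-1) b.
Proof.
move=> b0; have nb : 0 < nrm b by rewrite nrm_gt0.
apply: (@rep_analytic _ _ _ (nrm b / 2)
  (fun n => \poly_(k < n) ((-1) ^+ k / b ^+ k.+1))); split; first by lra.
  exists (nrm b)^-1; first by rewrite invr_ge0 ltW.
  move=> n; have -> : \poly_(k < n.+1) ((-1) ^+ k / b ^+ k.+1)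
      - \poly_(k < n) ((-1) ^+ k / b ^+ k.+1) = ((-1) ^+ n / b ^+ n.+1) *: 'X^n.
    apply/polyP => i; rewrite coefB !coef_poly coefZ coefXn ltnS leq_eqVlt.
    by case: ltngtP => [h|h|->]; rewrite ?subrr ?subr0 ?mulr0 ?mulr1//= ?subrr.
  rewrite -mul_polyC [_%:P * _]mulrC pnormMC; last by lra.
  have -> : pnorm (nrm b / 2) ('X^n : {poly C}) = (nrm b / 2) ^+ n.
    elim: n => [|n IH]; first by rewrite !expr0 -polyC1 pnormC nrm1.
    have := pnormE (nrm b / 2) ('X^n : {poly C}) 0; rewrite addr0 nrm0 addr0 -exprSr => ->.
    by rewrite IH exprS.
  rewrite nrmM nrmX nrmN nrm1 expr1n mul1r nrmV nrmX exprMn exprS invfM -!mulrA.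
  rewrite ler_wpM2l ?invr_ge0 ?nrm_ge0// mulrA mulVf ?mul1r//.
  by rewrite expf_neq0// gt_eqF.
move=> x xb.
have x0 : nrm x >= nrm b / 2.
  by have := nrmD x (b - x); rewrite addrC subrK nrm_distC; lra.
have xn0 : x != 0 by rewrite -nrm_gt0; lra.
set y := - ((x - b) / b).
have y1 : nrm y <= 2^-1.
  by rewrite nrmN nrmM nrmV ler_pdivrMr// mulrC.
have E n : (\poly_(k < n) ((-1) ^+ k / b ^+ k.+1)).[x - b] = x^-1 - y ^+ n / x.
  rewrite horner_poly.
  under eq_bigr => k _.
    rewrite (_ : _ * _ = b^-1 * y ^+ k); last first.
      have -> : y ^+ k = (-1) ^+ k * ((x - b) ^+ k / b ^+ k).
        by rewrite -expr_div_n -exprMn mulN1r.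
      by rewrite exprS invfM; ring.
    over.
  elim: n => [|n IHn]; first by rewrite big_ord0 expr0 mul1r subrr.
  rewrite big_ord_recr /= IHn exprS /y.
  move: (_ ^+ n) => t; field.
  by rewrite b0 xn0.
apply/cvgn_nrm => e e0.
have e1 : 0 < e * nrm x by rewrite mulr_gt0// nrm_gt0.
have [N HN] := expr_half_lt 1 e1; exists N => n Nn; rewrite E.
have -> : x^-1 - y ^+ n / x - x^-1 = - (y ^+ n / x) by ring.
rewrite nrmN nrmM nrmV ltr_pdivrMr ?nrm_gt0//; apply: le_lt_trans (HN _ Nn).
by rewrite mul1r nrmX lerXn2r ?nnegrE ?nrm_ge0 ?invr_ge0.
Qed.

Lemma analyticV f a : analytic_at f a -> f a != 0 -> analytic_at (fun x => (f x)^-1) a.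
Proof.
by move=> hf fa; apply: (@analytic_comp (fun x => x^-1)); [exact: analytic_inv|].
Qed.

Lemma analytic_div f g a : analytic_at f a -> analytic_at g a -> g a != 0 ->
  analytic_at (fun x => f x / g x) a.
Proof. by move=> hf hg g0; apply: analyticM; [exact: hf|exact: analyticV]. Qed.

Lemma derive1V f a : analytic_at f a -> f a != 0 ->
  derive1 (fun x => (f x)^-1) a = - derive1 f a / f a ^+ 2.
Proof.
move=> hf f0.
have : derive1 (fun x => f x * (f x)^-1) a = 0.
  rewrite (@derive1_near _ (fun=> 1)); first exact: derive1_cst_fun.
  by apply: filterS (near_neq0 hf f0) => x fx; rewrite divff.
rewrite derive1M; [|exact: hf|exact: analyticV].
move: (derive1 f a) (derive1 (fun x => (f x)^-1) a) (f a) f0 => u v p f0 E.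
apply: (mulfI f0); apply: (addrI (u / p)); rewrite E.
by field.
Qed.

Lemma derive1_div f g a : analytic_at f a -> analytic_at g a -> g a != 0 ->
  derive1 (fun x => f x / g x) a = (derive1 f a * g a - f a * derive1 g a) / g a ^+ 2.
Proof.
move=> hf hg g0; rewrite derive1M; [|exact: hf|exact: analyticV].
rewrite (derive1V hg g0).
by move: (derive1 f a) (derive1 g a) (f a) (g a) g0 => u v p q q0; field.
Qed.

End Analytic.

(** * Zeros, constancy and primitives *)

Section Zeros.
Variable R : realType.
Local Notation C := (cplx R).
Implicit Types (f g : C -> C) (a b x y c : C).

Lemma nearS (P Q : C -> Prop) a : (forall x, P x -> Q x) ->
  (\forall x \near a, P x) -> \forall x \near a, Q x.
Proof. by move=> PQ; apply: filterS. Qed.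

Lemma nearI (P Q : C -> Prop) a : (\forall x \near a, P x) ->
  (\forall x \near a, Q x) -> \forall x \near a, P x /\ Q x.
Proof. by move=> hP hQ; apply: filterS2 hP hQ. Qed.

Lemma nearW_dnear (P : C -> Prop) a : (\forall x \near a, P x) -> \forall x \near a^', P x.
Proof. by apply: cvg_within. Qed.

Lemma dnear_neq a : \forall x \near (a : C)^', x != a.
Proof. by apply: withinT; exact: nbhs_filter. Qed.

Lemma dnear_absurd a : (\forall x \near (a : C)^', False) -> False.
Proof. by move=> /filter_ex[]. Qed.

Lemma derive1X_id a b n : derive1 (fun x : C => (x - b) ^+ n) a = (a - b) ^+ n.-1 *+ n.
Proof.
have hl c : analytic_at (fun x : C => x - c) a.
  by apply: analyticB; [exact: analytic_id|exact: analytic_cst].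
elim: n => [|n IHn].
  by under eq_fun do rewrite expr0; rewrite derive1_cst_fun mulr0n.
under eq_fun do rewrite exprS.
rewrite (derive1M (hl b) (analyticX n (hl b))) IHn.
rewrite derive1B; [|exact: analytic_id|exact: analytic_cst].
rewrite derive1_id_fun derive1_cst_fun subr0 mul1r mulrnAr -exprS mulrS.
by case: n {IHn} => [|n]; rewrite ?mulr0n.
Qed.

(** The order n is the index of the first nonzero Taylor coefficient, and [g] is the sum of the
    shifted series. *)
Lemma analytic_zero f a : analytic_at f a ->
  (\forall x \near a, f x = 0) \/
  exists n g, [/\ analytic_at g a, g a != 0 & \forall x \near a, f x = (x - a) ^+ n * g x].
Proof.
move=> [c hc]; have [c0|/existsNP[k /eqP ck]] := pselect (forall k, c k = 0).
  left; apply: filterS hc => x hx; apply: nrm_limit_unique hx _.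
  apply/cvgn_nrm => e e0; exists 0%N => n _.
  by rewrite /series /= big1 => [|i _]; rewrite ?c0 ?mul0r// subrr nrm0.
right; have exk : exists k, c k != 0 by exists k.
case: (ex_minnP exk) => n cn nmin.
have cmin i : (i < n)%N -> c i = 0.
  by move=> ilt; apply/eqP; apply: contraTT ilt => /nmin; rewrite -leqNgt.
(* The quotient does not give the right value at [a], so the leading coefficient is put in by
   hand. *)
pose g x := if x == a then c n else f x / (x - a) ^+ n.
have fa : f a = c 0%N.
  apply: (nrm_limit_unique (near_self hc)).
  apply/cvgn_nrm => e e0; exists 1%N => -[//|m] _.
  rewrite /series /= big_nat_recl// subrr expr0 mulr1 big1 => [|i _].
    by rewrite addr0 subrr nrm0.
  by rewrite exprS mul0r mulr0.
exists n, g; split; last 1 first.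
- apply: filterS hc => x _; rewrite /g; case: eqVneq => [->|xa].
    rewrite subrr expr0n; case: n cn nmin cmin {g} => [|n] cn _ cmin.
      by rewrite mul1r fa.
    by rewrite mul0r fa cmin.
  by rewrite mulrC divfK// expf_neq0// subr_eq0.
- exists (fun k => c (n + k)%N); apply: filterS hc => x hx.
  rewrite /g; case: eqVneq => [->|xa].
    apply/cvgn_nrm => e e0; exists 1%N => -[//|m] _.
    rewrite /series /= big_nat_recl// subrr expr0 mulr1 big1 => [|i _].
      by rewrite addn0 addr0 subrr nrm0.
    by rewrite exprS mul0r mulr0.
  have y0 : (x - a) ^+ n != 0 by rewrite expf_neq0// subr_eq0.
  have E N : [series c (n + k)%N * (x - a) ^+ k]_k N =
      [series c k * (x - a) ^+ k]_k (N + n)%N / (x - a) ^+ n.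
    rewrite /series /= (@big_cat_nat _ _ _ n 0%N (N + n)%N _ _ (leq0n n) (leq_addl N n)) /=.
    have -> : \sum_(0 <= i < n) c i * (x - a) ^+ i = 0.
      by rewrite big_nat_cond big1 => // i /andP[/andP[_ ilt] _]; rewrite cmin// mul0r.
    rewrite add0r -{2}[n]add0n big_addn addnK mulr_suml; apply: eq_bigr => i _.
    by rewrite exprD addnC mulrA mulfK.
  rewrite (_ : [series _]_k = fun N =>
      [series c k * (x - a) ^+ k]_k (N + n)%N / (x - a) ^+ n); last exact/funext.
  by apply: cvgMl; rewrite cvg_shiftn; exact: hx.
- by rewrite /g eqxx.
Qed.

Lemma analytic_isolated f a : analytic_at f a ->
  (\forall x \near a, f x = 0) \/ (\forall x \near a^', f x != 0).
Proof.
move=> /analytic_zero[|[n [g [hg g0 hf]]]]; first by left.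
right; have h := near_neq0 hg g0.
apply: filterS3 (dnear_neq a) (nearW_dnear hf) (nearW_dnear h) => x xa -> gx.
by rewrite mulf_neq0// expf_neq0// subr_eq0.
Qed.

Lemma analytic_mul_eq0 f g a : analytic_at f a -> analytic_at g a ->
  (\forall x \near a, f x * g x = 0) ->
  (\forall x \near a, f x = 0) \/ (\forall x \near a, g x = 0).
Proof.
move=> /analytic_isolated[|hf]; first by left.
move=> /analytic_isolated[|hg]; first by right.
move=> /nearW_dnear fg; exfalso; apply: (@dnear_absurd a).
apply: filterS3 hf hg fg => x f0 g0 /eqP.
by rewrite mulf_eq0 (negPf f0) (negPf g0).
Qed.

(** Germs form a domain and (f - g)(f + g) = 0. Every comparison of two branches of a square root
    below goes through this. *)
Lemma analytic_sqr_eq f g a : analytic_at f a -> analytic_at g a ->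
  (\forall x \near a, f x ^+ 2 = g x ^+ 2) ->
  (\forall x \near a, f x = g x) \/ (\forall x \near a, f x = - g x).
Proof.
move=> hf hg fg.
have := analytic_mul_eq0 (analyticB hf hg) (analyticD hf hg).
case=> [|h|h].
- by apply: filterS fg => x fgx; rewrite -subr_sqr fgx subrr.
- by left; apply: filterS h => x /eqP; rewrite subr_eq0 => /eqP.
- by right; apply: filterS h => x /eqP; rewrite addr_eq0 => /eqP.
Qed.

(** Otherwise f - f a = (x - a)^(n+1) g with g a nonzero, and the derivative (x - a)^n ((n+1) g + (x
    - a) g') does not vanish on a punctured disc. *)
Lemma analytic_const f a : analytic_at f a -> (\forall x \near a, derive1 f x = 0) ->
  \forall x \near a, f x = f a.
Proof.
move=> hf df; have ha : analytic_at (fun x => f x - f a) a.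
  by apply: analyticB; [exact: hf|exact: analytic_cst].
have [h|[n [g [hg g0 fg]]]] := analytic_zero ha.
  by apply: filterS h => x /eqP; rewrite subr_eq0 => /eqP.
exfalso; case: n fg => [|n] fg.
  have := near_self fg; rewrite subrr mul1r => E.
  by move: g0; rewrite -E eqxx.
have hk : analytic_at (fun x => n.+1%:R * g x + (x - a) * derive1 g x) a.
  apply: analyticD; first by apply: analyticM; [exact: analytic_cst|].
  apply: analyticM; last exact: analytic_derive1.
  by apply: analyticB; [exact: analytic_id|exact: analytic_cst].
have k0 : n.+1%:R * g a + (a - a) * derive1 g a != 0.
  by rewrite subrr mul0r addr0 mulf_neq0// pnatr_eq0.
have h1 := nearW_dnear (near_neq0 hk k0).
have h2 : \forall x \near a, (x - a) ^+ n * (n.+1%:R * g x + (x - a) * derive1 g x) = 0.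
  have := nearI (nearI df (near_derive1 fg)) (nearI (analytic_near hf) (analytic_near hg)).
  apply: nearS => x [[dfx +] [hfx hgx]].
  have hxa : analytic_at (fun x => x - a) x.
    by apply: analyticB; [exact: analytic_id|exact: analytic_cst].
  rewrite (derive1B hfx (analytic_cst _ _)) derive1_cst_fun subr0 dfx.
  rewrite (derive1M (analyticX n.+1 hxa) hgx) derive1X_id /= => ->.
  by rewrite exprS -mulr_natl; move: (derive1 g x) (g x) => u v; ring.
apply: (@dnear_absurd a).
apply: filterS3 h1 (nearW_dnear h2) (dnear_neq a) => x k1 k2 xa; move/eqP: k2.
by rewrite mulf_eq0 (negPf k1) orbF expf_eq0 subr_eq0 (negPf xa) andbF.
Qed.

(** The coefficient of index 0 is a division by 0; its default value 0 makes the primitive vanish at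
    the centre. *)
Definition poly_prim (p : {poly C}) := \poly_(i < (size p).+1) (p`_i.-1 / i%:R).

Lemma coef_poly_prim p i : (poly_prim p)`_i = p`_i.-1 / i%:R.
Proof.
rewrite coef_poly; case: ltnP => // h; rewrite nth_default ?mul0r//.
by move: h; case: i => // i; rewrite ltnS.
Qed.

Lemma poly_primB p q : poly_prim p - poly_prim q = poly_prim (p - q).
Proof. by apply/polyP => i; rewrite coefB !coef_poly_prim coefB mulrBl. Qed.

Lemma deriv_poly_prim p : (poly_prim p)^`() = p.
Proof.
apply/polyP => i.
by rewrite coef_deriv coef_poly_prim /= -[LHS]mulr_natr divfK// pnatr_eq0.
Qed.

Lemma nrm_nat n : nrm (n%:R : C) = n%:R.
Proof. by rewrite -(rmorph_nat (RtoC R)) nrm_RtoC_ge0. Qed.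

Lemma pnorm_poly_prim (r : R) p : 0 <= r -> pnorm r (poly_prim p) <= r * pnorm r p.
Proof.
move=> r0; rewrite (@pnorm_widen _ _ _ (size p).+1) ?size_poly//.
rewrite big_ord_recl coef_poly_prim invr0 mulr0 nrm0 mul0r add0r /pnorm mulr_sumr.
apply: ler_sum => i _; rewrite coef_poly_prim /= exprS mulrCA ler_wpM2l//.
rewrite nrmM nrmV ler_wpM2r ?exprn_ge0// ler_piMr ?nrm_ge0//.
rewrite nrm_nat invf_le1 ?ltr0n// ler1n//.
Qed.

(** Termwise integration multiplies the norm by at most r, so fast sequences stay fast. *)
Lemma analytic_primitive f a : analytic_at f a -> exists G, primitive_at f G a.
Proof.
move=> /analytic_rep[r [p hf]]; have [r0 hp _] := hf.
have hP : fast r (fun n => poly_prim (p n)).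
  case: hp => K K0 pK; exists (r * K); first by rewrite mulr_ge0// ltW.
  move=> n; rewrite poly_primB (le_trans (pnorm_poly_prim _ (ltW r0)))//.
  by rewrite -mulrA ler_wpM2l ?(ltW r0).
have /choice[G hG] x : exists l : C,
    nrm (x - a) <= r -> (fun n => (poly_prim (p n)).[x - a]) @ \oo --> l.
  have [xr|xr] := pselect (nrm (x - a) <= r); last by exists 0.
  by have [l hl] := fast_cvg xr hP; exists l.
have rG : rep G a r (fun n => poly_prim (p n)).
  by split; [exact: r0|exact: hP|exact: hG].
exists G; split; first exact: rep_analytic rG.
apply/near_nrm; exists r; first exact: r0.
move=> x xr; apply: nrm_limit_unique (rep_derive1 rG xr) _.
under eq_fun do rewrite deriv_poly_prim.
exact: rep_pointwise hf (ltW xr).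
Qed.

End Zeros.

(** * Inverse function theorem and square roots *)

Section InverseFunction.
Variable R : realType.
Local Notation C := (cplx R).
Implicit Types (f g phi : C -> C) (a b x y c : C).

Definition local_inverse f phi a := [/\ analytic_at phi (f a), phi (f a) = a,
  \forall y \near f a, f (phi y) = y & \forall x \near a, phi (f x) = x].

Lemma coef1_horner (p : {poly C}) : p`_1 = p^`().[0].
Proof. by rewrite horner_coef0 coef_deriv mulr1n. Qed.

(* The inverse of x - h x with h = O(x^2) is the limit of the iteration
   q <- X + h \o q, a contraction for the norm of a small disc. *)
Lemma inverse_function_normalized f : analytic_at f 0 -> f 0 = 0 ->
  derive1 f 0 = 1 -> exists phi, local_inverse f phi 0.
Proof.
move=> hf0 f0 df0; have /analytic_rep[r [p hf]] := hf0.
have [r0 hp _] := hf.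
(* Only the limit [f] is normalised, not each [p n]. Cutting off the terms of degree below 2 forces
   a double zero and does not change the limit, as their coefficients tend to 0. *)
pose k n := 'X - p n; pose h n := k n - take_poly 2 (k n).
have fk : fast r k by apply: fastD; [exact: ltW|exact: fast_cst|exact: fastN].
have fh : fast r h.
  case: fk => K K0 hK; exists K; first exact: K0.
  move=> n; have -> : h n.+1 - h n = (k n.+1 - k n) - take_poly 2 (k n.+1 - k n).
    apply/polyP => i; rewrite !(coefB, coef_take_poly); case: ifP => _; ring.
  rewrite (le_trans (pnorm_drop _ 2 (ltW r0) (lexx r) r0))//.
  by rewrite divff ?gt_eqF// expr1n mul1r.
have hlim x : nrm x <= r -> (fun n => (h n).[x]) @ \oo --> x - f x.
  move=> xr.
  have zr : nrm (0 - 0 : C) < r by rewrite subr0 nrm0.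
  have e1 := rep_at hf; have := rep_derive1 hf zr; rewrite subr0 f0 df0 in e1 * => e2.
  have e3 := rep_pointwise (x := x) hf; rewrite subr0 in e3; have {}e3 := e3 xr.
  have E n : (h n).[x] = (x - (p n).[x]) - (- (p n).[0] + (1 - (p n)^`().[0]) * x).
    rewrite /h hornerD hornerN; congr (_ - _); first by rewrite !hornerE.
    rewrite /take_poly horner_poly !big_ord_recl big_ord0 /= expr0 mulr1 addr0 expr1.
    by rewrite !coefB !coefX -coef1_horner -horner_coef0 /= sub0r.
  under eq_fun do rewrite E.
  have -> : x - f x = (x - f x) - (- 0 + (1 - 1) * x) by ring.
  apply: cvgB; first by apply: cvgB; [exact: cvg_cst|exact: e3].
  apply: cvgD; first by apply: cvgN; exact: e1.
  by apply: cvgMl; apply: cvgB; [exact: cvg_cst|exact: e2].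
have [B B0 hB] := fast_bounded (ltW r0) fh.
have B1 : 0 < 8 * B + 8 by lra.
(* For t <= [rho] the double zero gives [pnorm t (h n)] <= (t / r)^2 B <= t / 8, because 8 B t <=
   r^2. *)
pose rho := Num.min r (r ^+ 2 / (8 * B + 8)).
have rho0 : 0 < rho by rewrite lt_min r0 divr_gt0// exprn_gt0.
have rhor : rho <= r by rewrite ge_min lexx.
have rhoB : rho * (8 * B + 8) <= r ^+ 2.
  by rewrite -ler_pdivlMr// ge_min lexx orbT.
have hc0 n i : (i < 2)%N -> (h n)`_i = 0.
  by move=> i2; rewrite coefB coef_take_poly i2 subrr.
have small t n : 0 <= t -> t <= rho -> pnorm t (h n) <= t / 8.
  move=> t0 tr.
  rewrite (le_trans (pnorm_shrink t0 (le_trans tr rhor) r0 (hc0 n)))//.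
  rewrite (le_trans (ler_wpM2l _ (hB n)))//; first by rewrite exprn_ge0// divr_ge0// ltW.
  rewrite expr_div_n mulrAC ler_pdivrMr ?exprn_gt0//.
  have : t * (t * (8 * B + 8)) <= t * (rho * (8 * B + 8)).
    by rewrite ler_wpM2l// ler_wpM2r// ltW.
  have : t * (rho * (8 * B + 8)) <= t * r ^+ 2 by rewrite ler_wpM2l.
  have : 0 <= t ^+ 2 by exact: exprn_ge0.
  have -> : t * (t * (8 * B + 8)) = 8 * (t ^+ 2 * B) + 8 * t ^+ 2 by ring.
  have -> : t / 8 * r ^+ 2 = t * r ^+ 2 / 8 by ring.
  lra.
have rho2 : rho / 2 < rho by lra.
have rho20 : 0 <= rho / 2 by lra.
have lip n : pnorm rho (h n) / (rho - rho / 2) <= 4^-1.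
  rewrite ler_pdivrMr; last by lra.
  by have := small rho n (ltW rho0) (lexx rho); lra.
(* 'X of norm rho / 4 plus a composite of norm at most rho / 16 stays within rho / 2. *)
set s := rho / 4; have s0 : 0 < s by rewrite /s; lra.
pose q := fix q n := if n is m.+1 then 'X + (h m \Po q m) else 'X : {poly C}.
have hq n : pnorm s (q n) <= rho / 2.
  elim: n => [|n IHn] /=; first by rewrite pnormX /s; lra.
  rewrite (le_trans (pnormD _ _ (ltW s0)))// pnormX.
  have := pnorm_comp (h n) (ltW s0) IHn.
  by have := small (rho / 2) n rho20 (ltW rho2); rewrite /s; lra.
have fq : fast s q.
  have [K K0 hK] := fh.
  (* Needed is K + K' / 4 <= K' / 2: the change of [h] and the contracted previous step must fit
     into half the previous bound. *)
  pose K' := 4 * K + pnorm s (q 1%N - q 0%N).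
  have K'0 : 0 <= K' by rewrite addr_ge0 ?pnorm_ge0 ?mulr_ge0// ltW.
  exists K'; first exact: K'0.
  elim=> [|n IHn]; first by rewrite expr0 mulr1 lerDr mulr_ge0.
  have -> : q n.+2 - q n.+1 = ((h n.+1 - h n) \Po q n.+1)
      + ((h n \Po q n.+1) - (h n \Po q n)).
    transitivity ('X + (h n.+1 \Po q n.+1) - ('X + (h n \Po q n))); first by [].
    rewrite (comp_polyB (h n.+1) (h n)).
    by move: (h n.+1 \Po q n.+1) (h n \Po q n.+1) (h n \Po q n) => u v w; ring.
  rewrite (le_trans (pnormD _ _ (ltW s0)))// exprS.
  have h1 := pnorm_comp (h n.+1 - h n) (ltW s0) (hq n.+1).
  have rr : rho / 2 <= r by lra.
  have h2 := pnorm_monotone (h n.+1 - h n) rho20 rr.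
  have h3 := pnorm_comp_lip (h n) (ltW s0) rho2 (hq n.+1) (hq n).
  have h4 := ler_wpM2r (pnorm_ge0 (q n.+1 - q n) (ltW s0)) (lip n).
  have h5 := hK n.
  have h6 : 4 * (K * (2^-1) ^+ n) <= K' * (2^-1) ^+ n.
    by rewrite mulrA ler_wpM2r ?half_ge0// lerDl pnorm_ge0// ltW.
  have -> : K' * (2^-1 * 2^-1 ^+ n) = (K' * (2^-1) ^+ n) / 2 by ring.
  lra.
have /choice[phi hphi] x : exists l : C,
    nrm x <= s -> (fun n => (q n).[x]) @ \oo --> l.
  have [xs|xs] := pselect (nrm x <= s); last by exists 0.
  by have [l hl] := fast_cvg xs fq; exists l.
have rphi : rep phi 0 s q.
  by split; [exact: s0|exact: fq|] => x; rewrite subr0; exact: hphi.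
have phis y : nrm y <= s -> nrm (phi y) <= rho / 2.
  move=> ys; rewrite -[phi y]subr0; apply: (nrm_le_lim (hphi y ys)) => n.
  by rewrite subr0 (le_trans (horner_pnorm _ ys)).
have rhoh : rho / 2 <= r by lra.
have hlip n x y : nrm x <= rho / 2 -> nrm y <= rho / 2 ->
    nrm ((h n).[x] - (h n).[y]) <= 4^-1 * nrm (x - y).
  move=> xr yr; rewrite (le_trans (horner_lip _ xr yr rho2))//.
  by rewrite ler_wpM2r ?nrm_ge0.
have fphi y : nrm y <= s -> f (phi y) = y.
  move=> ys; have h1 := hphi y ys.
  have h2 : (fun n => (q n.+1).[y]) @ \oo --> phi y.
    apply/cvgn_nrm => e e0; have [N HN] := (cvgn_nrm _ _).1 h1 _ e0.
    by exists N => n Nn; apply: HN; exact: leqW.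
  have h3 : (fun n => y + (h n).[(q n).[y]]) @ \oo --> y + (phi y - f (phi y)).
    apply: cvgD; first exact: cvg_cst.
    have h4 := hlim _ (le_trans (phis y ys) rhoh).
    apply/cvgn_nrm => e e0; have e2 : 0 < e / 2 by lra.
    have [N1 H1] := (cvgn_nrm _ _).1 h1 _ e2.
    have [N2 H2] := (cvgn_nrm _ _).1 h4 _ e2.
    exists (maxn N1 N2) => n; rewrite geq_max => /andP[n1 n2].
    apply: le_lt_trans (nrm_dist_tri _ (h n).[phi y] _) _.
    have qb : nrm (q n).[y] <= rho / 2 by rewrite (le_trans (horner_pnorm _ ys)).
    have := hlip n _ _ qb (phis y ys).
    have := H1 n n1; have := H2 n n2; have := nrm_ge0 ((q n).[y] - phi y).
    by lra.
  have E n : (q n.+1).[y] = y + (h n).[(q n).[y]].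
    by rewrite /= hornerD hornerX horner_comp.
  have {}h2 : (fun n => y + (h n).[(q n).[y]]) @ \oo --> phi y.
    by rewrite -(funext E); exact: h2.
  have := nrm_limit_unique h2 h3 => E2.
  by apply: (addrI (phi y - f (phi y))); rewrite subrK addrC.
have phif x : nrm x <= rho / 2 -> nrm (f x) <= s -> phi (f x) = x.
  move=> xr fs; have := fphi _ fs; set x' := phi (f x) => E.
  have x'r : nrm x' <= rho / 2 by exact: phis.
  (* [x - f x] contracts distances by 1/4 here, so [f] is injective. *)
  have : nrm ((x' - f x') - (x - f x)) <= 4^-1 * nrm (x' - x).
    apply: (nrm_cvg (hlim _ (le_trans x'r rhoh)) (hlim _ (le_trans xr rhoh))) => n.
    exact: hlip.
  rewrite E opprB addrA subrK.
  have := nrm_ge0 (x' - x); set d := nrm _ => d0 d1.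
  have : d == 0 by apply/eqP; lra.
  by rewrite nrm_eq0 subr_eq0 => /eqP.
exists phi; split.
- by rewrite f0; exact: rep_analytic rphi.
- by apply: phif; rewrite ?f0 nrm0; [exact: rho20|exact: ltW].
- by rewrite f0; apply/near_nrm; exists s; [exact: s0|] => y; rewrite subr0 => /ltW; exact: fphi.
- have n1 : \forall y \near f 0, nrm y <= s.
    by rewrite f0; apply/near_nrm; exists s; [exact: s0|] => y; rewrite subr0 => /ltW.
  have n2 : \forall x \near (0 : C), nrm x <= rho / 2.
    apply/near_nrm; exists (rho / 2); first by lra.
    by move=> x; rewrite subr0 => /ltW.
  have := nearI n2 (near_analytic (P := fun y => nrm y <= s) hf0 n1).
  by apply: nearS => x [h1 h2]; exact: phif.
Qed.

Lemma inverse_function f a : analytic_at f a -> derive1 f a != 0 ->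
  exists phi, local_inverse f phi a.
Proof.
move=> hf df.
pose g x := (f (a + x) - f a) / derive1 f a.
have ha b x : analytic_at (fun x : C => b + x) x.
  by apply: analyticD; [exact: analytic_cst|exact: analytic_id].
have dha b x : derive1 (fun x : C => b + x) x = 1.
  rewrite derive1D; [|exact: analytic_cst|exact: analytic_id].
  by rewrite derive1_cst_fun derive1_id_fun add0r.
have hfa : analytic_at (f \o (fun x => a + x)) 0.
  by apply: analytic_comp; [rewrite addr0|exact: ha].
have hfa' : analytic_at (fun x => f (a + x) - f a) 0.
  by apply: analyticB; [exact: hfa|exact: analytic_cst].
have hg : analytic_at g 0 by apply: analyticM; [exact: hfa'|exact: analytic_cst].
have g0 : g 0 = 0 by rewrite /g addr0 subrr mul0r.
have dg : derive1 g 0 = 1.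
  rewrite /g (derive1M hfa' (analytic_cst _ _)) derive1_cst_fun mulr0 addr0.
  rewrite (derive1B hfa (analytic_cst _ _)) derive1_cst_fun subr0.
  rewrite (@derive1_chain _ f (fun x => a + x)); [|by rewrite addr0|exact: ha].
  by rewrite dha mulr1 addr0 divff.
have [psi [hpsi psi0 gpsi psig]] := inverse_function_normalized hg g0 dg.
rewrite g0 in hpsi psi0 gpsi.
pose u y := (y - f a) / derive1 f a.
have hu y : analytic_at u y.
  apply: analyticM; last exact: analytic_cst.
  by apply: analyticB; [exact: analytic_id|exact: analytic_cst].
have u0 : u (f a) = 0 by rewrite /u subrr mul0r.
exists (fun y => a + psi (u y)); split.
- apply: analyticD; first exact: analytic_cst.
  by apply: (@analytic_comp _ psi); [rewrite u0|exact: hu].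
- by rewrite u0 psi0 addr0.
- have : \forall y \near f a, g (psi (u y)) = u y.
    by apply: (near_analytic (P := fun y => g (psi y) = y) (hu _)); rewrite u0.
  apply: nearS => y; rewrite /g /u => /(divIf df) /eqP.
  by rewrite (inj_eq (addIr _)) => /eqP.
- have hs : analytic_at (fun x : C => x - a) a.
    by apply: analyticB; [exact: analytic_id|exact: analytic_cst].
  have : \forall x \near a, psi (g (x - a)) = x - a.
    by apply: (near_analytic (P := fun x => psi (g x) = x) hs); rewrite subrr.
  apply: nearS => x; rewrite /g [a + (x - a)]addrC subrK -/(u (f x)) => ->.
  by rewrite addrC subrK.
Qed.

Lemma analytic_sqrt f a b : analytic_at f a -> f a != 0 -> b ^+ 2 = f a ->
  exists r, [/\ analytic_at r a, r a = b & \forall x \near a, r x ^+ 2 = f x].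
Proof.
move=> hf fa bf; have b0 : b != 0.
  by apply: contraNneq fa => b0; rewrite -bf b0 expr0n.
have hsq : analytic_at (fun x : C => x ^+ 2) b by apply: analyticX; exact: analytic_id.
have dsq : derive1 (fun x : C => x ^+ 2) b != 0.
  rewrite (derive1X2 (analytic_id _)) derive1_id_fun mulr1 mulf_neq0//.
have [phi [h1 h2 h3 _]] := inverse_function hsq dsq.
rewrite bf in h1 h2 h3.
exists (phi \o f); split; [exact: analytic_comp|exact: h2|].
exact: (near_analytic (P := fun y => phi y ^+ 2 = y) hf h3).
Qed.

End InverseFunction.

(** * Paths *)

Section LocallyConstant.

(** The part of [A] where P holds and the rest of [A] are both relatively open. Connectedness enters
    the continuation arguments in this form. *)
Lemma connected_ind (T : topologicalType) (A : set T) (P : T -> Prop) :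
  connected A ->
  (forall x, A x -> \forall y \near x, A y -> (P x <-> P y)) ->
  forall x y, A x -> A y -> P x -> P y.
Proof.
move=> cA locP x y Ax Ay Px.
suff E : A `&` P = A by move: Ay; rewrite -{1}E => -[].
apply: cA; first by exists x.
- exists (interior [set y | A y -> P y]); first exact: open_interior.
  apply/seteqP; split=> u [Au Pu]; split=> //.
    rewrite /interior /=; apply: filterS (locP u Au) => v h Av.
    by apply/(h Av).
  by move: Pu => /nbhs_singleton; apply.
- exists (~` interior [set y | A y -> ~ P y]).
    by apply: open_closedC; exact: open_interior.
  apply/seteqP; split=> u [Au Pu]; split=> //.
    by move=> /nbhs_singleton h; exact: (h Au Pu).
  apply: contrapT => nPu; apply: Pu; rewrite /interior /=.
  by apply: filterS (locP u Au) => v h Av Pv; apply: nPu; apply/(h Av).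
Qed.

Variable R : realType.
Local Notation C := (cplx R).

Lemma near_R (s : R) (P : R -> Prop) : (\forall u \near s, P u) <->
  exists2 e : R, 0 < e & forall u, `|u - s| < e -> P u.
Proof.
split=> [/nbhs_ballP[e e0 H]|[e e0 H]].
  by exists e => // u ue; apply: H; rewrite /ball /= distrC.
by apply/nbhs_ballP; exists e => // u; rewrite /ball /= distrC => /H.
Qed.

Lemma unit_ind (P : R -> Prop) :
  (forall s : R, 0 <= s <= 1 -> \forall u \near s, 0 <= u <= 1 -> (P s <-> P u)) ->
  forall s u : R, 0 <= s <= 1 -> 0 <= u <= 1 -> P s -> P u.
Proof.
move=> h s u hs hu; apply: (@connected_ind R `[0, 1]%classic).
- exact: segment_connected.
- by move=> x; rewrite /= in_itv /= => /h; apply: filterS => y; rewrite in_itv.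
- by rewrite /= in_itv.
- by rewrite /= in_itv.
Qed.

Definition seg (x y : C) (s : R) : C := x + RtoC R s * (y - x).

Lemma seg0 x y : seg x y 0 = x.
Proof. by rewrite /seg rmorph0 mul0r addr0. Qed.

Lemma seg1 x y : seg x y 1 = y.
Proof. by rewrite /seg rmorph1 mul1r addrC subrK. Qed.

Lemma seg_near x y s (Q : C -> Prop) : (\forall u \near seg x y s, Q u) ->
  exists2 e : R, 0 < e & forall s', `|s' - s| < e -> Q (seg x y s').
Proof.
move=> /near_nrm[e e0 H]; have k0 : 0 < nrm (y - x) + 1 by rewrite ltr_wpDl ?nrm_ge0.
exists (e / (nrm (y - x) + 1)); first by rewrite divr_gt0.
move=> s' hs; apply: H.
have -> : seg x y s' - seg x y s = RtoC R (s' - s) * (y - x).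
  by rewrite /seg rmorphB /=; ring.
rewrite nrmM nrm_RtoC; move: hs; rewrite ltr_pdivlMr//; apply: le_lt_trans.
by rewrite ler_wpM2l// lerDl.
Qed.

Lemma seg_ball a x y s (e : R) : 0 <= s <= 1 -> nrm (x - a) < e ->
  nrm (y - a) < e -> nrm (seg x y s - a) < e.
Proof.
move=> /andP[s0 s1] xe ye.
have -> : seg x y s - a = RtoC R (1 - s) * (x - a) + RtoC R s * (y - a).
  by rewrite /seg rmorphB rmorph1 /=; ring.
rewrite (le_lt_trans (nrmD _ _))// !nrmM !nrm_RtoC_ge0 ?subr_ge0//.
have [->|sn0] := eqVneq s 0; first by rewrite subr0 mul1r mul0r addr0.
have sp : 0 < s by rewrite lt_def sn0.
have h1 : (1 - s) * nrm (x - a) <= (1 - s) * e by rewrite ler_wpM2l ?subr_ge0// ltW.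
have h2 : s * nrm (y - a) < s * e by rewrite ltr_pM2l.
have -> : e = (1 - s) * e + s * e by ring.
exact: ler_ltD.
Qed.

Lemma seg_ind (P : C -> Prop) x y :
  (forall s, 0 <= s <= 1 -> \forall u \near seg x y s, P (seg x y s) <-> P u) ->
  P x -> P y.
Proof.
move=> h Px; rewrite -(seg1 x y).
apply: (@unit_ind (fun s => P (seg x y s)) _ 0 1); rewrite ?lexx ?ler01 ?seg0//.
move=> s hs; apply/near_R; have [e e0 H] := seg_near (h s hs).
by exists e => // u ue _; exact: H.
Qed.

Lemma ball_ind (P : C -> Prop) a (e : R) :
  (forall x, nrm (x - a) < e -> \forall u \near x, P x <-> P u) ->
  forall x y, nrm (x - a) < e -> nrm (y - a) < e -> P x -> P y.
Proof.
by move=> h x y xe ye; apply: seg_ind => s hs; apply: h; exact: seg_ball.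
Qed.

Lemma pball_ind (P : C -> Prop) a (e : R) :
  (forall x, 0 < nrm (x - a) < e -> \forall u \near x, P x <-> P u) ->
  forall x y, 0 < nrm (x - a) < e -> 0 < nrm (y - a) < e -> P x -> P y.
Proof.
move=> h; have direct x y : 0 < nrm (x - a) < e -> 0 < nrm (y - a) < e ->
    (forall s, 0 <= s <= 1 -> seg x y s != a) -> P x -> P y.
  move=> /andP[_ xe] /andP[_ ye] na; apply: seg_ind => s hs; apply: h.
  by rewrite nrm_gt0 subr_eq0 na//= seg_ball.
move=> x y hx hy Px.
have [na|] := pselect (forall s, 0 <= s <= 1 -> seg x y s != a).
  exact: direct Px.
move=> /existsNP[s /not_implyP[hs /negP]]; rewrite negbK => /eqP sa.
(* a is on the segment, so y - a is a nonpositive multiple of x - a: go around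
   through a + 'i (x - a). *)
have xa0 : x - a != 0 by move: hx => /andP[]; rewrite nrm_gt0.
have ni : nrm ('i : C) = 1 by apply: RtoC_inj; rewrite -RtoC_nrm normCi rmorph1.
have i0 : 'i != 0 :> C by rewrite -nrm_gt0 ni.
pose m := a + 'i * (x - a).
have hm : 0 < nrm (m - a) < e.
  by rewrite /m addrAC subrr add0r nrmM ni mul1r.
have comb (p q : R) : 0 <= p -> 0 <= q -> 0 < p + q -> RtoC R p + 'i * RtoC R q != 0 :> C.
  move=> p0 q0 pq; apply/eqP => /eqP; rewrite eq_complex.
  have -> : 'i = Complex 0 1 :> C by [].
  rewrite /= !(mul0r, mul1r, mulr0, sub0r, subr0, addr0, add0r, oppr0) => /andP[/eqP pE /eqP qE].
  by move: pq; rewrite pE qE addr0 ltxx.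
have s0 : s != 0.
  by apply: contraNneq xa0 => s0; rewrite -sa s0 seg0 subrr.
have sp : 0 < s by rewrite lt_def s0; case/andP: hs.
have ya : y - a = - RtoC R ((1 - s) / s) * (x - a).
  have sn : RtoC R s != 0 by rewrite fmorph_eq0.
  rewrite fmorph_div rmorphB rmorph1 /=.
  by apply: (mulfI sn); rewrite -sa /seg; field.
have k0 : 0 <= (1 - s) / s by rewrite divr_ge0 ?subr_ge0 ?(ltW sp)//; case/andP: hs.
move: ((1 - s) / s) ya k0 => k ya k0.
have Pm : P m.
  apply: (direct x m hx hm _ Px) => u /andP[u0 u1].
  rewrite -subr_eq0.
  have -> : seg x m u - a = (RtoC R (1 - u) + 'i * RtoC R u) * (x - a).
    by rewrite /seg /m rmorphB rmorph1 /=; ring.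
  by rewrite mulf_neq0// comb ?subr_ge0// subrK.
apply: (direct m y hm hy _ Pm) => u /andP[u0 u1].
rewrite -subr_eq0.
have -> : seg m y u - a = 'i * (RtoC R (1 - u) + 'i * RtoC R (u * k)) * (x - a).
  have -> : seg m y u - a = RtoC R (1 - u) * (m - a) + RtoC R u * (y - a).
    by rewrite /seg rmorphB rmorph1 /=; ring.
  have ma : m - a = 'i * (x - a) by rewrite /m; ring.
  rewrite ma ya (rmorphM (RtoC R)).
  have E : 'i * 'i = -1 :> C by rewrite -expr2 sqrCi.
  transitivity (RtoC R (1 - u) * ('i * (x - a))
      + ('i * 'i) * (RtoC R u * RtoC R k) * (x - a)); last by ring.
  by rewrite E; ring.
rewrite !mulf_neq0//.
have [->|u1'] := eqVneq u 1.
  rewrite subrr mul1r comb ?add0r// lt_def k0 andbT.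
  apply: contraTneq hy => kz; rewrite ya kz rmorph0 oppr0 mul0r nrm0 ltxx//.
by rewrite comb ?subr_ge0 ?mulr_ge0// ltr_wpDr ?mulr_ge0// subr_gt0 lt_neqAle u1'.
Qed.

End LocallyConstant.

(** * Paths for an abstract notion of neighbourhood *)

Section NeighbourhoodPaths.
Variables (R : realType) (X : Type) (nb : X -> (X -> Prop) -> Prop).

(** Neither the curve nor the set of germs is given a topology; a relation [nb] telling which
    properties hold near a point is enough to speak of paths. *)
Definition nbpath (g : R -> X) := forall s, 0 <= s <= 1 -> forall U, nb (g s) U ->
  exists2 e : R, 0 < e & forall s', `|s' - s| < e -> 0 <= s' <= 1 -> U (g s').

Definition cat_path (g h : R -> X) (s : R) := if s <= 2^-1 then g (2 * s) else h (2 * s - 1).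

Lemma cat_path0 g h : cat_path g h 0 = g 0.
Proof. by rewrite /cat_path mulr0 invr_ge0 ler0n. Qed.

Lemma cat_path1 g h : cat_path g h 1 = h 1.
Proof.
rewrite /cat_path; case: ifP => h1; first by exfalso; lra.
by congr h; ring.
Qed.

Lemma cat_path_all (P : X -> Prop) g h : (forall s, 0 <= s <= 1 -> P (g s)) ->
  (forall s, 0 <= s <= 1 -> P (h s)) -> forall s, 0 <= s <= 1 -> P (cat_path g h s).
Proof.
move=> Pg Ph s hs; rewrite /cat_path; case: leP => h2; [apply: Pg|apply: Ph]; lra.
Qed.

(** The two ends need not be equal; it suffices that neighbourhoods of [g 1] are neighbourhoods of
    [h 0]. For germs the representing functions agree only near the point. *)
Lemma nbpath_cat g h : nbpath g -> nbpath h ->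
  (forall U, nb (g 1) U -> nb (h 0) U) -> nbpath (cat_path g h).
Proof.
move=> pg ph gh s hs U; rewrite {1}/cat_path.
have [slt|sgt|->] := ltgtP s 2^-1.
- have h1 : 0 <= 2 * s <= 1 by lra.
  move=> /(pg _ h1)[e e0 H]; exists (Num.min (e / 2) (2^-1 - s)).
    by rewrite lt_min; apply/andP; split; lra.
  move=> s'; rewrite lt_min !ltr_norml => /andP[a1 a2] a3.
  rewrite /cat_path ifT; last by lra.
  by apply: H; rewrite ?ltr_norml; lra.
- have h1 : 0 <= 2 * s - 1 <= 1 by lra.
  move=> /(ph _ h1)[e e0 H]; exists (Num.min (e / 2) (s - 2^-1)).
    by rewrite lt_min; apply/andP; split; lra.
  move=> s'; rewrite lt_min !ltr_norml => /andP[a1 a2] a3.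
  rewrite /cat_path ifF; last by apply/negbTE; rewrite -ltNge; lra.
  by apply: H; rewrite ?ltr_norml; lra.
- rewrite divff ?pnatr_eq0// => nbU.
  have h1 : (0 : R) <= (1 : R) <= (1 : R) by rewrite ler01 lexx.
  have h0 : (0 : R) <= (0 : R) <= (1 : R) by rewrite ler01 lexx.
  have [e1 e10 H1] := pg _ h1 _ nbU; have [e2 e20 H2] := ph _ h0 _ (gh _ nbU).
  exists (Num.min (e1 / 2) (e2 / 2)).
    by rewrite lt_min; apply/andP; split; lra.
  move=> s'; rewrite lt_min !ltr_norml => /andP[a1 a2] a3.
  rewrite /cat_path; case: leP => s2; [apply: H1|apply: H2]; rewrite ?ltr_norml; lra.
Qed.

Lemma nbpath_ind (P : X -> Prop) g : nbpath g ->
  (forall s, 0 <= s <= 1 -> nb (g s) (fun y => P (g s) <-> P y)) ->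
  forall s u : R, 0 <= s <= 1 -> 0 <= u <= 1 -> P (g s) -> P (g u).
Proof.
move=> pg h s u hs hu; apply: (@unit_ind _ (fun s => P (g s)) _ s u hs hu).
move=> v hv; apply/near_R; have [e e0 H] := pg v hv _ (h v hv).
by exists e => // x xe; exact: H.
Qed.

End NeighbourhoodPaths.

(** * Analytic functions with countably many values *)

Section CountableValues.
Variable R : realType.
Local Notation C := (cplx R).
Implicit Types (f : C -> C) (a x : C).

Lemma itv_uncountable (e : R) : 0 < e -> ~ countable (`]0, e[%classic : set R).
Proof.
move=> e0 /countable_lebesgue_measure0; rewrite lebesgue_measure_itv /= lte_fin e0.
by rewrite sube0 => -[] /eqP; rewrite gt_eqF.
Qed.

Lemma ball_uncountable a (e : R) (S : set C) : 0 < e -> countable S ->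
  ~ (forall x, nrm (x - a) < e -> S x).
Proof.
move=> e0 cS H; apply: (itv_uncountable e0).
have inj : {in `]0, e[%classic &, injective (fun u : R => a + RtoC R u)}.
  by move=> u v _ _ /addrI; exact: RtoC_inj.
have : countable ((fun u : R => a + RtoC R u) @` `]0, e[%classic).
  apply: (sub_countable _ cS); apply: subset_card_le => _ [u /= hu <-].
  apply: H; rewrite addrAC subrr add0r.
  by move: hu; rewrite in_itv /= => /andP[u0 ue]; rewrite nrm_RtoC_ge0 ?ltW.
by rewrite (eq_countable (inj_card_eq inj)).
Qed.

(* Where f' does not vanish, f has a local inverse and its values fill a disc. *)
Lemma analytic_countable f a (S : set C) : analytic_at f a -> countable S ->
  (\forall x \near a, S (f x)) -> \forall x \near a, f x = f a.
Proof.
move=> hf cS Sf.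
have [|df] := analytic_isolated (analytic_derive1 hf).
  exact: analytic_const.
exfalso; apply: (@dnear_absurd _ a).
apply: filterS3 df (nearW_dnear (near_near Sf)) (nearW_dnear (analytic_near hf)).
move=> b dfb Sb hb.
have [phi [hphi phib fphi _]] := inverse_function hb dfb.
have Sb' : \forall x \near phi (f b), S (f x) by rewrite phib.
have := nearI fphi (near_analytic (P := fun x => S (f x)) hphi Sb').
move=> /near_nrm[e e0 H]; apply: (ball_uncountable e0 cS (a := f b)) => y ye.
by have [E] := H y ye; rewrite E.
Qed.

(** Positions for the centres of the discs in [stage]. *)
Definition rat_points : set C :=
  [set x | exists p q : rat, x = Complex (ratr p) (ratr q)].

Lemma rat_points_countable : countable rat_points.
Proof.
apply: (@sub_countable _ _ _ [set: rat * rat]); last exact: countableP.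
apply: card_le_trans (card_image_le (fun pq : rat * rat =>
  Complex (ratr pq.1) (ratr pq.2) : C) setT).
by apply: subset_card_le => x [p [q ->]]; exists (p, q).
Qed.

Lemma rat_points_dense x (e : R) : 0 < e -> exists2 q, rat_points q & nrm (q - x) < e.
Proof.
move=> e0; have h (b : R) : b - e / 2 < b + e / 2 by lra.
have [p hp] := rat_in_itvoo (h (complex.Re x)).
have [q hq] := rat_in_itvoo (h (complex.Im x)).
exists (Complex (ratr p) (ratr q)); first by exists p, q.
move: hp hq; rewrite !in_itv /= => /andP[p1 p2] /andP[q1 q2].
apply: le_lt_trans (nrm_le_ReIm _) _; case: x p1 p2 q1 q2 => u v /= p1 p2 q1 q2.
have h1 : `|ratr p - u| < e / 2 by rewrite ltr_norml; lra.
have h2 : `|ratr q - v| < e / 2 by rewrite ltr_norml; lra.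
lra.
Qed.

End CountableValues.

(** * The curve *)

Section Branches.
Variable R : realType.
Local Notation C := (cplx R).
Variable t : C -> C.
Implicit Types (T : 'M[C]_2) (F : C -> 'M[C]_2) (a x y : C).

Lemma ord2_ind (P : 'I_2 -> 'I_2 -> Prop) :
  P 0 0 -> P 0 1 -> P 1 0 -> P 1 1 -> forall i j, P i j.
Proof.
have e (i : 'I_2) : i = 0 \/ i = 1.
  by case: i => [[|[|//]] hi]; [left|right]; apply: val_inj.
by move=> h1 h2 h3 h4 i j; case: (e i) => ->; case: (e j) => ->.
Qed.

Lemma mx2P (M N : 'M[C]_2) : M 0 0 = N 0 0 -> M 0 1 = N 0 1 ->
  M 1 0 = N 1 0 -> M 1 1 = N 1 1 -> M = N.
Proof. by move=> h1 h2 h3 h4; apply/matrixP; exact: ord2_ind. Qed.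

Lemma sym2E (a b c : C) : [/\ sym2 a b c 0 0 = a, sym2 a b c 0 1 = b,
  sym2 a b c 1 0 = b & sym2 a b c 1 1 = c].
Proof. by split; rewrite mxE. Qed.

Definition is_sym T := T 1 0 = T 0 1.

Lemma is_symP T : is_sym T <-> T = sym2 (T 0 0) (T 0 1) (T 1 1).
Proof.
have [h1 h2 h3 h4] := sym2E (T 0 0) (T 0 1) (T 1 1).
by split=> [hT|->]; [apply: mx2P; rewrite ?h1 ?h2 ?h3 ?h4|rewrite /is_sym !mxE].
Qed.

Lemma primitive_diff (f G G' : C -> C) a : primitive_at f G a -> primitive_at f G' a ->
  \forall x \near a, G x - G' x = G a - G' a.
Proof.
move=> [hG dG] [hG' dG'].
apply: (@analytic_const _ (fun x => G x - G' x)); first exact: analyticB.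
have := nearI (nearI dG dG') (nearI (analytic_near hG) (analytic_near hG')).
apply: nearS => x [[d1 d2] [h1 h2]].
by rewrite (derive1B h1 h2) d1 d2 subrr.
Qed.

Lemma primitive_near (f G : C -> C) a : primitive_at f G a ->
  \forall x \near a, primitive_at f G x.
Proof.
move=> [hG dG]; have := nearI (analytic_near hG) (near_near dG).
by apply: nearS => x [].
Qed.

Lemma branch_sym T F : branch_at t T F ->
  \forall x \near T 0 0, F x 0 0 = x /\ is_sym (F x).
Proof.
move=> [_ h _ _]; apply: nearS h => x E.
have [h1 h2 h3 h4] := sym2E x (F x 0 1) (F x 1 1).
by rewrite /is_sym {1 2}E h1 h3.
Qed.

Lemma branch_near T F : branch_at t T F -> \forall x \near T 0 0, branch_at t (F x) F.
Proof.
move=> hF; have [h1 h2 h3 h4] := hF.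
have := nearI (nearI (branch_sym hF) (near_near h2))
  (nearI (primitive_near h3) (primitive_near h4)).
by apply: nearS => x [[[E _] k2] [k3 k4]]; split; rewrite ?E.
Qed.

(** The entries of both branches are primitives of the same functions, so two sheets over one point
    are locally translates of each other. *)
Lemma branch_diff T T' F F' : branch_at t T F -> branch_at t T' F' -> T 0 0 = T' 0 0 ->
  \forall x \near T 0 0, F x - F' x = T - T'.
Proof.
move=> hF hF' E; have [h1 _ h2 h3] := hF; have [k1 _ k2 k3] := hF'.
rewrite -E in k1 k2 k3.
have k0 := branch_sym hF'; rewrite -E in k0.
have [_ s1] := near_self (branch_sym hF); have [_ s2] := near_self k0.
have := nearI (nearI (branch_sym hF) k0) (nearI (primitive_diff h2 k2) (primitive_diff h3 k3)).
apply: nearS => x [[[a1 b1] [a2 b2]] [c1 c2]].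
rewrite h1 k1 in c1 c2 s1 s2.
by apply: mx2P; rewrite !mxE ?a1 ?a2 ?b1 ?b2 ?c1 ?c2 ?s1 ?s2 ?E ?subrr.
Qed.

Lemma branch_unique T F F' : branch_at t T F -> branch_at t T F' ->
  \forall x \near T 0 0, F x = F' x.
Proof.
move=> hF hF'; apply: nearS (branch_diff hF hF' erefl) => x.
by rewrite subrr => /eqP; rewrite subr_eq0 => /eqP.
Qed.

Lemma branch_addr T F (k : 'M[C]_2) : branch_at t T F -> k 0 0 = 0 -> is_sym k ->
  branch_at t (T + k) (fun x => F x + k).
Proof.
move=> hF k0 ks; have E : (T + k) 0 0 = T 0 0 by rewrite mxE k0 addr0.
have [h1 _ [h2 d2] [h3 d3]] := hF; split; rewrite ?E.
- by rewrite h1.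
- apply: nearS (branch_sym hF) => x [s1 s2].
  have e0 : (F x + k) 0 0 = x by rewrite mxE s1 k0 addr0.
  have /is_symP : is_sym (F x + k) by rewrite /is_sym !mxE s2 ks.
  by rewrite e0.
- split.
    under eq_fun do rewrite mxE.
    by apply: analyticD; [exact: h2|exact: analytic_cst].
  have := nearI d2 (analytic_near h2); apply: nearS => x [dx hx].
  under eq_fun do rewrite mxE.
  by rewrite (derive1D hx (analytic_cst _ _)) derive1_cst_fun addr0 dx.
- split.
    under eq_fun do rewrite mxE.
    by apply: analyticD; [exact: h3|exact: analytic_cst].
  have := nearI d3 (analytic_near h3); apply: nearS => x [dx hx].
  under eq_fun do rewrite mxE.
  by rewrite (derive1D hx (analytic_cst _ _)) derive1_cst_fun addr0 dx.
Qed.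

Lemma primitive_eq (f g G : C -> C) a : (forall x, f x = g x) ->
  primitive_at f G a -> primitive_at g G a.
Proof. by move=> fg [hG dG]; split=> //; apply: nearS dG => x ->. Qed.

Lemma primitive_addr (f G : C -> C) a c : primitive_at f G a ->
  primitive_at f (fun x => G x + c) a.
Proof.
move=> [hG dG]; split; first by apply: analyticD; [exact: hG|exact: analytic_cst].
have := nearI dG (analytic_near hG); apply: nearS => x [dx hx].
by rewrite (derive1D hx (analytic_cst _ _)) derive1_cst_fun addr0.
Qed.

Lemma primitive_opp (f G : C -> C) a : primitive_at f G a ->
  primitive_at (fun x => - f x) (fun x => - G x) a.
Proof.
move=> [hG dG]; split; first exact: analyticN.
have := nearI dG (analytic_near hG); apply: nearS => x [dx hx].
by rewrite (derive1N hx) dx.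
Qed.

Lemma branch_of_primitives (G2 G3 : C -> C) a :
  primitive_at (fun x => - t x) G2 a -> primitive_at (fun x => t x ^+ 2) G3 a ->
  branch_at t (sym2 a (G2 a) (G3 a)) (fun x => sym2 x (G2 x) (G3 x)).
Proof.
move=> h2 h3; have [e0 _ _ _] := sym2E a (G2 a) (G3 a).
have E1 : (fun x => sym2 x (G2 x) (G3 x) 0 1) = G2.
  by apply/funext => x; have [_ ->] := sym2E x (G2 x) (G3 x).
have E2 : (fun x => sym2 x (G2 x) (G3 x) 1 1) = G3.
  by apply/funext => x; have [_ _ _ ->] := sym2E x (G2 x) (G3 x).
split; rewrite ?e0 ?E1 ?E2 //.
by apply/near_nrm; exists 1 => // x _; have [_ -> _ ->] := sym2E x (G2 x) (G3 x).
Qed.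

Lemma branch_exists T : is_sym T -> analytic_at t (T 0 0) -> exists F, branch_at t T F.
Proof.
move=> sT ht.
have [G2 h2] := analytic_primitive (analyticN ht).
have [G3 h3] := analytic_primitive (analyticX 2 ht).
have := branch_of_primitives (primitive_addr (T 0 1 - G2 (T 0 0)) h2)
  (primitive_addr (T 1 1 - G3 (T 0 0)) h3).
rewrite !(addrC (G2 (T 0 0))) !(addrC (G3 (T 0 0))) !subrK.
have /is_symP <- := sT => h.
by exists (fun x => sym2 x (G2 x + (T 0 1 - G2 (T 0 0))) (G3 x + (T 1 1 - G3 (T 0 0)))).
Qed.

End Branches.

(** * The curve as a connected surface with countable fibres *)

Section CurvePaths.
Variable R : realType.
Local Notation C := (cplx R).
Variables (H : set C) (t : C -> C) (c1 k3 : C).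
Hypothesis H_open : open H.
Implicit Types (T : 'M[C]_2) (F : C -> 'M[C]_2) (a x y : C).
Local Notation CC := (curve R H t c1 k3).

(** The topology of the curve as a Riemann surface: only points of the same sheet are near. The
    topology of matrices would also count points of other sheets that come close. *)
Definition nbc T (U : 'M[C]_2 -> Prop) :=
  exists2 F, branch_at t T F & \forall x \near T 0 0, U (F x).

Definition regular_sym T := [/\ H (T 0 0), analytic_at t (T 0 0) & is_sym T].

Definition lpath (L : R -> 'M[C]_2) :=
  (forall s, 0 <= s <= 1 -> regular_sym (L s)) /\ nbpath nbc L.

Lemma nbc_branch T F U : branch_at t T F -> nbc T U -> \forall x \near T 0 0, U (F x).
Proof.
move=> hF [F' hF' hU]; have := nearI (branch_unique hF hF') hU.
by apply: nearS => x [->].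
Qed.

Lemma regular_branch T : regular_sym T -> exists F, branch_at t T F.
Proof. by move=> [_ h s]; exact: branch_exists. Qed.

Lemma path_near (alpha : R -> C) U s (Q : C -> Prop) : path_in U alpha ->
  0 <= s <= 1 -> (\forall x \near alpha s, Q x) ->
  exists2 e : R, 0 < e & forall s', `|s' - s| < e -> 0 <= s' <= 1 -> Q (alpha s').
Proof.
move=> [/subspace_continuousP ca _] hs hQ.
have sI : `[0, 1]%classic s by rewrite /= in_itv.
have := ca s sI Q hQ; rewrite /within /= => /near_R[e e0 He].
by exists e => // s' h1 h2; apply: He => //=; rewrite in_itv.
Qed.

Lemma lpath_continuous (L : R -> 'M[C]_2) U : lpath L ->
  (forall s, 0 <= s <= 1 -> U (L s 0 0)) -> path_in U (fun s => L s 0 0).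
Proof.
move=> [hL pL] hU; split=> //; apply/subspace_continuousP => s.
rewrite /= in_itv /= => hs Q hQ.
have [F hF] := regular_branch (hL s hs).
have nQ : nbc (L s) (fun T => Q (T 0 0)).
  exists F; first exact: hF.
  by have := nearI (branch_sym hF) hQ; apply: nearS => x [[-> _]].
have [e e0 He] := pL s hs _ nQ.
rewrite /within /=; apply/near_R; exists e; first exact: e0.
by move=> u ue; rewrite in_itv; exact: He.
Qed.

(** The integrals are differences of local primitives of t and t^2, and so are the entries of a path
    of branches. Afterwards the curve is handled only as the set of ends of such paths from the base
    point. *)
Lemma curveP T : CC T <-> exists L, [/\ lpath L, L 0 = sym2 c1 0 k3 & L 1 = T].
Proof.
have h0 : (0 : R) <= (0 : R) <= (1 : R) by rewrite lexx ler01.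
have h1 : (0 : R) <= (1 : R) <= (1 : R) by rewrite lexx ler01.
split.
- move=> [alpha [I2 [I3 [pa a0 [F2 [p2 ->]] [F3 [p3 ->]] ->]]]].
  exists (fun s => sym2 (alpha s) (- (F2 s - F2 0)) (k3 + (F3 s - F3 0))).
  split; last 2 first.
  + by rewrite a0 !subrr oppr0 addr0.
  + by [].
  split.
    move=> s hs; have [_ /(_ s hs)[Hs ts]] := pa.
    have [e0 e1 e2 _] := sym2E (alpha s) (- (F2 s - F2 0)) (k3 + (F3 s - F3 0)).
    by split; rewrite ?e0 // /is_sym e1 e2.
  move=> s hs U nU.
  have [G2 [prim2 n2]] := p2 s hs; have [G3 [prim3 n3]] := p3 s hs.
  move/near_R: n2 => [d2 d20 n2]; move/near_R: n3 => [d3 d30 n3].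
  have ss e : 0 < e -> `|s - s| < e by rewrite subrr normr0.
  have E2 := n2 s (ss _ d20) hs; have E3 := n3 s (ss _ d30) hs.
  have hB := branch_of_primitives
    (primitive_opp (primitive_addr (- F2 0) prim2))
    (primitive_addr (k3 - F3 0) prim3).
  rewrite -E2 -E3 in hB.
  have E : F3 s + (k3 - F3 0) = k3 + (F3 s - F3 0) by ring.
  rewrite E in hB; have := nbc_branch hB nU.
  have [-> _ _ _] := sym2E (alpha s) (- (F2 s - F2 0)) (k3 + (F3 s - F3 0)).
  move=> /(path_near pa hs)[e e0 He].
  exists (Num.min e (Num.min d2 d3)); first by rewrite !lt_min e0 d20 d30.
  move=> s'; rewrite !lt_min => /and3P[l1 l2 l3] hs'.
  have := He s' l1 hs'; rewrite -(n2 s' l2 hs') -(n3 s' l3 hs').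
  by have -> : F3 s' + (k3 - F3 0) = k3 + (F3 s' - F3 0) by ring.
- move=> [L [lL L0 L1]]; have [hL pL] := lL.
  have [z0 z1 _ z2] := sym2E c1 0 k3.
  have loc s : 0 <= s <= 1 -> exists F, branch_at t (L s) F /\
      \forall s' \near s, 0 <= s' <= 1 -> L s' = F (L s' 0 0).
    move=> hs; have [F hF] := regular_branch (hL s hs); exists F; split=> //.
    apply/near_R; apply: (pL s hs (fun T => T = F (T 0 0))).
    by exists F => //; apply: nearS (branch_sym hF) => x [-> _].
  exists (fun s => L s 0 0), (- (L 1 0 1)), (L 1 1 1 - k3); split.
  + by apply: lpath_continuous => // s hs; have [] := hL s hs.
  + by rewrite L0.
  + exists (fun s => - (L s 0 1)); split; last by rewrite L0 z1 oppr0 subr0.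
    move=> s hs; have [F [hF near_s]] := loc s hs.
    exists (fun x => - F x 0 1); split.
      have [_ _ h2 _] := hF; apply: primitive_eq (primitive_opp h2) => x.
      by rewrite opprK.
    by apply: filterS near_s => s' h hs'; rewrite {1}(h hs').
  + exists (fun s => L s 1 1); split; last by rewrite L0 z2.
    move=> s hs; have [F [hF near_s]] := loc s hs.
    exists (fun x => F x 1 1); split; first by have [] := hF.
    by apply: filterS near_s => s' h hs'; rewrite {1}(h hs').
  + rewrite opprK addrC subrK -L1; apply/is_symP.
    by have [] := hL 1 h1.
Qed.

Lemma curve_regular T : CC T -> regular_sym T.
Proof.
move=> /curveP[L [[hL _] _ <-]]; apply: hL; by rewrite ler01 lexx.
Qed.

Lemma curve_branch T : CC T -> exists F, branch_at t T F.
Proof. by move=> /curve_regular; exact: regular_branch. Qed.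

Lemma lpath_trunc L s : 0 <= s <= 1 -> lpath L -> lpath (fun u => L (s * u)).
Proof.
move=> /andP[s0 s1] [hL pL].
have hsu u : 0 <= u <= 1 -> 0 <= s * u <= 1.
  by move=> /andP[u0 u1]; rewrite mulr_ge0//= mulr_ile1.
split; first by move=> u hu; apply: hL; exact: hsu.
move=> u hu U nU; have [e e0 He] := pL _ (hsu u hu) U nU.
exists e => // u' hu' hu01; apply: He; last exact: hsu.
rewrite -mulrBr normrM (ger0_norm s0); apply: le_lt_trans hu'.
by rewrite ler_piMl.
Qed.

Lemma lpath_curve L s : lpath L -> L 0 = sym2 c1 0 k3 -> 0 <= s <= 1 -> CC (L s).
Proof.
move=> lL L0 hs; apply/curveP; exists (fun u => L (s * u)); split.
- exact: lpath_trunc.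
- by rewrite mulr0.
- by rewrite mulr1.
Qed.

(** The property is carried back to the base point along a path of branches for [T], and out again
    along one for [T']. *)
Lemma curve_ind (P : 'M[C]_2 -> Prop) :
  (forall T F, CC T -> branch_at t T F -> \forall x \near T 0 0, P T <-> P (F x)) ->
  forall T T', CC T -> CC T' -> P T -> P T'.
Proof.
move=> hP.
have h0 : (0 : R) <= (0 : R) <= (1 : R) by rewrite lexx ler01.
have h1 : (0 : R) <= (1 : R) <= (1 : R) by rewrite lexx ler01.
have ends L s u : lpath L -> L 0 = sym2 c1 0 k3 -> 0 <= s <= 1 -> 0 <= u <= 1 ->
    P (L s) -> P (L u).
  move=> lL L0; have [hL pL] := lL; apply: (nbpath_ind pL) => v hv.
  have [F hF] := regular_branch (hL v hv).
  by exists F; [exact: hF|apply: hP; [exact: lpath_curve|exact: hF]].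
move=> T T' /curveP[L [lL L0 <-]] /curveP[L' [lL' L'0 <-]] PT.
apply: (ends L' 0) => //; rewrite L'0 -L0.
exact: (ends L 1).
Qed.

Definition disc F a (e : R) := forall x, nrm (x - a) < e ->
  [/\ H x, analytic_at t x, branch_at t (F x) F & F x 0 0 = x].

Lemma disc_regular F a e x : disc F a e -> nrm (x - a) < e -> regular_sym (F x).
Proof.
move=> hd /hd[Hx tx hF Fx]; split; rewrite ?Fx //.
by have [_] := near_self (branch_sym hF); rewrite Fx.
Qed.

Lemma branch_disc T F : regular_sym T -> branch_at t T F ->
  exists2 e : R, 0 < e & disc F (T 0 0) e.
Proof.
move=> [HT tT sT] hF; apply/near_nrm.
have := nearI (nearI (open_nbhs_nbhs (conj H_open HT)) (analytic_near tT))
  (nearI (branch_near hF) (branch_sym hF)).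
by apply: nearS => x [[k1 k2] [k3' [k4 k5]]]; split.
Qed.

Lemma disc_sub F a e b d : (forall x, nrm (x - b) < d -> nrm (x - a) < e) ->
  disc F a e -> disc F b d.
Proof. by move=> h hd x /h /hd. Qed.

Lemma lpath_seg F a e x y : disc F a e -> nrm (x - a) < e -> nrm (y - a) < e ->
  lpath (fun s => F (seg x y s)).
Proof.
move=> hd xe ye; split.
  by move=> s hs; apply: (disc_regular hd); exact: seg_ball.
move=> s hs U nU; have hse := seg_ball hs xe ye.
have [_ _ hF Fx] := hd _ hse.
have := nbc_branch hF nU; rewrite Fx => /seg_near[d d0 hU].
by exists d => // s' hs' _; exact: hU.
Qed.

Lemma curve_disc F a e x y : disc F a e -> nrm (x - a) < e -> nrm (y - a) < e ->
  CC (F x) -> CC (F y).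
Proof.
move=> hd xe ye /curveP[L [[hL pL] L0 L1]].
have [hS pS] := lpath_seg hd xe ye.
apply/curveP; exists (cat_path L (fun s => F (seg x y s))); split.
- split; last first.
    by apply: nbpath_cat; [exact: pL|exact: pS|move=> U; rewrite L1 seg0].
  by move=> s; apply: (@cat_path_all _ _ regular_sym).
- by rewrite cat_path0.
- by rewrite cat_path1 seg1.
Qed.

Lemma curve_near T F : CC T -> branch_at t T F -> \forall x \near T 0 0, CC (F x).
Proof.
move=> hT hF; have [e e0 hd] := branch_disc (curve_regular hT) hF.
apply/near_nrm; exists e => // x xe; apply: (curve_disc (x := T 0 0) hd _ xe).
  by rewrite subrr nrm0.
by have [-> _] := hF.
Qed.

(** The disc is left open, yet [T] and the coordinate of [T'] determine [T']; hence a countable set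
    of centres has only countably many successors over rational points. *)
Definition step T T' := exists F (e : R), [/\ disc F (T 0 0) e, 0 < e, F (T 0 0) = T,
  nrm (T' 0 0 - T 0 0) < e & F (T' 0 0) = T'].

Lemma disc_diff F F' a e : disc F a e -> disc F' a e -> forall x y,
  nrm (x - a) < e -> nrm (y - a) < e -> F x = F' x -> F y = F' y.
Proof.
move=> hd hd'; apply: ball_ind => x xe.
have [_ _ hF Fx] := hd x xe; have [_ _ hF' Fx'] := hd' x xe.
have E : F x 0 0 = F' x 0 0 by rewrite Fx Fx'.
have := branch_diff hF hF' E; rewrite Fx; apply: nearS => u Eu.
split=> /eqP; rewrite -subr_eq0.
  by rewrite -Eu subr_eq0 => /eqP.
by rewrite Eu subr_eq0 => /eqP.
Qed.

Lemma step_functional T T1 T2 : step T T1 -> step T T2 -> T1 0 0 = T2 0 0 -> T1 = T2.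
Proof.
move=> [F [e [hd e0 FT l1 E1]]] [F' [e' [hd' e'0 FT' l2 E2]]] E.
rewrite -E1 -E2 E; rewrite E in l1 => {E1 E2 E}.
have d1 : disc F (T 0 0) (Num.min e e').
  by apply: disc_sub hd => x; rewrite lt_min => /andP[].
have d2 : disc F' (T 0 0) (Num.min e e').
  by apply: disc_sub hd' => x; rewrite lt_min => /andP[].
apply: (disc_diff d1 d2 (x := T 0 0)); last by rewrite FT FT'.
  by rewrite subrr nrm0 lt_min e0.
by rewrite lt_min l1.
Qed.

Fixpoint stage n : set 'M[C]_2 := if n is m.+1
  then \bigcup_(T in stage m) \bigcup_(q in @rat_points R) [set T' | step T T' /\ T' 0 0 = q]
  else [set sym2 c1 0 k3].

Lemma countable_step T q : countable [set T' | step T T' /\ T' 0 0 = q].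
Proof.
have [[T' [sT' qT']]|no] := pselect (exists T', step T T' /\ T' 0 0 = q).
  apply: sub_countable (countable1 T'); apply: subset_card_le => T'' [s q''] /=.
  by apply: (step_functional s sT'); rewrite q'' qT'.
have -> : [set T' | step T T' /\ T' 0 0 = q] = set0; last exact: countable0.
by rewrite -subset0 => T' hT'; apply: no; exists T'.
Qed.

Lemma countable_stage n : countable (stage n).
Proof.
elim: n => [|n IHn] /=; first exact: countable1.
apply: bigcup_countable => // T _; apply: bigcup_countable => [|q _].
  exact: rat_points_countable.
exact: countable_step.
Qed.

Lemma stage_step T : CC T -> exists n T', stage n T' /\ step T' T.
Proof.
have h0 : (0 : R) <= (0 : R) <= (1 : R) by rewrite lexx ler01.
move=> hT; have /curveP[L [lL L0 L1]] := hT.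
have CL0 : CC (L 0) by exact: lpath_curve.
apply: (curve_ind (P := fun T => exists n T', stage n T' /\ step T' T) _ CL0 hT).
  move=> {L lL L0 L1 CL0 hT}T F hT hF.
  have [e e0 hd] := branch_disc (curve_regular hT) hF.
  have [FT _ _ _] := hF.
  have move x y : nrm (x - T 0 0) < e / 8 -> nrm (y - T 0 0) < e / 8 ->
      (exists n T', stage n T' /\ step T' (F x)) -> exists n T', stage n T' /\ step T' (F y).
    move=> xe ye [n [T' [nT' [F' [e' [hd' e'0 F'T' l1 l2]]]]]].
    have xe' : nrm (x - T 0 0) < e by lra.
    have [_ _ hFx Fx] := hd x xe'; rewrite Fx in l1 l2.
    have [_ _ hF'x _] := hd' x l1; rewrite l2 in hF'x.
    have nF : \forall u \near x, F u = F' u by rewrite -Fx; exact: branch_unique hFx hF'x.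
    move/near_nrm: nF => [d d0 nF].
    (* [q] is taken where [F] and [F'] agree, inside the disc of [F'] and close to x; it becomes a
       centre of the next stage, whose disc of radius e / 2 reaches y. *)
    have [q rq] := @rat_points_dense R x (Num.min d (Num.min (e / 8) (e' - nrm (x - T' 0 0))))
      ltac:(rewrite !lt_min d0 subr_gt0 l1 andbT /=; lra).
    rewrite !lt_min => /and3P[qd qe qe'].
    have qT : nrm (q - T 0 0) < e by have := nrm_dist_tri q x (T 0 0); lra.
    have [_ _ _ Fq] := hd q qT.
    exists n.+1, (F q); split.
      exists T' => //; exists q => //; split; last exact: Fq.
      exists F', e'; rewrite Fq; split; [exact: hd'|exact: e'0|exact: F'T'| |].
        by have := nrm_dist_tri q x (T' 0 0); lra.
      by rewrite nF.
    have ye' : nrm (y - T 0 0) < e by lra.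
    have [_ _ _ Fy] := hd y ye'.
    exists F, (e / 2); rewrite Fq Fy; split; [|by lra|by []| |by []].
      apply: disc_sub hd => u; have := nrm_dist_tri u q (T 0 0).
      by have := nrm_dist_tri q x (T 0 0); lra.
    have := nrm_dist_tri y x q; have := nrm_dist_tri y (T 0 0) x.
    by rewrite (nrm_distC (T 0 0)) (nrm_distC x q); lra.
  apply/near_nrm; exists (e / 8); first by lra.
  have TT : nrm (T 0 0 - T 0 0) < e / 8 by rewrite subrr nrm0; lra.
  by move=> x xe; have := move _ _ TT xe; have := move _ _ xe TT; rewrite FT.
exists 0%N, (L 0); split; first by rewrite L0.
have [F hF] := curve_branch CL0.
have [e e0 hd] := branch_disc (curve_regular CL0) hF.
have [FT _ _ _] := hF.
by exists F, e; split=> //; rewrite subrr nrm0.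
Qed.

(** The theorem of Poincare and Volterra: every point is the end of a finite chain of discs from the
    base point with all later centres over rational points, and there are countably many such
    chains. *)
Lemma curve_fiber_countable x : countable [set T | CC T /\ T 0 0 = x].
Proof.
apply: (@sub_countable _ _ _ (\bigcup_n \bigcup_(T in stage n)
    [set T' | step T T' /\ T' 0 0 = x])).
  apply: subset_card_le => T [/stage_step[n [T' [h1 h2]]] h3].
  by exists n => //; exists T'.
apply: bigcup_countable => [|n _]; first exact: countableP.
apply: bigcup_countable => [|T _]; first exact: countable_stage.
exact: countable_step.
Qed.

End CurvePaths.

Local Opaque derive1 analytic_at.

(** * The action on the curve *)

Section MatrixFunctions.
Variable R : realType.
Local Notation C := (cplx R).
Implicit Types (a x : C).

Lemma analytic_sum (I : finType) (P : pred I) (f : I -> C -> C) a :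
  (forall i, analytic_at (f i) a) -> analytic_at (fun x => \sum_(i | P i) f i x) a.
Proof.
move=> hf; elim: (index_enum I) => [|i s IHs].
  by under eq_fun do rewrite big_nil; exact: analytic_cst.
under eq_fun do rewrite big_cons.
by case: (P i); [apply: analyticD; [exact: hf|exact: IHs]|exact: IHs].
Qed.

Lemma analytic_prod (I : finType) (P : pred I) (f : I -> C -> C) a :
  (forall i, analytic_at (f i) a) -> analytic_at (fun x => \prod_(i | P i) f i x) a.
Proof.
move=> hf; elim: (index_enum I) => [|i s IHs].
  by under eq_fun do rewrite big_nil; exact: analytic_cst.
under eq_fun do rewrite big_cons.
by case: (P i); [apply: analyticM; [exact: hf|exact: IHs]|exact: IHs].
Qed.

Lemma derive1_sum (I : finType) (P : pred I) (f : I -> C -> C) a :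
  (forall i, analytic_at (f i) a) ->
  derive1 (fun x => \sum_(i | P i) f i x) a = \sum_(i | P i) derive1 (f i) a.
Proof.
move=> hf; have an s : analytic_at (fun x => \sum_(i <- s | P i) f i x) a.
  elim: s => [|i s IHs].
    by under eq_fun do rewrite big_nil; exact: analytic_cst.
  under eq_fun do rewrite big_cons.
  by case: (P i); [apply: analyticD; [exact: hf|exact: IHs]|exact: IHs].
elim: (index_enum I) => [|i s IHs].
  by rewrite big_nil; under eq_fun do rewrite big_nil; exact: derive1_cst_fun.
rewrite big_cons; under eq_fun do rewrite big_cons.
by case: (P i); [rewrite (derive1D (hf i) (an s)) IHs|exact: IHs].
Qed.

Lemma mxDE m n (A B : 'M[C]_(m, n)) i j : (A + B) i j = A i j + B i j.
Proof. exact: mxE. Qed.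

Lemma mxBE m n (A B : 'M[C]_(m, n)) i j : (A - B) i j = A i j - B i j.
Proof. by rewrite mxDE; congr (_ + _); exact: mxE. Qed.

Definition mx_analytic m n (F : C -> 'M[C]_(m, n)) a :=
  forall i j, analytic_at (fun x => F x i j) a.

Definition dmx m n (F : C -> 'M[C]_(m, n)) a : 'M[C]_(m, n) :=
  \matrix_(i, j) derive1 (fun x => F x i j) a.

Lemma dmxE m n (F : C -> 'M[C]_(m, n)) a i j :
  dmx F a i j = derive1 (fun x => F x i j) a.
Proof. exact: mxE. Qed.

Lemma mx_analytic_cst m n (A : 'M[C]_(m, n)) a : mx_analytic (fun=> A) a.
Proof. by move=> i j; exact: analytic_cst. Qed.

Lemma mx_analyticD m n (F G : C -> 'M[C]_(m, n)) a : mx_analytic F a ->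
  mx_analytic G a -> mx_analytic (fun x => F x + G x) a.
Proof.
by move=> hF hG i j; under eq_fun do rewrite mxE; apply: analyticD.
Qed.

Lemma mx_analyticM m n p (F : C -> 'M[C]_(m, n)) (G : C -> 'M[C]_(n, p)) a :
  mx_analytic F a -> mx_analytic G a -> mx_analytic (fun x => F x *m G x) a.
Proof.
move=> hF hG i j; under eq_fun do rewrite mxE.
by apply: analytic_sum => k; apply: analyticM.
Qed.

Lemma mx_analytic_det n (F : C -> 'M[C]_n) a : mx_analytic F a ->
  analytic_at (fun x => \det (F x)) a.
Proof.
move=> hF; apply: analytic_sum => s; apply: analyticM; first exact: analytic_cst.
by apply: analytic_prod => i; exact: hF.
Qed.

(** By Cramer's rule, the determinant being nonzero near [a]. *)
Lemma mx_analytic_inv n (F : C -> 'M[C]_n) a : mx_analytic F a -> F a \in unitmx ->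
  mx_analytic (fun x => invmx (F x)) a.
Proof.
move=> hF Fa i j; have hd := mx_analytic_det hF.
have da : \det (F a) != 0 by rewrite -unitfE -unitmxE.
have h : analytic_at (fun x => (\det (F x))^-1 * \adj (F x) i j) a.
  apply: analyticM; first exact: analyticV.
  under eq_fun do rewrite mxE.
  apply: analyticM; first exact: analytic_cst.
  apply: mx_analytic_det => k l; under eq_fun do rewrite !mxE.
  exact: hF.
apply: analytic_near_eq h; apply: nearS (near_neq0 hd da) => x dx.
by rewrite /invmx unitmxE unitfE dx [RHS]mxE.
Qed.

Lemma near_unitmx n (F : C -> 'M[C]_n) a : mx_analytic F a -> F a \in unitmx ->
  \forall x \near a, F x \in unitmx.
Proof.
move=> hF Fa; have da : \det (F a) != 0 by rewrite -unitfE -unitmxE.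
by apply: nearS (near_neq0 (mx_analytic_det hF) da) => x; rewrite unitmxE unitfE.
Qed.

Lemma dmx_cst m n (A : 'M[C]_(m, n)) a : dmx (fun=> A) a = 0.
Proof. by apply/matrixP => i j; rewrite dmxE derive1_cst_fun mxE. Qed.

Lemma dmxD m n (F G : C -> 'M[C]_(m, n)) a : mx_analytic F a -> mx_analytic G a ->
  dmx (fun x => F x + G x) a = dmx F a + dmx G a.
Proof.
move=> hF hG; apply/matrixP => i j; rewrite [RHS]mxE.
transitivity (derive1 (fun x => F x i j + G x i j) a).
  rewrite dmxE; congr (derive1 _ a); apply/funext => x; exact: mxE.
rewrite (derive1D (hF i j) (hG i j)).
by congr (_ + _); apply/esym; exact: dmxE.
Qed.

Lemma dmxM m n p (F : C -> 'M[C]_(m, n)) (G : C -> 'M[C]_(n, p)) a :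
  mx_analytic F a -> mx_analytic G a ->
  dmx (fun x => F x *m G x) a = dmx F a *m G a + F a *m dmx G a.
Proof.
move=> hF hG; apply/matrixP => i j; rewrite [RHS]mxE.
transitivity (derive1 (fun x => \sum_k F x i k * G x k j) a).
  rewrite dmxE; congr (derive1 _ a); apply/funext => x; exact: mxE.
rewrite derive1_sum; last by move=> k; apply: analyticM; [exact: hF|exact: hG].
transitivity (\sum_k (dmx F a i k * G a k j + F a i k * dmx G a k j)).
  apply: eq_bigr => k _; rewrite (derive1M (hF i k) (hG k j)).
  by congr (_ * _ + _ * _); apply/esym; exact: dmxE.
by rewrite big_split; congr (_ + _); apply/esym; exact: mxE.
Qed.

Lemma dmx_near m n (F G : C -> 'M[C]_(m, n)) a : (\forall x \near a, F x = G x) ->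
  dmx F a = dmx G a.
Proof.
move=> FG; apply/matrixP => i j.
transitivity (derive1 (fun x => F x i j) a); first exact: dmxE.
transitivity (derive1 (fun x => G x i j) a); last by apply/esym; exact: dmxE.
by apply: derive1_near; apply: nearS FG => x ->.
Qed.

End MatrixFunctions.

(** * Relations between the blocks of a symplectic matrix *)

Section SymplecticBlocks.
Variables (R : realType) (g : 'M[R]_(2 + 2)).
Hypothesis g_Sp4 : Sp4 g.
Local Notation C := (cplx R).
Local Notation iota := (RtoC R).
Implicit Type T : 'M[C]_2.

Definition aut_num T : 'M[C]_2 := toC iota (ulsubmx g) *m T + toC iota (ursubmx g).

Lemma symplectic_blocks :
  (dlsubmx g)^T *m ulsubmx g = (ulsubmx g)^T *m dlsubmx g /\
  (drsubmx g)^T *m ulsubmx g - (ursubmx g)^T *m dlsubmx g = 1%:M.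
Proof.
move: g_Sp4; rewrite /Sp4 /Jmx /= -{1 2}[g]submxK tr_block_mx !mulmx_block.
rewrite !(mulmx0, mul0mx, mulmx1, mul1mx, mulmxN, mulNmx, addr0, add0r).
move=> /eq_block_mx[h1 _ h2 _]; split.
  by apply/eqP; rewrite -subr_eq0 -opprB oppr_eq0 -h1 addrC.
by rewrite -[RHS]opprK -h2 opprD opprK addrC.
Qed.

(** For M = C T + D, differentiating N M = A T + B gives N' M = (A - N C) T'; this identity turns it
    into M^T N' M = T'. *)
Lemma aut_symplectic T N : T^T = T -> N^T = N -> N *m aut_den iota g T = aut_num T ->
  (aut_den iota g T)^T *m (toC iota (ulsubmx g) - N *m toC iota (dlsubmx g)) = 1%:M.
Proof.
move=> sT sN E; rewrite mulmxBr mulmxA -{1}sN -trmx_mul E.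
rewrite /aut_num /aut_den !linearD /= !trmx_mul sT !mulmxDl -!mulmxA.
rewrite /toC !map_trmx -!map_mxM; have [-> h2] := symplectic_blocks.
by rewrite opprD addrACA subrr add0r -map_mxB h2 map_mx1.
Qed.

End SymplecticBlocks.

(** * Congruence of tangent matrices of rank one *)

Section TangentVector.
Variable R : realType.
Local Notation C := (cplx R).

Lemma mulmx2E (A B : 'M[C]_2) i j : (A *m B) i j = A i 0 * B 0 j + A i 1 * B 1 j.
Proof.
rewrite mxE !big_ord_recl big_ord0 addr0.
by have -> : lift ord0 ord0 = 1 :> 'I_2 by exact: val_inj.
Qed.

Lemma det2E (M : 'M[C]_2) : \det M = M 0 0 * M 1 1 - M 0 1 * M 1 0.
Proof.
have e : lift ord0 ord0 = 1 :> 'I_2 by exact: val_inj.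
have e' : lift (1 : 'I_2) 0 = 0 by exact: val_inj.
rewrite (expand_det_row _ 0) !big_ord_recl big_ord0 e /cofactor !det_mx11 !mxE.
rewrite e' e (_ : (0 + ord0)%N = 0%N) // (_ : (0 + 1)%N = 1%N) // expr0 expr1.
by rewrite addr0 mul1r mulN1r mulrN.
Qed.

(** The hypothesis says that h u^T u = (1, -t0)^T (1, -t0) for the row u = (1, -t1) M. So u is a
    multiple of (1, -t0) and kills (t0, 1)^T, which puts M (t0, 1)^T on the line of (t1, 1)^T.
    Moreover h u_0^2 = 1 and det M = u_0 lambda. *)
Lemma tangent_vector (M : 'M[C]_2) (h t0 t1 : C) :
  M^T *m (h *: sym2 1 (- t1) (t1 ^+ 2)) *m M = sym2 1 (- t0) (t0 ^+ 2) ->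
  let lambda := M 1 0 * t0 + M 1 1 in
  M 0 0 * t0 + M 0 1 = lambda * t1 /\ lambda ^+ 2 = \det M ^+ 2 * h.
Proof.
have [a0 a1 a2 a3] := sym2E 1 (- t0) (t0 ^+ 2).
have [b0 b1 b2 b3] := sym2E 1 (- t1) (t1 ^+ 2).
set S1 := sym2 1 (- t1) _ in b0 b1 b2 b3 *.
have hS i j : (h *: S1) i j = h * S1 i j by exact: mxE.
have tM i j : M^T i j = M j i by exact: mxE.
move=> /matrixP E; have := E 0 0; have := E 0 1.
rewrite !mulmx2E !hS !tM a0 a1 b0 b1 b2 b3.
rewrite det2E.
move: (M 0 0) (M 0 1) (M 1 0) (M 1 1) => m00 m01 m10 m11 {E} E01 E00 lambda.
pose u0 := m00 - t1 * m10; pose u1 := m01 - t1 * m11.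
have e0 : h * u0 ^+ 2 = 1 by rewrite -E00 /u0; ring.
have e1 : h * u0 * u1 = - t0 by rewrite -E01 /u0 /u1; ring.
have e2 : u0 * t0 + u1 = 0.
  have -> : u0 * t0 + u1 = (u0 * t0 + u1) * (h * u0 ^+ 2) by rewrite e0 mulr1.
  have -> : (u0 * t0 + u1) * (h * u0 ^+ 2) = u0 * (t0 * (h * u0 ^+ 2) + h * u0 * u1) by ring.
  by rewrite e0 e1 mulr1 subrr mulr0.
split.
  apply/eqP; rewrite -subr_eq0; apply/eqP; rewrite -[RHS]e2 /lambda /u0 /u1; ring.
have -> : m00 * m11 - m01 * m10 = u0 * lambda - (u0 * t0 + u1) * m10.
  by rewrite /lambda /u0 /u1; ring.
rewrite e2 mul0r subr0 exprMn mulrC mulrA e0 mul1r //.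
Qed.

End TangentVector.

(** * The action maps branches into branches *)

Section ActionOnCurve.
Variable R : realType.
Local Notation C := (cplx R).
Local Notation iota := (RtoC R).
Variables (H : set C) (t : C -> C) (c1 k3 : C) (g : 'M[R]_(2 + 2)).
Local Notation CC := (curve R H t c1 k3).
Hypothesis H_open : open H.
Hypothesis g_Sp4 : Sp4 g.
Hypothesis g_acts : forall T, CC T ->
  aut_den iota g T \in unitmx /\ CC (aut_act iota g T).
Implicit Types (T : 'M[C]_2) (F : C -> 'M[C]_2) (a x y : C).

Lemma branch_mx_analytic T F : branch_at t T F -> mx_analytic F (T 0 0).
Proof.
move=> hF; have [_ _ [h2 _] [h3 _]] := hF.
have h1 : analytic_at (fun x => F x 0 0) (T 0 0).
  apply: analytic_near_eq (analytic_id _).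
  by apply: nearS (branch_sym hF) => x [-> _].
have h4 : analytic_at (fun x => F x 1 0) (T 0 0).
  apply: analytic_near_eq h2.
  by apply: nearS (branch_sym hF) => x [_ ->].
exact: ord2_ind h1 h2 h4 h3.
Qed.

Lemma branch_dmx T F : branch_at t T F ->
  dmx F (T 0 0) = sym2 1 (- t (T 0 0)) (t (T 0 0) ^+ 2).
Proof.
move=> hF; have [_ _ [_ d2] [_ d3]] := hF.
have [e0 e1 e2 e3] := sym2E 1 (- t (T 0 0)) (t (T 0 0) ^+ 2).
apply: mx2P; rewrite ?e0 ?e1 ?e2 ?e3; (etransitivity; first exact: dmxE).
- rewrite (@derive1_near _ _ id); first exact: derive1_id_fun.
  by apply: nearS (branch_sym hF) => x [-> _].
- exact: near_self d2.
- rewrite (@derive1_near _ _ (fun x => F x 0 1)); first exact: near_self d2.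
  by apply: nearS (branch_sym hF) => x [_ ->].
- exact: near_self d3.
Qed.

Lemma is_sym_tr T : is_sym T -> T^T = T.
Proof. by move=> sT; apply: mx2P; rewrite mxE. Qed.

Lemma den_analytic T F : branch_at t T F ->
  mx_analytic (fun x => aut_den iota g (F x)) (T 0 0).
Proof.
move=> hF; apply: mx_analyticD; last exact: mx_analytic_cst.
by apply: mx_analyticM; [exact: mx_analytic_cst|exact: branch_mx_analytic].
Qed.

Lemma num_analytic T F : branch_at t T F ->
  mx_analytic (fun x => aut_num g (F x)) (T 0 0).
Proof.
move=> hF; apply: mx_analyticD; last exact: mx_analytic_cst.
by apply: mx_analyticM; [exact: mx_analytic_cst|exact: branch_mx_analytic].
Qed.

Lemma act_analytic T F : CC T -> branch_at t T F ->
  mx_analytic (fun x => aut_act iota g (F x)) (T 0 0).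
Proof.
move=> hT hF; apply: mx_analyticM; first exact: num_analytic.
apply: mx_analytic_inv; first exact: den_analytic.
by have [-> _ _ _] := hF; have [] := g_acts hT.
Qed.

(* Both sides are points of the curve over the same point, so their difference
   takes countably many values. *)
Lemma action_branch T F F1 : CC T -> branch_at t T F ->
  branch_at t (aut_act iota g T) F1 ->
  \forall x \near T 0 0, aut_act iota g (F x) = F1 (aut_act iota g (F x) 0 0).
Proof.
move=> hT hF hF1; have [FT _ _ _] := hF; have [_ hgT] := g_acts hT.
have hA := act_analytic hT hF.
pose h x := aut_act iota g (F x) 0 0.
have hh : analytic_at h (T 0 0) by exact: hA.
have [y0 Dy0] : exists y0, aut_act iota g T 0 0 = y0 by exists (aut_act iota g T 0 0).
have h0 : h (T 0 0) = y0 by rewrite /h FT Dy0.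
have [e e0 hd] := branch_disc H_open (curve_regular hgT) hF1; rewrite Dy0 in hd.
have y00 : nrm (y0 - y0) < e by rewrite subrr nrm0.
have hy : \forall x \near T 0 0, nrm (h x - y0) < e.
  apply: (near_analytic (P := fun y => nrm (y - y0) < e) hh).
  by rewrite h0; apply/near_nrm; exists e.
pose D x := aut_act iota g (F x) - F1 (h x).
pose S := (fun T' => T' - F1 y0) @` [set T' | CC T' /\ T' 0 0 = y0].
have cS : countable S.
  exact: (sub_countable (card_image_le _ _) (curve_fiber_countable t c1 k3 H_open y0)).
have SD : \forall x \near T 0 0, S (D x).
  have := nearI hy (curve_near H_open hT hF); apply: nearS => x [xe CFx].
  have [_ CgFx] := g_acts CFx; set G := aut_act iota g (F x) in CgFx.
  have [_ _ hFh Fh] := hd _ xe.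
  move Dk : (D x) => k.
  have k0 : k 0 0 = 0 by rewrite -Dk /D mxBE Fh subrr.
  have ks : is_sym (k).
    have [_ _ sG] := curve_regular CgFx; have [_ _ sF] := disc_regular hd xe.
    by rewrite /is_sym -Dk /D !mxBE -/G sG sF.
  (* The translate [F1 + k] passes through the image of [F x], a point of the curve; followed back
     to [y0] it ends in the countable fibre over [y0], which places k = [D x] in [S]. *)
  have hd' : disc H t (fun u => F1 u + k) y0 e.
    move=> u ue; have [Hu tu hFu Fu] := hd u ue.
    by split; [exact: Hu|exact: tu|exact: branch_addr|rewrite mxDE Fu k0 addr0].
  have E : F1 (h x) + k = G by rewrite -Dk addrC subrK.
  have CFy : CC (F1 y0 + k).
    apply: (@curve_disc _ H t c1 k3 (fun u => F1 u + k) y0 e (h x) y0 hd' xe y00).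
    by rewrite E.
  exists (F1 y0 + k); last by rewrite addrAC subrr add0r.
  have [_ _ _ Fy] := hd _ y00.
  have Ey : (F1 y0 + k) 0 0 = y0 by rewrite mxDE Fy k0 addr0.
  exact: (conj CFy Ey).
have aD i j : analytic_at (fun x => D x i j) (T 0 0).
  have -> : (fun x => D x i j) = (fun x => aut_act iota g (F x) i j - F1 (h x) i j).
    by apply/funext => x; exact: mxBE.
  apply: analyticB; first exact: hA.
  apply: (@analytic_comp _ (fun y => F1 y i j) h); last exact: hh.
  by rewrite h0 -Dy0; exact: branch_mx_analytic.
have D0 : D (T 0 0) = 0 by rewrite /D h0 FT -Dy0; have [-> _ _ _] := hF1; rewrite subrr.
have cst i j : \forall x \near T 0 0, D x i j = 0.
  have cSij : countable ((fun M : 'M[C]_2 => M i j) @` S).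
    exact: (sub_countable (card_image_le _ _) cS).
  have := analytic_countable (aD i j) cSij; rewrite D0 mxE; apply.
  by apply: nearS SD => x Sx; exists (D x).
have := nearI (nearI (cst 0 0) (cst 0 1)) (nearI (cst 1 0) (cst 1 1)).
apply: nearS => x [[d1 d2] [d3 d4]].
apply/eqP; rewrite -subr_eq0; apply/eqP; rewrite -/(h x) -/(D x).
by apply: mx2P; rewrite ?d1 ?d2 ?d3 ?d4 mxE.
Qed.

Lemma aut_act_den T : aut_den iota g T \in unitmx ->
  aut_act iota g T *m aut_den iota g T = aut_num g T.
Proof. by move=> u; rewrite /aut_act mulmxKV. Qed.

Lemma action_derivative T F : CC T -> branch_at t T F ->
  (aut_den iota g T)^T *m dmx (fun x => aut_act iota g (F x)) (T 0 0)
    *m aut_den iota g T = dmx F (T 0 0).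
Proof.
move=> hT hF; have [FT _ _ _] := hF; have [uT gT] := g_acts hT.
have [_ _ sT] := curve_regular hT; have [_ _ sgT] := curve_regular gT.
have hA := act_analytic hT hF; have hM := den_analytic hF.
have bF := branch_mx_analytic hF.
have E : dmx (fun x => aut_act iota g (F x) *m aut_den iota g (F x)) (T 0 0)
    = dmx (fun x => aut_num g (F x)) (T 0 0).
  apply: dmx_near; have := near_unitmx hM; rewrite FT => /(_ uT).
  by apply: nearS => x; exact: aut_act_den.
have cst A x : mx_analytic (fun=> A : 'M[C]_2) x by exact: mx_analytic_cst.
have lin (A B : 'M[C]_2) : dmx (fun x => A *m F x + B) (T 0 0) = A *m dmx F (T 0 0).
  rewrite (dmxD (mx_analyticM (cst A _) bF) (cst B _)) dmx_cst addr0.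
  by rewrite (dmxM (cst A _) bF) dmx_cst mul0mx add0r.
have E2 : dmx (fun x => aut_den iota g (F x)) (T 0 0)
    = toC iota (dlsubmx g) *m dmx F (T 0 0) by exact: lin.
have E3 : dmx (fun x => aut_num g (F x)) (T 0 0)
    = toC iota (ulsubmx g) *m dmx F (T 0 0) by exact: lin.
rewrite (dmxM hA hM) FT E3 in E.
rewrite E2 in E; rewrite -mulmxA (_ : dmx _ _ *m _ =
  (toC iota (ulsubmx g) - aut_act iota g T *m toC iota (dlsubmx g)) *m dmx F (T 0 0)).
  rewrite mulmxA aut_symplectic ?mul1mx //; [exact: is_sym_tr|exact: is_sym_tr|].
  exact: aut_act_den.
by rewrite mulmxBl -E -!mulmxA addrK.
Qed.

(* With e = (t, 1) and M = C T + D, the equation M^T (g T)' M = T' together with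
   T' = (1, -t) (1, -t)^T says that M e is a multiple of e at g T. *)
Lemma action_tangent T F F1 : CC T -> branch_at t T F ->
  branch_at t (aut_act iota g T) F1 ->
  let M := aut_den iota g T in
  let t0 := t (T 0 0) in let t1 := t (aut_act iota g T 0 0) in
  let lambda := M 1 0 * t0 + M 1 1 in
  M 0 0 * t0 + M 0 1 = lambda * t1 /\
  lambda ^+ 2 = \det M ^+ 2 * derive1 (fun x => aut_act iota g (F x) 0 0) (T 0 0).
Proof.
move=> hT hF hF1 M t0 t1 lambda; have [FT _ _ _] := hF.
set h := fun x => aut_act iota g (F x) 0 0.
set h' := derive1 _ _.
have hA := act_analytic hT hF.
have hh : analytic_at h (T 0 0) by exact: hA.
have D : dmx (fun x => aut_act iota g (F x)) (T 0 0) = h' *: sym2 1 (- t1) (t1 ^+ 2).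
  rewrite (@dmx_near _ _ _ _ (fun x => F1 (h x))); last exact: action_branch.
  have bF1 := branch_mx_analytic hF1; have := branch_dmx hF1; rewrite -/t1 => <-.
  apply/matrixP => i j; rewrite [RHS]mxE.
  transitivity (derive1 ((fun y => F1 y i j) \o h) (T 0 0)); first exact: dmxE.
  have hT0 : h (T 0 0) = aut_act iota g T 0 0 by rewrite /h FT.
  rewrite derive1_chain; [|by rewrite hT0; exact: bF1|exact: hh].
  rewrite hT0 [LHS]mulrC; apply: (congr1 ( *%R h')).
  by apply/esym; exact: dmxE.
have := action_derivative hT hF; rewrite D (branch_dmx hF).
exact: tangent_vector.
Qed.

End ActionOnCurve.

(** * The differential equation *)

Section DifferentialPolynomials.
Variable C : numClosedFieldType.

(* Differential polynomials: DVar i k is the k-th derivative of the i-th unknown. *)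
Inductive dpoly := DVar of nat & nat | DCst of C | DAdd of dpoly & dpoly
  | DMul of dpoly & dpoly.

Fixpoint dderiv e := match e with
  | DVar i k => DVar i k.+1
  | DCst _ => DCst 0
  | DAdd e f => DAdd (dderiv e) (dderiv f)
  | DMul e f => DAdd (DMul (dderiv e) f) (DMul e (dderiv f))
  end.

Fixpoint deval (val : nat -> nat -> C) e := match e with
  | DVar i k => val i k
  | DCst c => c
  | DAdd e f => deval val e + deval val f
  | DMul e f => deval val e * deval val f
  end.

Fixpoint dsubst (s : nat -> dpoly) e := match e with
  | DVar i k => iter k dderiv (s i)
  | DCst c => DCst c
  | DAdd e f => DAdd (dsubst s e) (dsubst s f)
  | DMul e f => DMul (dsubst s e) (dsubst s f)
  end.

Definition DQ (c d : nat) : dpoly := DCst (c%:R / d%:R).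
Definition DN (c d : nat) : dpoly := DCst (- (c%:R / d%:R)).
Local Notation "x +' y" := (DAdd x y) (at level 50, left associativity).
Local Notation "x *' y" := (DMul x y) (at level 40, left associativity).

(* The unknowns 0, 1, 2 are the logarithmic z d/dz-derivatives a, m, n
   of G1, w and v. *)
Let a := DVar 0 0.
Let m := DVar 1 0.
Let n := DVar 2 0.

Definition dp1 := a +' DN 1 2 *' (m +' n).
(* If f(tau) = G1^k e then f' = G1^(k+1) (dnext k e). *)
Definition dnext k e := dderiv e +' DQ k 1 *' a *' e.
Definition dG3_1 := dnext 1 n.
Definition dG3_2 := dnext 2 dG3_1.
Definition dG3_3 := dnext 3 dG3_2.
Definition dp2 := DQ 24 20 *' dG3_1
  +' DN 20 20 *' dnext 1 (m +' n)
  +' DQ 5 20 *' ((m +' n) *' (m +' n)) +' DN 8 20 *' (n *' n).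
Definition dp3 := DN 10 50 *' dG3_3 +' DQ 40 50 *' (n *' dG3_2)
  +' DQ 21 50 *' (dG3_1 *' dG3_1) +' DN 54 50 *' (n *' n *' dG3_1)
  +' DQ 9 50 *' (n *' n *' n *' n).
Definition dpi i := nth dp1 [:: dp1; dp2; dp3] i.

Let P1 := DVar 0 0.
Let P1' := DVar 0 1.
Let P1'' := DVar 0 2.
Let P1''' := DVar 0 3.
Let P2 := DVar 1 0.
Let P2' := DVar 1 1.
Let P2'' := DVar 1 2.
Let P3 := DVar 2 0.

(* Found as the solution of the linear system that ode_identity amounts to; ode k is
   homogeneous of weight 4 - k when p1, p2, p3 have weights 1, 2, 4. *)
Definition ode3 := DQ 8 1 *' P1.
Definition ode2 := DQ 43 2 *' (P1 *' P1) +' DQ 7 1 *' P1' +' DQ 5 2 *' P2.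
Definition ode1 := DQ 22 1 *' (P1 *' P1 *' P1) +' DQ 23 1 *' (P1 *' P1')
  +' DQ 10 1 *' (P1 *' P2) +' DQ 3 1 *' P1'' +' DQ 5 2 *' P2'.
Definition ode0 := DQ 105 16 *' (P1 *' P1 *' P1 *' P1) +' DQ 61 4 *' (P1 *' P1 *' P1')
  +' DQ 71 8 *' (P1 *' P1 *' P2) +' DQ 9 2 *' (P1 *' P1'') +' DQ 5 1 *' (P1 *' P2')
  +' DQ 11 4 *' (P1' *' P1') +' DQ 11 4 *' (P1' *' P2) +' DQ 1 2 *' P1'''
  +' DQ 9 16 *' (P2 *' P2) +' DQ 3 4 *' P2'' +' DN 1 2 *' P3.
Definition ode k := nth ode0 [:: ode0; ode1; ode2; ode3] k.

(* theta^k (s u) = s (A u + B k1 q1 + C k2 q2 + D k3 q3), where theta s = l s,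
   u, q1, q2, q3 is the chain of derivatives of u, and k1 = v / G1,
   k2 = v / G1^2, k3 = v^2 / G1^3. *)
Definition dl := m +' DN 1 2 *' a.
Definition wstep (W : nat -> dpoly) : nat -> dpoly := fun i =>
  nth (DCst 0)
  [:: dl *' W 0%N +' dderiv (W 0%N);
      W 0%N +' (dl +' n +' DN 1 1 *' a) *' W 1%N +' dderiv (W 1%N);
      W 1%N +' (dl +' n +' DN 2 1 *' a) *' W 2%N +' dderiv (W 2%N);
      W 2%N +' (dl +' DQ 2 1 *' n +' DN 3 1 *' a) *' W 3%N +' dderiv (W 3%N)] i.
Definition wrow k : nat -> dpoly :=
  iter k wstep (fun i => nth (DCst 0) [:: DCst 1] i).

Let term val k i := deval val (dsubst dpi (ode k)) * deval val (wrow k i).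

(** Coordinate i of the equation in the basis u, q1, q2, q3. Only derivatives of a, m, n up to the
    third order occur, so this is an identity in twelve variables. *)
Lemma ode_identity val i : (i < 4)%N ->
  deval val (wrow 4 i) + (term val 0 i + term val 1 i + term val 2 i + term val 3 i) = 0.
Proof.
rewrite /term; case: i => [|[|[|[|//]]]] _; cbn -[GRing.add GRing.mul
  GRing.opp GRing.inv GRing.natmul GRing.one GRing.zero].
all: move: (val 0 0)%N (val 0 1)%N (val 0 2)%N (val 0 3)%N (val 1 0)%N (val 1 1)%N
  (val 1 2)%N (val 1 3)%N (val 2 0)%N (val 2 1)%N (val 2 2)%N (val 2 3)%N
  => a0 a1 a2 a3 m0 m1 m2 m3 n0 n1 n2 n3; by field.
Qed.

(** The rows are unitriangular: theta^k (s u) has leading coefficient 1 at the k-th basis vector.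
    This serves the uniqueness of the coefficients. *)
Lemma wrow_triangular val (d : nat -> C) :
  (forall i, (i < 4)%N -> d 0%N * deval val (wrow 0 i) + d 1%N * deval val (wrow 1 i)
    + d 2%N * deval val (wrow 2 i) + d 3%N * deval val (wrow 3 i) = 0) ->
  forall k, (k < 4)%N -> d k = 0.
Proof.
have e01 : deval val (wrow 0 1) = 0 by [].
have e02 : deval val (wrow 0 2) = 0 by [].
have e03 : deval val (wrow 0 3) = 0 by [].
have e00 : deval val (wrow 0 0) = 1 by [].
have e11 : deval val (wrow 1 1) = 1 by rewrite /= mulr0 !addr0.
have e12 : deval val (wrow 1 2) = 0 by rewrite /= mulr0 !addr0.
have e13 : deval val (wrow 1 3) = 0 by rewrite /= mulr0 !addr0.
have e22 : deval val (wrow 2 2) = 1.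
  by move: e11 e12; rewrite /= => -> ->; rewrite !mulr0 !addr0.
have e23 : deval val (wrow 2 3) = 0 by rewrite /= !(mulr0, addr0).
have e33 : deval val (wrow 3 3) = 1.
  have -> : wrow 3 3 = wrow 2 2 +' (dl +' DQ 2 1 *' n +' DN 3 1 *' a) *' wrow 2 3
    +' dderiv (wrow 2 3) by [].
  cbn [deval]; rewrite e22 e23 /= !(mulr0, addr0)//.
move=> h; have := h 3%N isT; rewrite e03 e13 e23 e33 !mulr0 !add0r mulr1 => d3.
have := h 2%N isT; rewrite d3 mul0r e02 e12 e22 !mulr0 !add0r mulr1 addr0 => d2.
have := h 1%N isT; rewrite d3 d2 !mul0r e01 e11 mulr0 mulr1 add0r !addr0 => d1.
have := h 0%N isT; rewrite d3 d2 d1 !mul0r e00 mulr1 !addr0 => d0.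
by case=> [|[|[|[|//]]]].
Qed.

End DifferentialPolynomials.

(** * Calculus of z d/dz and the chain of derivatives *)

Section ThetaCalculus.
Variable R : realType.
Local Notation C := (cplx R).
Implicit Types (f g : C -> C) (a x : C) (base : nat -> C -> C).

Lemma analytic_theta f a : analytic_at f a -> analytic_at (theta f) a.
Proof.
by move=> hf; apply: analyticM; [exact: analytic_id|exact: analytic_derive1].
Qed.

Lemma near_theta f g a : (\forall x \near a, f x = g x) ->
  \forall x \near a, theta f x = theta g x.
Proof. by move=> /near_derive1; apply: nearS => x; rewrite /theta => ->. Qed.

Lemma analytic_iter_theta k f a : analytic_at f a -> analytic_at (iter k theta f) a.
Proof. by move=> hf; elim: k => [//|k IHk] /=; exact: analytic_theta. Qed.

Lemma near_iter_theta k f g a : (\forall x \near a, f x = g x) ->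
  \forall x \near a, iter k theta f x = iter k theta g x.
Proof. by move=> hf; elim: k => [//|k IHk] /=; exact: near_theta. Qed.

Lemma thetaD f g a : analytic_at f a -> analytic_at g a ->
  theta (fun x => f x + g x) a = theta f a + theta g a.
Proof. by move=> hf hg; rewrite /theta (derive1D hf hg) mulrDr. Qed.

Lemma thetaM f g a : analytic_at f a -> analytic_at g a ->
  theta (fun x => f x * g x) a = theta f a * g a + f a * theta g a.
Proof.
move=> hf hg; rewrite /theta (derive1M hf hg).
by move: (derive1 f a) (derive1 g a) => u v; ring.
Qed.

Lemma theta_cst (c : C) a : theta (fun=> c) a = 0.
Proof. by rewrite /theta derive1_cst_fun mulr0. Qed.

Lemma thetaZ (c : C) f a : analytic_at f a -> theta (fun x => c * f x) a = c * theta f a.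
Proof.
by move=> hf; rewrite (thetaM (analytic_cst c a) hf) theta_cst mul0r add0r.
Qed.

Lemma theta_div f g a : analytic_at f a -> analytic_at g a -> g a != 0 ->
  theta (fun x => f x / g x) a = (theta f a - f a / g a * theta g a) / g a.
Proof.
move=> hf hg g0; rewrite /theta (derive1_div hf hg g0).
by move: (derive1 f a) (derive1 g a) (f a) (g a) g0 => u v p q q0; field.
Qed.

Lemma sum4E (f : nat -> C) : \sum_(k < 4) f k = f 0%N + f 1%N + f 2%N + f 3%N.
Proof. by rewrite !big_ord_recr big_ord0 /= add0r. Qed.

Lemma lin4 (W : nat -> nat -> C) (c e : nat -> C) :
  (forall i, (i < 4)%N -> W 4%N i + (c 0%N * W 0%N i + c 1%N * W 1%N i + c 2%N * W 2%N i
    + c 3%N * W 3%N i) = 0) ->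
  (W 4%N 0%N * e 0%N + W 4%N 1%N * e 1%N + W 4%N 2%N * e 2%N + W 4%N 3%N * e 3%N) +
  (c 0%N * (W 0%N 0%N * e 0%N + W 0%N 1%N * e 1%N + W 0%N 2%N * e 2%N + W 0%N 3%N * e 3%N)
   + c 1%N * (W 1%N 0%N * e 0%N + W 1%N 1%N * e 1%N + W 1%N 2%N * e 2%N + W 1%N 3%N * e 3%N)
   + c 2%N * (W 2%N 0%N * e 0%N + W 2%N 1%N * e 1%N + W 2%N 2%N * e 2%N + W 2%N 3%N * e 3%N)
   + c 3%N * (W 3%N 0%N * e 0%N + W 3%N 1%N * e 1%N + W 3%N 2%N * e 2%N + W 3%N 3%N * e 3%N)) = 0.
Proof.
move=> h.
pose f i := (W 4%N i + (c 0%N * W 0%N i + c 1%N * W 1%N i + c 2%N * W 2%N i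
  + c 3%N * W 3%N i)) * e i.
transitivity (f 0%N + f 1%N + f 2%N + f 3%N); first by rewrite /f; ring.
by rewrite /f !h // !mul0r !addr0.
Qed.

Lemma lin4_swap (d : nat -> C) (W : nat -> nat -> C) (s k1 k2 k3 u a b c : C) :
  s * (d 0%N * W 0%N 0%N + d 1%N * W 1%N 0%N + d 2%N * W 2%N 0%N + d 3%N * W 3%N 0%N) * u
    + s * k1 * (d 0%N * W 0%N 1%N + d 1%N * W 1%N 1%N + d 2%N * W 2%N 1%N + d 3%N * W 3%N 1%N) * a
  + s * k2 * (d 0%N * W 0%N 2%N + d 1%N * W 1%N 2%N + d 2%N * W 2%N 2%N
    + d 3%N * W 3%N 2%N) * b + s * k3 * (d 0%N * W 0%N 3%N + d 1%N * W 1%N 3%N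
      + d 2%N * W 2%N 3%N + d 3%N * W 3%N 3%N) * c =
d 0%N * (W 0%N 0%N * (s * u) + W 0%N 1%N * (s * (k1 * a)) + W 0%N 2%N * (s * (k2 * b))
  + W 0%N 3%N * (s * (k3 * c)))
 + d 1%N * (W 1%N 0%N * (s * u) + W 1%N 1%N * (s * (k1 * a)) + W 1%N 2%N * (s * (k2 * b))
   + W 1%N 3%N * (s * (k3 * c)))
 + d 2%N * (W 2%N 0%N * (s * u) + W 2%N 1%N * (s * (k1 * a)) + W 2%N 2%N * (s * (k2 * b))
   + W 2%N 3%N * (s * (k3 * c)))
 + d 3%N * (W 3%N 0%N * (s * u) + W 3%N 1%N * (s * (k1 * a)) + W 3%N 2%N * (s * (k2 * b))
   + W 3%N 3%N * (s * (k3 * c))).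
Proof. ring. Qed.

Definition dfun base e : C -> C := fun x => deval (fun i k => iter k theta (base i) x) e.

Definition analytic_base base a := forall i, analytic_at (base i) a.

Lemma dfun_analytic base e a : analytic_base base a -> analytic_at (dfun base e) a.
Proof.
move=> hb; elim: e => [i k|c|e IHe f IHf|e IHe f IHf].
- exact: analytic_iter_theta.
- exact: analytic_cst.
- exact: (analyticD IHe IHf).
- exact: (analyticM IHe IHf).
Qed.

Lemma theta_dfun base e a : analytic_base base a ->
  theta (dfun base e) a = dfun base (dderiv e) a.
Proof.
move=> hb; elim: e => [i k|c|e IHe f IHf|e IHe f IHf].
- by [].
- exact: theta_cst.
- etransitivity; first exact: (thetaD (dfun_analytic e hb) (dfun_analytic f hb)).
  by rewrite IHe IHf.
- etransitivity; first exact: (thetaM (dfun_analytic e hb) (dfun_analytic f hb)).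
  by rewrite IHe IHf.
Qed.

Lemma iter_theta_dfun base e a k : (\forall x \near a, analytic_base base x) ->
  \forall x \near a, iter k theta (dfun base e) x = dfun base (iter k (@dderiv C) e) x.
Proof.
move=> hb; elim: k => [|k IHk]; first by apply: nearS hb.
have := nearI hb (near_theta IHk); apply: nearS => x [hx /= ->].
exact: theta_dfun.
Qed.

Lemma dfun_dsubst base (s : nat -> dpoly C) (p : nat -> C -> C) e a :
  (\forall x \near a, analytic_base base x) ->
  (forall i, \forall x \near a, p i x = dfun base (s i) x) ->
  \forall x \near a, dfun p e x = dfun base (dsubst s e) x.
Proof.
move=> hb hp; elim: e => [i k|c|e IHe f IHf|e IHe f IHf].
- have := nearI (near_iter_theta k (hp i)) (iter_theta_dfun (s i) k hb).
  by apply: nearS => x [h1 h2]; rewrite /dfun /= h1 h2.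
- by apply: nearS hb.
- have := nearI IHe IHf; apply: nearS => x [h1 h2].
  by move: h1 h2; rewrite /dfun /= => -> ->.
- have := nearI IHe IHf; apply: nearS => x [h1 h2].
  by move: h1 h2; rewrite /dfun /= => -> ->.
Qed.

Definition base3 (f g h : C -> C) i := nth (fun=> 0) [:: f; g; h] i.

Lemma base3_analytic f g h a : analytic_at f a -> analytic_at g a -> analytic_at h a ->
  analytic_base (base3 f g h) a.
Proof.
move=> hf hg hh [|[|[|i]]]; [exact: hf|exact: hg|exact: hh|].
by rewrite /base3 /= nth_nil; exact: analytic_cst.
Qed.

Lemma base3_near f g h a : analytic_at f a -> analytic_at g a -> analytic_at h a ->
  \forall x \near a, analytic_base (base3 f g h) x.
Proof.
move=> hf hg hh; have := nearI (analytic_near hf) (nearI (analytic_near hg) (analytic_near hh)).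
by apply: nearS => x [h1 [h2 h3]]; exact: base3_analytic.
Qed.

Variables (gam om nu : C -> C) (a : C).
Hypotheses (gam_an : analytic_at gam a) (om_an : analytic_at om a) (nu_an : analytic_at nu a).
Hypotheses (gam0 : gam a != 0) (om0 : om a != 0) (nu0 : nu a != 0).

Definition logd f : C -> C := fun x => theta f x / f x.
Definition abase := base3 (logd gam) (logd om) (logd nu).

Lemma logd_analytic f x : analytic_at f x -> f x != 0 -> analytic_at (logd f) x.
Proof.
move=> hf f0; apply: (analytic_div (f := theta f)); [exact: analytic_theta|exact: hf|exact: f0].
Qed.

Lemma theta_logd f x : f x != 0 -> theta f x = logd f x * f x.
Proof. by move=> f0; rewrite /logd divfK. Qed.

Lemma abase_near : \forall x \near a, analytic_base abase x.
Proof. by apply: base3_near; exact: logd_analytic. Qed.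

Definition K1 x := nu x / gam x.
Definition K2 x := K1 x / gam x.
Definition K3 x := K1 x * K2 x.

Definition chain_basis (s u q1 q2 q3 : C -> C) i : C -> C := nth (fun=> 0)
  [:: (fun x => s x * u x); (fun x => s x * (K1 x * q1 x));
      (fun x => s x * (K2 x * q2 x)); (fun x => s x * (K3 x * q3 x))] i.

(** With [gam], [om], [nu] standing for G1, w, v as functions of z, theta is (1 / G1) d/dtau, and
    the last four fields say u' = t' q1, q1' = q2, q2' = t' q3, q3' = 0 for d/dtau. *)
Record solution_chain (s u q1 q2 q3 : C -> C) : Prop := SolutionChain {
  s_an : analytic_at s a; s_neq0 : s a != 0;
  s_sqr : \forall x \near a, s x ^+ 2 = om x ^+ 2 / gam x;
  u_an : analytic_at u a; q1_an : analytic_at q1 a;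
  q2_an : analytic_at q2 a; q3_an : analytic_at q3 a;
  theta_u : \forall x \near a, theta u x = K1 x * q1 x;
  theta_q1 : \forall x \near a, theta q1 x = q2 x / gam x;
  theta_q2 : \forall x \near a, theta q2 x = K1 x * q3 x;
  theta_q3 : \forall x \near a, theta q3 x = 0 }.

Lemma K_analytic x : analytic_at gam x -> analytic_at nu x -> gam x != 0 ->
  [/\ analytic_at K1 x, analytic_at K2 x & analytic_at K3 x].
Proof.
move=> hg hn g0; have h1 : analytic_at K1 x by exact: (analytic_div hn hg g0).
have h2 : analytic_at K2 x by exact: (analytic_div h1 hg g0).
by split; [exact: h1|exact: h2|exact: (analyticM h1 h2)].
Qed.

Lemma chain_analytic s u q1 q2 q3 x : analytic_at gam x -> analytic_at nu x ->
  gam x != 0 -> analytic_at s x -> analytic_at u x -> analytic_at q1 x ->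
  analytic_at q2 x -> analytic_at q3 x ->
  forall i, analytic_at (chain_basis s u q1 q2 q3 i) x.
Proof.
move=> hg hn g0 hs hu h1 h2 h3; have [k1 k2 k3] := K_analytic hg hn g0.
case=> [|[|[|[|i]]]].
- exact: (analyticM hs hu).
- exact: (analyticM hs (analyticM k1 h1)).
- exact: (analyticM hs (analyticM k2 h2)).
- exact: (analyticM hs (analyticM k3 h3)).
- by rewrite /chain_basis /= nth_nil; exact: analytic_cst.
Qed.

Lemma theta_K x : analytic_at gam x -> analytic_at nu x -> gam x != 0 -> nu x != 0 ->
  [/\ theta K1 x = (logd nu x - logd gam x) * K1 x,
      theta K2 x = (logd nu x - 2 * logd gam x) * K2 x
    & theta K3 x = (2 * logd nu x - 3 * logd gam x) * K3 x].
Proof.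
move=> hg hn g0 n0; have [k1 k2 _] := K_analytic hg hn g0.
have e1 : theta K1 x = (logd nu x - logd gam x) * K1 x.
  rewrite (theta_div hn hg g0) (theta_logd n0) (theta_logd g0) /K1.
  by move: (logd nu x) (logd gam x) (nu x) (gam x) g0 => u v p q q0; field.
have e2 : theta K2 x = (logd nu x - 2 * logd gam x) * K2 x.
  rewrite (theta_div k1 hg g0) e1 (theta_logd g0) /K2.
  by move: (logd nu x) (logd gam x) (K1 x) (gam x) g0 => u v p q q0; field.
split; [exact: e1|exact: e2|].
rewrite (thetaM k1 k2) e1 e2 /K3.
by move: (logd nu x) (logd gam x) (K1 x) (K2 x) => u v p q; ring.
Qed.

Lemma theta_s s x : analytic_at gam x -> analytic_at om x -> analytic_at s x ->
  gam x != 0 -> om x != 0 -> s x != 0 ->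
  (\forall y \near x, s y ^+ 2 = om y ^+ 2 / gam y) ->
  theta s x = (logd om x - 2^-1 * logd gam x) * s x.
Proof.
move=> hg ho hs g0 o0 s0 ss.
have ss' : \forall y \near x, s y * s y = om y * om y / gam y.
  by apply: nearS ss => y; rewrite !expr2.
have := near_self (near_theta ss'); rewrite (thetaM hs hs).
rewrite (theta_div (analyticM ho ho) hg g0) (thetaM ho ho).
rewrite (theta_logd o0) (theta_logd g0); have := near_self ss'.
move: (theta s x) (logd om x) (logd gam x) (om x) (gam x) (s x) g0 s0.
move=> ts lo lg o g y g0 y0 E E2.
have {E2}E2 : 2 * y * ts = y * y * (2 * lo - lg).
  have -> : 2 * y * ts = ts * y + y * ts by ring.
  by rewrite E2 E; field.
have y2 : 2 * y != 0 by rewrite mulf_neq0.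
by apply: (mulfI y2); rewrite E2; field.
Qed.

Section Chain.
Variables s u q1 q2 q3 : C -> C.
Hypothesis hc : solution_chain s u q1 q2 q3.
Local Notation E := (chain_basis s u q1 q2 q3).

Lemma chain_theta : \forall x \near a, (forall i, analytic_at (E i) x) /\
  [/\ theta (E 0) x = (logd om x - 2^-1 * logd gam x) * E 0 x + E 1 x,
    theta (E 1) x = (logd om x - 2^-1 * logd gam x + logd nu x - logd gam x) * E 1 x
      + E 2%N x,
    theta (E 2%N) x = (logd om x - 2^-1 * logd gam x + logd nu x - 2 * logd gam x) * E 2%N x
      + E 3%N x &
    theta (E 3%N) x = (logd om x - 2^-1 * logd gam x + 2 * logd nu x - 3 * logd gam x) * E 3%N x].
Proof.
have [hs s0 ss hu h1 h2 h3 tu t1 t2 t3] := hc.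
have A := nearI (nearI (analytic_near gam_an) (analytic_near om_an))
  (nearI (analytic_near nu_an) (analytic_near hs)).
have B := nearI (nearI (near_neq0 gam_an gam0) (near_neq0 om_an om0))
  (nearI (near_neq0 nu_an nu0) (near_neq0 hs s0)).
have D := nearI (nearI (analytic_near hu) (analytic_near h1))
  (nearI (analytic_near h2) (analytic_near h3)).
have T := nearI (nearI tu t1) (nearI t2 t3).
have := nearI (nearI A B) (nearI (near_near ss) (nearI D T)).
apply: nearS => x [[[[a1 a2] [a3 a4]] [[b1 b2] [b3 b4]]]].
move=> [ssx [[[d1 d2] [d3 d4]] [[e1 e2] [e3 e4]]]].
split; first exact: chain_analytic.
have ts := theta_s a1 a2 a4 b1 b2 b4 ssx.
have [tk1 tk2 tk3] := theta_K a1 a3 b1 b3.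
have [k1 k2 k3] := K_analytic a1 a3 b1.
rewrite /chain_basis /=; split.
- rewrite (thetaM a4 d1) ts e1.
  by move: (logd om x) (logd gam x) (K1 x) (s x) (u x) (q1 x) => *; ring.
- rewrite (thetaM a4 (analyticM k1 d2)) (thetaM k1 d2) ts tk1 e2 /K2.
  by move: (logd om x) (logd gam x) (logd nu x) (K1 x) (s x) (q1 x) (q2 x) (gam x)^-1
    => *; ring.
- rewrite (thetaM a4 (analyticM k2 d3)) (thetaM k2 d3) ts tk2 e3 /K3.
  by move: (logd om x) (logd gam x) (logd nu x) (K1 x) (K2 x) (s x) (q2 x) (q3 x)
    => *; ring.
- rewrite (thetaM a4 (analyticM k3 d4)) (thetaM k3 d4) ts tk3 e4.
  by move: (logd om x) (logd gam x) (logd nu x) (K3 x) (s x) (q3 x) => *; ring.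
Qed.

Lemma chain_wrow k : \forall x \near a, iter k theta (E 0) x =
  dfun abase (@wrow C k 0) x * E 0 x + dfun abase (@wrow C k 1) x * E 1 x
  + dfun abase (@wrow C k 2) x * E 2%N x + dfun abase (@wrow C k 3) x * E 3%N x.
Proof.
elim: k => [|k IHk].
  by apply: nearS abase_near => x _; rewrite /dfun /= mul1r !mul0r !addr0.
have := nearI chain_theta (nearI abase_near (near_theta IHk)).
apply: nearS => x [[hE [t0 t1 t2 t3]] [hb /= ->]].
pose W i := @wrow C k i.
have aW i : analytic_at (fun x => dfun abase (W i) x * E i x) x.
  by apply: analyticM; [exact: dfun_analytic|exact: hE].
rewrite (thetaD (analyticD (analyticD (aW 0%N) (aW 1%N)) (aW 2%N)) (aW 3%N)).
rewrite (thetaD (analyticD (aW 0%N) (aW 1%N)) (aW 2%N)) (thetaD (aW 0%N) (aW 1%N)).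
have tW i : theta (fun x => dfun abase (W i) x * E i x) x =
    dfun abase (dderiv (W i)) x * E i x + dfun abase (W i) x * theta (E i) x.
  by rewrite (thetaM (dfun_analytic _ hb) (hE i)) (theta_dfun _ hb).
rewrite !tW t0 t1 t2 t3.
have b0 : abase 0 x = logd gam x by [].
have b1 : abase 1 x = logd om x by [].
have b2 : abase 2 x = logd nu x by [].
rewrite /dfun /= b0 b1 b2 -/(W 0%N) -/(W 1%N) -/(W 2%N) -/(W 3%N).
set D0 := deval _ (dderiv (W 0%N)); set D1 := deval _ (dderiv (W 1%N)).
set D2 := deval _ (dderiv (W 2%N)); set D3 := deval _ (dderiv (W 3%N)).
set W0 := deval _ (W 0%N); set W1 := deval _ (W 1%N).
set W2 := deval _ (W 2%N); set W3 := deval _ (W 3%N).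
move: D0 D1 D2 D3 W0 W1 W2 W3 (logd om x) (logd gam x) (logd nu x).
move: (E 0%N x) (E 1%N x) (E 2%N x) (E 3%N x) => *.
by field.
Qed.

Lemma chain_solution (p : nat -> C -> C) :
  (forall i, \forall x \near a, p i x = dfun abase (dpi C i) x) ->
  \forall x \near a, iter 4 theta (E 0) x +
    \sum_(k < 4) dfun p (ode C k) x * iter k theta (E 0) x = 0.
Proof.
move=> hp.
have S k := dfun_dsubst (ode C k) abase_near hp.
have := nearI (nearI (chain_wrow 4) (nearI (chain_wrow 0) (chain_wrow 1)))
  (nearI (nearI (chain_wrow 2) (chain_wrow 3)) (nearI (nearI (S 0%N) (S 1%N)) (nearI (S 2%N)
    (S 3%N)))).
apply: nearS => x [[w4 [w0 w1]] [[w2 w3] [[s0 s1] [s2 s3]]]].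
rewrite (sum4E (fun k => dfun p (ode C k) x * iter k theta (E 0) x)).
rewrite w4 w0 w1 w2 w3 s0 s1 s2 s3 {w4 w0 w1 w2 w3 s0 s1 s2 s3}.
pose val i k := iter k theta (abase i) x.
have I i : (i < 4)%N -> dfun abase (@wrow C 4 i) x +
    (dfun abase (dsubst (dpi C) (ode C 0)) x * dfun abase (@wrow C 0 i) x +
     dfun abase (dsubst (dpi C) (ode C 1)) x * dfun abase (@wrow C 1 i) x +
     dfun abase (dsubst (dpi C) (ode C 2)) x * dfun abase (@wrow C 2 i) x +
     dfun abase (dsubst (dpi C) (ode C 3)) x * dfun abase (@wrow C 3 i) x) = 0.
  exact: (@ode_identity C val).
exact: (@lin4 (fun k i => dfun abase (@wrow C k i) x)
  (fun k => dfun abase (dsubst (dpi C) (ode C k)) x) (fun i => E i x)).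
Qed.

End Chain.

(** The Wronskian matrix of the four functions is the matrix of the u, q1, q2, q3 times nonzero
    factors and a unitriangular matrix. The conclusion holds at every point near [a], not only for
    germs, since coefficients are to be compared pointwise. *)
Lemma chains_independent (s : C -> C) (u q1 q2 q3 : 'I_4 -> C -> C) :
  (forall j, solution_chain s (u j) (q1 j) (q2 j) (q3 j)) ->
  \forall x \near a,
  (forall v : nat -> C, (forall j, v 0%N * u j x + v 1%N * q1 j x + v 2%N * q2 j x
      + v 3%N * q3 j x = 0) -> forall i, (i < 4)%N -> v i = 0) ->
  forall d : nat -> C, (forall j, d 0%N * (s x * u j x) + d 1%N * theta (fun x => s x * u j x) x
      + d 2%N * iter 2 theta (fun x => s x * u j x) x
      + d 3%N * iter 3 theta (fun x => s x * u j x) x = 0) ->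
    forall i, (i < 4)%N -> d i = 0.
Proof.
move=> hc.
pose E j := chain_basis s (u j) (q1 j) (q2 j) (q3 j).
have W : \forall x \near a, forall j k, (k < 4)%N -> iter k theta (E j 0) x =
    dfun abase (@wrow C k 0) x * E j 0 x + dfun abase (@wrow C k 1) x * E j 1 x
    + dfun abase (@wrow C k 2) x * E j 2%N x + dfun abase (@wrow C k 3) x * E j 3%N x.
  apply: (@filter_forall _ _ (fun j x => _) (nbhs a) _) => j.
  have := nearI (nearI (chain_wrow (hc j) 0) (chain_wrow (hc j) 1))
    (nearI (chain_wrow (hc j) 2) (chain_wrow (hc j) 3)).
  by apply: nearS => x [[h0 h1] [h2 h3]] [|[|[|[|//]]]].
have [hs s0 _ _ _ _ _ _ _ _ _] := hc 0.
have := nearI (nearI W (near_neq0 hs s0)) (nearI (near_neq0 gam_an gam0) (near_neq0 nu_an nu0)).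
apply: nearS => x [[hW sx] [gx nx]] nondeg d hd.
apply: (@wrow_triangular C (fun i k => iter k theta (abase i) x)).
pose w i := d 0%N * dfun abase (@wrow C 0 i) x + d 1%N * dfun abase (@wrow C 1 i) x
  + d 2%N * dfun abase (@wrow C 2 i) x + d 3%N * dfun abase (@wrow C 3 i) x.
have k1 : K1 x != 0 by rewrite /K1 mulf_neq0// invr_eq0.
have k2 : K2 x != 0 by rewrite /K2 mulf_neq0// invr_eq0.
have k3 : K3 x != 0 by rewrite /K3 mulf_neq0.
pose kk i := nth 0 [:: s x; s x * K1 x; s x * K2 x; s x * K3 x] i.
have kk0 i : (i < 4)%N -> kk i != 0.
  by case: i => [|[|[|[|//]]]] _; [exact: sx|exact: mulf_neq0|exact: mulf_neq0|exact: mulf_neq0].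
suff wz i : (i < 4)%N -> kk i * w i = 0.
  move=> i i4; have /eqP := wz i i4; rewrite mulf_eq0 (negPf (kk0 i i4)) /= => /eqP h.
  exact: h.
apply: (nondeg (fun i => kk i * w i)) => j; have := hd j.
rewrite (hW j 2%N isT) (hW j 3%N isT).
have -> : theta (fun x => s x * u j x) x = iter 1 theta (E j 0) x by [].
rewrite (hW j 1%N isT).
have -> : s x * u j x = iter 0 theta (E j 0) x by [].
rewrite (hW j 0%N isT).
move=> <-.
exact: (@lin4_swap d (fun k i => dfun abase (@wrow C k i) x) (s x) (K1 x) (K2 x) (K3 x)).
Qed.

End ThetaCalculus.

(** * Functions of tau as functions of z *)

Section RegularPoint.
Variable R : realType.
Local Notation C := (cplx R).
Variables (t : C -> C) (CC : set 'M[C]_2) (z w : 'M[C]_2 -> C).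
Variables (T0 : 'M[C]_2) (F : C -> 'M[C]_2) (phi : C -> C).
Hypothesis reg : regular_point t CC z w T0 F phi.
Hypothesis t_an : analytic_at t (T0 0 0).

Local Notation zF := (z \o F).
Local Notation wF := (w \o F).
Local Notation a := (z T0).
Let gam : C -> C := G1 zF \o phi.
Let om : C -> C := wF \o phi.
Let nu : C -> C := v t \o phi.

Lemma reg_branch : branch_at t T0 F. Proof. by case: reg. Qed.

Lemma reg_zF : zF (T0 0 0) = a.
Proof. by have [h _ _ _] := reg_branch; rewrite /= h. Qed.

Lemma reg_wF : wF (T0 0 0) = w T0.
Proof. by have [h _ _ _] := reg_branch; rewrite /= h. Qed.

(** [regular_point] provides a right inverse of z only; it coincides near [a] with the two-sided
    inverse from [inverse_function]. *)
Lemma reg_inverse : local_inverse zF phi (T0 0 0).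
Proof.
have [_ _ [hz _] [_ _ dz _] [hphi phi0 zphi]] := reg.
have [psi [hpsi psi0 zpsi psiz]] := inverse_function hz dz.
rewrite /local_inverse reg_zF in hpsi psi0 zpsi *.
have E : \forall y \near a, phi y = psi y.
  have : \forall y \near a, psi (zF (phi y)) = phi y.
    by apply: (near_analytic (P := fun x => psi (zF x) = x) hphi); rewrite phi0.
  by move=> h; have := nearI h zphi; apply: nearS => y [h1 h2]; rewrite -[LHS]h1 /= h2.
split; [exact: hphi|exact: phi0|exact: zphi|].
have := near_analytic (P := fun y => phi y = psi y) hz; rewrite reg_zF => /(_ E) E'.
by have := nearI psiz E'; apply: nearS => x [h1 ->].
Qed.

Lemma phi_an : analytic_at phi a.
Proof. by case: reg => _ _ _ _ []. Qed.

Lemma phi_at : phi a = T0 0 0.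
Proof. by case: reg => _ _ _ _ []. Qed.

Lemma pull_analytic f : analytic_at f (T0 0 0) -> analytic_at (f \o phi) a.
Proof. by move=> hf; apply: analytic_comp; [rewrite phi_at|exact: phi_an]. Qed.

Lemma near_pull (P : C -> Prop) : (\forall x \near T0 0 0, P x) ->
  \forall y \near a, P (phi y).
Proof. by move=> h; apply: (near_analytic (P := P) phi_an); rewrite phi_at. Qed.

Lemma G1_an : analytic_at (G1 zF) (T0 0 0).
Proof.
have [_ _ [hz _] [z0 _ _ _] _] := reg.
apply: (analytic_div (f := derive1 zF)); [exact: analytic_derive1|exact: hz|].
by rewrite reg_zF.
Qed.

Lemma G1_neq0 : G1 zF (T0 0 0) != 0.
Proof.
have [_ _ _ [z0 _ dz _] _] := reg.
by rewrite /G1 mulf_neq0// invr_eq0 reg_zF.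
Qed.

Lemma gam_analytic : analytic_at gam a. Proof. exact: (pull_analytic G1_an). Qed.
Lemma om_analytic : analytic_at om a.
Proof. by apply: pull_analytic; case: reg => _ _ []. Qed.
Lemma v_analytic : analytic_at (v t) (T0 0 0). Proof. exact: analytic_derive1. Qed.
Lemma nu_analytic : analytic_at nu a. Proof. exact: (pull_analytic v_analytic). Qed.
Lemma gam_neq0 : gam a != 0. Proof. by rewrite /gam /= phi_at; exact: G1_neq0. Qed.
Lemma om_neq0 : om a != 0.
Proof.
rewrite /om /= phi_at; have [-> _ _ _] := reg_branch.
by case: reg => _ _ _ [].
Qed.
Lemma nu_neq0 : nu a != 0.
Proof. by rewrite /nu /= phi_at; case: reg => _ _ _ []. Qed.

Lemma theta_pull f : analytic_at f (T0 0 0) ->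
  \forall y \near a, theta (f \o phi) y = derive1 f (phi y) / gam y.
Proof.
move=> hf; have [_ _ [hz _] [z0 _ dz _] _] := reg.
have [_ _ zphi _] := reg_inverse; rewrite reg_zF in zphi.
have dz' := near_pull (near_neq0 (analytic_derive1 hz) dz).
have hf' := near_pull (analytic_near hf); have hz' := near_pull (analytic_near hz).
have := nearI (nearI (near_neq z0) (near_near zphi)) (nearI (nearI dz' (analytic_near phi_an))
  (nearI hf' hz')).
apply: nearS => y [[y0 zy] [[dy phiy] [fy zFy]]].
have D := derive1_near zy; rewrite (derive1_chain zFy phiy) derive1_id_fun in D.
rewrite /theta (derive1_chain fy phiy) /gam /= /G1 /=.
have -> : z (F (phi y)) = y by have := near_self zy.
have -> : derive1 phi y = (derive1 zF (phi y))^-1.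
  by apply: (mulfI dy); rewrite D divff.
by move: (derive1 f (phi y)) (derive1 zF (phi y)) dy => u v v0; field; rewrite v0 y0.
Qed.

Local Notation B := (abase gam om nu).

Lemma B_near : \forall y \near a, analytic_base B y.
Proof.
exact: (abase_near gam_analytic om_analytic nu_analytic gam_neq0 om_neq0 nu_neq0).
Qed.

Lemma pull_derive1 f e k : analytic_at f (T0 0 0) ->
  (\forall y \near a, f (phi y) = gam y ^+ k * dfun B e y) ->
  \forall y \near a, derive1 f (phi y) =
    gam y ^+ k.+1 * dfun B (dnext k e) y.
Proof.
move=> hf E; have := nearI (nearI (theta_pull hf) (near_theta E))
  (nearI (nearI (analytic_near gam_analytic) (near_neq0 gam_analytic gam_neq0)) B_near).
apply: nearS => y [[t1 t2] [[gy g0] by_]].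
have aX : analytic_at (fun y => gam y ^+ k) y by exact: analyticX.
have tX : theta (fun y => gam y ^+ k) y = k%:R * B 0 y * gam y ^+ k.
  have b0 : B 0 y = theta gam y / gam y by [].
  rewrite b0; elim: k {t2 E aX} => [|k IHk].
    by rewrite !mul0r (_ : (fun y => _) = fun=> 1) ?theta_cst.
  rewrite (_ : (fun y => gam y ^+ k.+1) = fun y => gam y * gam y ^+ k); last first.
    by apply/funext => u; rewrite exprS.
  rewrite (thetaM gy (analyticX k gy)) IHk exprS -natr1.
  by move: (theta gam y) (gam y) g0 (gam y ^+ k) => p q q0 r; field.
have t3 : theta (f \o phi) y = k%:R * B 0 y * gam y ^+ k * dfun B e y
    + gam y ^+ k * dfun B (dderiv e) y.
  by rewrite t2 (thetaM aX (dfun_analytic e by_)) tX (theta_dfun e by_).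
have -> : derive1 f (phi y) = gam y * theta (f \o phi) y.
  by rewrite t1 mulrC divfK.
have -> : dfun B (dnext k e) y = dfun B (dderiv e) y + k%:R / 1 * B 0 y * dfun B e y by [].
rewrite t3 exprS.
by move: (gam y ^+ k) (gam y) (dfun B (dderiv e) y) (dfun B e y) (B 0 y) => p q r s u; field.
Qed.

Lemma gam_pull y : G1 zF (phi y) = gam y ^+ 1 * dfun B (DCst 1) y.
Proof. by rewrite /dfun /= mulr1. Qed.

Let n0 : dpoly C := DVar C 2 0.
Let m0 : dpoly C := DVar C 1 0.

Lemma G2_an : analytic_at (G2 wF) (T0 0 0).
Proof.
have [_ _ [_ hw] [_ w0 _ _] _] := reg.
apply: (analytic_div (f := derive1 wF)); [exact: analytic_derive1|exact: hw|].
by rewrite reg_wF.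
Qed.

Lemma G3_an : analytic_at (G3 t) (T0 0 0).
Proof.
have [_ _ _ [_ _ _ v0] _] := reg.
apply: (analytic_div (f := derive1 (v t))); last exact: v0.
  exact: (analytic_derive1 v_analytic).
exact: v_analytic.
Qed.

Lemma G23_an : analytic_at (G23 wF t) (T0 0 0).
Proof. exact: (analyticD G2_an G3_an). Qed.

Lemma pull_logd f : analytic_at f (T0 0 0) -> f (T0 0 0) != 0 ->
  \forall y \near a, derive1 f (phi y) / f (phi y) = gam y ^+ 1 * logd (f \o phi) y.
Proof.
move=> hf f0; have := nearI (theta_pull hf) (near_neq0 gam_analytic gam_neq0).
apply: nearS => y [t1 g0]; rewrite /logd t1 expr1 /=.
by move: (derive1 f (phi y)) (f (phi y))^-1 (gam y) g0 => p q r r0; field.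
Qed.

Lemma G2_pull : \forall y \near a, G2 wF (phi y) = gam y ^+ 1 * dfun B m0 y.
Proof.
have [_ _ [_ hw] [_ w0 _ _] _] := reg.
by apply: pull_logd; [exact: hw|rewrite reg_wF].
Qed.

Lemma G3_pull : \forall y \near a, G3 t (phi y) = gam y ^+ 1 * dfun B n0 y.
Proof.
have [_ _ _ [_ _ _ v0] _] := reg.
by apply: (pull_logd v_analytic); exact: v0.
Qed.

Lemma G23_pull : \forall y \near a,
  G23 wF t (phi y) = gam y ^+ 1 * dfun B (DAdd m0 n0) y.
Proof.
have := nearI G2_pull G3_pull; apply: nearS => y [h1 h2].
by rewrite /G23 h1 h2 -mulrDr.
Qed.

(** Numerator and denominator of each p_i have the same weight in G1, so the powers of [gam] cancel
    and a differential polynomial in a, m, n remains. *)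
Lemma pfun_pull (i : 'I_3) : \forall y \near a,
  pfun zF wF t i (phi y) = dfun B (dpi C i) y.
Proof.
have g1 := pull_derive1 (e := DCst 1) (k := 1) G1_an _.
have d1 := g1 (nearS (fun y _ => gam_pull y) B_near).
have dG23 := pull_derive1 G23_an G23_pull.
have dG3 := pull_derive1 G3_an G3_pull.
have E1 := dG3.
have E2 := pull_derive1 (analytic_derive1 G3_an) E1.
have E3 := pull_derive1 (analytic_derive1 (analytic_derive1 G3_an)) E2.
have := nearI (nearI (near_neq0 gam_analytic gam_neq0) (nearI d1 dG23))
  (nearI (nearI G3_pull G23_pull) (nearI E1 (nearI E2 E3))).
apply: nearS => y [[g0 [k1 k23]] [[k3 j23] [e1 [e2 e3]]]].
have k0 : G1 zF (phi y) = gam y by [].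
have nE : dfun B n0 y = B 2 y by [].
have mnE : dfun B (DAdd m0 n0) y = B 1 y + B 2 y by [].
rewrite nE in k3; rewrite mnE in j23.
case: i => [[|[|[|//]]] hi]; rewrite /pfun /=.
- rewrite /p1 k1 j23 k0.
  have -> : dfun B (dp1 C) y = B 0 y + - (1 / 2) * (B 1 y + B 2 y) by [].
  have -> : dfun B (dnext 1 (DCst 1)) y = 0 + 1 / 1 * B 0 y * 1 by [].
  move: (B 0 y) (B 1 y) (B 2 y) (gam y) g0 => A M N g g0.
  by field.
- rewrite /p2 e1 k23 j23 k3 k0.
  have -> : dfun B (dp2 C) y = 24 / 20 * dfun B (dG3_1 C) y
    + - (20 / 20) * dfun B (dnext 1 (DAdd m0 n0)) y
    + 5 / 20 * ((B 1 y + B 2 y) * (B 1 y + B 2 y)) + - (8 / 20) * (B 2 y * B 2 y) by [].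
  rewrite -/(dG3_1 C).
  move: (dfun B (dG3_1 C) y) (dfun B (dnext 1 (DAdd m0 n0)) y) (B 1 y) (B 2 y) (gam y) g0
    => X Y M N g g0.
  by field.
- have i1 : derive1 (G3 t) (phi y) = gam y ^+ 2 * dfun B (dG3_1 C) y := e1.
  have i2 : derive1n 2 (G3 t) (phi y) = gam y ^+ 3 * dfun B (dG3_2 C) y := e2.
  have i3 : derive1n 3 (G3 t) (phi y) = gam y ^+ 4 * dfun B (dG3_3 C) y := e3.
  rewrite /p3 i1 i2 i3 k3 k0.
  have -> : dfun B (dp3 C) y = - (10 / 50) * dfun B (dG3_3 C) y
    + 40 / 50 * (B 2 y * dfun B (dG3_2 C) y)
    + 21 / 50 * (dfun B (dG3_1 C) y * dfun B (dG3_1 C) y)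
    + - (54 / 50) * (B 2 y * B 2 y * dfun B (dG3_1 C) y)
    + 9 / 50 * (B 2 y * B 2 y * B 2 y * B 2 y) by [].
  move: (dfun B (dG3_1 C) y) (dfun B (dG3_2 C) y) (dfun B (dG3_3 C) y) (B 2 y) (gam y) g0
    => X Y Z N g g0.
  by field.
Qed.

End RegularPoint.

(** * The four solutions *)

Section Solutions.
Variable R : realType.
Local Notation C := (cplx R).
Variables (t : C -> C) (F : C -> 'M[C]_2).
Implicit Types (x : C) (j : nat).

(* the vector (T e; e) with e = (t, 1), on which Sp4 acts linearly *)
Definition Uf j : C -> C := nth (fun=> 0)
  [:: (fun x => t x * x + F x 0 1); (fun x => t x * F x 0 1 + F x 1 1); t; (fun=> 1)] j.
Definition Q1f j : C -> C := nth (fun=> 0) [:: id; (fun x => F x 0 1); (fun=> 1)] j.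
Definition Q2f j : C -> C := nth (fun=> 0) [:: (fun=> 1); (fun x => - t x)] j.
Definition Q3f j : C -> C := nth (fun=> 0) [:: (fun=> 0); (fun=> -1)] j.

Lemma UQ_deriv T0 : branch_at t T0 F -> analytic_at t (T0 0 0) -> forall j,
  [/\ analytic_at (Uf j) (T0 0 0), analytic_at (Q1f j) (T0 0 0),
      analytic_at (Q2f j) (T0 0 0) & analytic_at (Q3f j) (T0 0 0)] /\
  \forall x \near T0 0 0, [/\ derive1 (Uf j) x = derive1 t x * Q1f j x,
    derive1 (Q1f j) x = Q2f j x, derive1 (Q2f j) x = derive1 t x * Q3f j x
    & derive1 (Q3f j) x = 0].
Proof.
move=> [_ _ [h2 d2] [h3 d3]] ht.
have c0 (c x : C) : analytic_at (fun=> c) x := analytic_cst c x.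
have N := nearI (nearI (analytic_near ht) (nearI (analytic_near h2) (analytic_near h3)))
  (nearI d2 d3).
case=> [|[|[|[|j]]]].
- split.
    split; [|exact: analytic_id|exact: c0|exact: c0].
    by apply: analyticD; [exact: (analyticM ht (analytic_id _))|exact: h2].
  apply: nearS N => x [[tx [f2 f3]] [e2 e3]]; split.
  + rewrite /Uf /= (derive1D (analyticM tx (analytic_id x)) f2).
    rewrite (derive1M tx (analytic_id x)) derive1_id_fun e2 mulr1 addrK //.
  + exact: derive1_id_fun.
  + by rewrite derive1_cst_fun mulr0.
  + exact: derive1_cst_fun.
- split.
    split; [|exact: h2|exact: (analyticN ht)|exact: c0].
    by apply: analyticD; [exact: (analyticM ht h2)|exact: h3].
  apply: nearS N => x [[tx [f2 f3]] [e2 e3]]; split.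
  + rewrite /Uf /= (derive1D (analyticM tx f2) f3) (derive1M tx f2) e2 e3.
    by rewrite mulrN -expr2 subrK.
  + exact: e2.
  + by rewrite /Q2f /= (derive1N tx) mulrN1.
  + exact: derive1_cst_fun.
- split; first by split; [exact: ht|exact: c0|exact: c0|exact: c0].
  apply: nearS N => x _; split.
  + by rewrite mulr1.
  + exact: derive1_cst_fun.
  + by rewrite derive1_cst_fun mulr0.
  + exact: derive1_cst_fun.
- split; first by split; exact: c0.
  apply: nearS N => x _; split.
  + by rewrite derive1_cst_fun mulr0.
  + exact: derive1_cst_fun.
  + by rewrite derive1_cst_fun mulr0.
  + exact: derive1_cst_fun.
- rewrite /Uf /Q1f /Q2f /Q3f /= !nth_nil; split; first by split; exact: c0.
  by apply: nearS N => x _; rewrite derive1_cst_fun mulr0.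
Qed.

Variables (CC : set 'M[C]_2) (z w : 'M[C]_2 -> C).
Variables (T0 : 'M[C]_2) (phi : C -> C).
Hypothesis reg : regular_point t CC z w T0 F phi.
Hypothesis t_an : analytic_at t (T0 0 0).

Local Notation zF := (z \o F).
Local Notation wF := (w \o F).
Local Notation a := (z T0).
Let gam : C -> C := G1 zF \o phi.
Let om : C -> C := wF \o phi.
Let nu : C -> C := v t \o phi.

Definition sqrt_factor (s : C -> C) := [/\ analytic_at s a, s a != 0 &
  \forall y \near a, s y ^+ 2 = om y ^+ 2 / gam y].

Lemma sqrt_factor_exists : exists s, sqrt_factor s.
Proof.
have hg := gam_analytic reg; have ho := om_analytic reg.
have g0 := gam_neq0 reg; have o0 := om_neq0 reg.
pose f y := om y ^+ 2 / gam y.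
have hf : analytic_at f a by exact: (analytic_div (analyticX 2 ho) hg g0).
have f0 : f a != 0 by rewrite /f mulf_neq0 ?invr_eq0 ?expf_neq0.
have [s [h1 h2 h3]] := analytic_sqrt hf f0 (sqrtCK (f a)).
exists s; split; [exact: h1| |exact: h3].
by rewrite h2 sqrtC_eq0.
Qed.

Lemma chain_at s j : sqrt_factor s ->
  solution_chain gam om nu a s (Uf j \o phi) (Q1f j \o phi) (Q2f j \o phi) (Q3f j \o phi).
Proof.
move=> [hs s0 ss]; have [[h0 h1 h2 h3] d] := UQ_deriv (reg_branch reg) t_an j.
have dn := near_pull reg d; have g0 := near_neq0 (gam_analytic reg) (gam_neq0 reg).
have pull f e : analytic_at f (T0 0 0) -> (\forall y \near a, derive1 f (phi y) = e y) ->
    \forall y \near a, theta (f \o phi) y = e y / gam y.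
  move=> hf he; have := nearI (theta_pull reg hf) he.
  by apply: nearS => y [-> ->].
split; [exact: hs|exact: s0|exact: ss|exact: (pull_analytic reg h0)|
  exact: (pull_analytic reg h1)|exact: (pull_analytic reg h2)|exact: (pull_analytic reg h3)|..].
- have := pull _ _ h0 (nearS (fun y (h : [/\ _, _, _ & _]) => let: And4 e _ _ _ := h in e) dn).
  by apply: nearS => y ->; rewrite /K1 /nu /v /= mulrAC.
- exact: (pull _ _ h1 (nearS (fun y (h : [/\ _, _, _ & _]) => let: And4 _ e _ _ := h in e) dn)).
- have := pull _ _ h2 (nearS (fun y (h : [/\ _, _, _ & _]) => let: And4 _ _ e _ := h in e) dn).
  by apply: nearS => y ->; rewrite /K1 /nu /v /= mulrAC.
- have := pull _ _ h3 (nearS (fun y (h : [/\ _, _, _ & _]) => let: And4 _ _ _ e := h in e) dn).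
  by apply: nearS => y ->; rewrite mul0r.
Qed.

(** Up to the order of rows the matrix of the four chains is triangular with diagonal 1, 1, 1, -1,
    at every point x. *)
Lemma chain_nondeg x (v : nat -> C) : (forall j : 'I_4, v 0%N * Uf j x + v 1%N * Q1f j x
    + v 2%N * Q2f j x + v 3%N * Q3f j x = 0) -> forall i, (i < 4)%N -> v i = 0.
Proof.
move=> h; have h0 := h (@Ordinal 4 0 isT); have h1 := h (@Ordinal 4 1 isT).
have h2 := h (@Ordinal 4 2 isT); have h3 := h (@Ordinal 4 3 isT).
move: h0 h1 h2 h3; rewrite /Uf /Q1f /Q2f /Q3f /=.
rewrite !(mulr0, addr0, mulr1, mulrN1) => h0 h1 h2 h3.
rewrite h3 mul0r add0r in h2; rewrite h3 h2 !mul0r !add0r in h0 h1.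
rewrite h0 mul0r add0r in h1.
case=> [|[|[|[|//]]]] _; [exact: h3|exact: h2|exact: h0|].
by apply/eqP; rewrite -oppr_eq0 h1.
Qed.

(** The derivatives of the common factor w cancel, and theta is d/dtau divided by G1. *)
Lemma wronskian_pull (m n : C -> C) : analytic_at m (T0 0 0) -> analytic_at n (T0 0 0) ->
  \forall y \near a, wronskian (fun y => m (phi y) * om y) (fun y => n (phi y) * om y) y =
    om y ^+ 2 / gam y * (m (phi y) * derive1 n (phi y) - derive1 m (phi y) * n (phi y)).
Proof.
move=> hm hn; have := nearI (nearI (theta_pull reg hm) (theta_pull reg hn))
  (nearI (analytic_near (om_analytic reg)) (nearI (analytic_near (pull_analytic reg hm))
    (analytic_near (pull_analytic reg hn)))).
apply: nearS => y [[e1 e2] [oy [my ny]]].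
rewrite /wronskian (thetaM my oy) (thetaM ny oy) e1 e2.
have -> : (m \o phi) y = m (phi y) by [].
have -> : (n \o phi) y = n (phi y) by [].
rewrite -/om -/gam.
by move: (theta om y) (om y) (gam y)^-1 (m (phi y)) (n (phi y))
  (derive1 m (phi y)) (derive1 n (phi y)) => *; ring.
Qed.

(** The determinant that belongs to the j-th entry of (T e; e): t tau + tau2 to (w1, w4), t tau2 +
    tau3 to (w3, w4), t to (w0, w3) and 1 to (w0, w1). *)
Definition det_index (j : 'I_4) : 'I_4 := nth ord0
  [:: (@Ordinal 4 2 isT); (@Ordinal 4 3 isT); (@Ordinal 4 1 isT); (@Ordinal 4 0 isT)] j.

(** For each pair m w, n w the expression m n' - m' n is a perfect square: with delta = tau tau3 -
    tau2^2 one has delta' = tau3 + tau t^2 + 2 tau2 t, hence tau delta' - delta = (t tau + tau2)^2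
    and tau3 delta' - t^2 delta = (t tau2 + tau3)^2. *)
Lemma det_fun_sqr s (j : 'I_4) : sqrt_factor s ->
  \forall y \near a, det_fun w F phi (det_index j) y = (s y * Uf j (phi y)) ^+ 2.
Proof.
move=> [_ _ ss]; have hF := reg_branch reg; have [_ _ [h2 d2] [h3 d3]] := hF.
have b := branch_mx_analytic hF.
have h1 : analytic_at (fun x => F x 0 0) (T0 0 0) := b 0 0.
have d1 : \forall x \near T0 0 0, derive1 (fun x => F x 0 0) x = 1.
  have E : \forall x \near T0 0 0, F x 0 0 = x.
    by apply: nearS (branch_sym hF) => x [].
  by apply: nearS (near_derive1 E) => x ->; exact: derive1_id_fun.
have h0 : analytic_at (fun=> 1 : C) (T0 0 0) := analytic_cst _ _.
have h4 : analytic_at (fun x => F x 0 0 * F x 1 1 - F x 0 1 ^+ 2) (T0 0 0).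
  by apply: analyticB; [exact: analyticM|exact: analyticX].
have N := nearI (nearI (analytic_near h1) (nearI (analytic_near h2) (analytic_near h3)))
  (nearI (nearI d1 (nearI d2 d3)) (branch_sym hF)).
have d4 : \forall x \near T0 0 0, derive1 (fun x => F x 0 0 * F x 1 1 - F x 0 1 ^+ 2) x
    = F x 1 1 + x * t x ^+ 2 + 2 * F x 0 1 * t x.
  apply: nearS N => x [[f1 [f2 f3]] [[e1 [e2 e3]] [e0 _]]].
  rewrite (derive1B (analyticM f1 f3) (analyticX 2 f2)) (derive1M f1 f3) (derive1X2 f2).
  by rewrite e1 e2 e3 e0 mul1r mulrN opprK.
have D := near_pull reg (nearI (nearI d1 (nearI d2 d3)) (nearI d4 (branch_sym hF))).
have W := fun m n (hm : analytic_at m _) (hn : analytic_at n _) =>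
  nearI (nearI (wronskian_pull hm hn) ss) D.
case: j => [[|[|[|[|//]]]] hj]; rewrite /det_index /det_fun /Uf /=.
- apply: nearS (W _ _ h1 h4) => y [[Wy sy] [[e1 [e2 e3]] [e4 [e0 _]]]].
  rewrite exprMn sy.
  etransitivity; first exact: Wy.
  rewrite e1 e4 e0 -/om; congr (_ * _).
  by move: (F (phi y) 1 1) (F (phi y) 0 1) (t (phi y)) (phi y) => *; ring.
- apply: nearS (W _ _ h3 h4) => y [[Wy sy] [[e1 [e2 e3]] [e4 [e0 _]]]].
  rewrite exprMn sy.
  etransitivity; first exact: Wy.
  rewrite e3 e4 e0 -/om; congr (_ * _).
  by move: (F (phi y) 1 1) (F (phi y) 0 1) (t (phi y)) (phi y) => *; ring.
- apply: nearS (W _ _ h0 h3) => y [[Wy sy] [[e1 [e2 e3]] [e4 [e0 _]]]].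
  rewrite exprMn sy.
  etransitivity; first exact: Wy.
  by rewrite e3 derive1_cst_fun mul0r subr0 mul1r.
- apply: nearS (W _ _ h0 h1) => y [[Wy sy] [[e1 [e2 e3]] [e4 [e0 _]]]].
  rewrite exprMn sy.
  etransitivity; first exact: Wy.
  by rewrite e1 derive1_cst_fun mul0r subr0 mul1r expr1n.
Qed.

Lemma Y_analytic s (j : 'I_4) : sqrt_factor s ->
  analytic_at (fun y => s y * Uf j (phi y)) a.
Proof.
move=> [hs _ _]; have [[h0 _ _ _] _] := UQ_deriv (reg_branch reg) t_an j.
exact: (analyticM hs (pull_analytic reg h0)).
Qed.

(** A relation with constant coefficients between the U passes to Q1, Q2 and Q3 by differentiating
    and dividing by nonvanishing factors; the four relations at one point form a triangular
    system. *)
Lemma Y_lin_indep s : sqrt_factor s ->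
  lin_indep_at (fun (j : 'I_4) y => s y * Uf j (phi y)) a.
Proof.
move=> sf b hb; have ch j := chain_at j sf; have [hs s0 _] := sf.
have hK := near_neq0 (nu_analytic reg t_an) (nu_neq0 reg).
have hG := near_neq0 (gam_analytic reg) (gam_neq0 reg).
pose S (f : nat -> C -> C) y := \sum_(j < 4) b j * f j y.
have thS (f f' : nat -> C -> C) (k : C -> C) : (forall j, analytic_at (f j) a) ->
    (forall j, \forall y \near a, theta (f j) y = k y * f' j y) ->
    (\forall y \near a, S f y = 0) -> (\forall y \near a, k y != 0) ->
    \forall y \near a, S f' y = 0.
  move=> hf hf' hS hk; have aS := fun j : 'I_4 => analytic_near (hf j).
  have A : \forall y \near a, forall j : 'I_4, analytic_at (f j) y.
    exact: (@filter_forall _ _ (fun (j : 'I_4) y => _) (nbhs a) _ aS).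
  have D : \forall y \near a, forall j : 'I_4, theta (f j) y = k y * f' j y.
    by apply: (@filter_forall _ _ (fun (j : 'I_4) y => _) (nbhs a) _) => j; exact: hf'.
  have := nearI (nearI A D) (nearI (near_theta hS) hk).
  apply: nearS => y [[Ay Dy] [t1 ky]]; rewrite theta_cst in t1.
  have : theta (S f) y = k y * S f' y.
    rewrite /S /theta derive1_sum; last first.
      by move=> j; apply: analyticM; [exact: analytic_cst|exact: Ay].
    rewrite !mulr_sumr; apply: eq_bigr => j _.
    have /= := thetaZ (b j) (Ay j); rewrite /theta => ->.
    by have := Dy j; rewrite /theta => ->; rewrite mulrCA.
  rewrite t1 => /esym/eqP; rewrite mulf_eq0 (negPf ky) /= => /eqP; exact.
have S0 : \forall y \near a, S (fun j => Uf j \o phi) y = 0.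
  have := nearI hb (near_neq0 hs s0); apply: nearS => y [hy sy].
  have : s y * S (fun j => Uf j \o phi) y = 0.
    by rewrite -[RHS]hy /S mulr_sumr; apply: eq_bigr => j _; rewrite mulrCA.
  by move=> /eqP; rewrite mulf_eq0 (negPf sy) /= => /eqP.
have k1 : \forall y \near a, K1 gam nu y != 0.
  by have := nearI hK hG; apply: nearS => y [h1 h2]; rewrite /K1 mulf_neq0// invr_eq0.
have k2 : \forall y \near a, (gam y)^-1 != 0.
  by apply: nearS hG => y; rewrite invr_eq0.
have S1 : \forall y \near a, S (fun j => Q1f j \o phi) y = 0.
  apply: (thS _ _ _ _ _ S0 k1) => j; first by case: (ch j).
  exact: theta_u (ch j).
have S2 : \forall y \near a, S (fun j => Q2f j \o phi) y = 0.
  apply: (thS _ _ _ _ _ S1 k2) => j; first by case: (ch j).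
  by apply: nearS (theta_q1 (ch j)) => y ->; rewrite mulrC.
have S3 : \forall y \near a, S (fun j => Q3f j \o phi) y = 0.
  apply: (thS _ _ _ _ _ S2 k1) => j; first by case: (ch j).
  exact: theta_q2 (ch j).
move: (near_self S0) (near_self S1) (near_self S2) (near_self S3).
rewrite /S !big_ord_recl !big_ord0 /Uf /Q1f /Q2f /Q3f /=.
rewrite !(mulr0, addr0, add0r, mulr1, mulrN1).
set b0 := b ord0; set b1 := b (lift ord0 ord0).
set b2 := b _; set b3 := b _.
move=> e0 e1 e2 /eqP; rewrite oppr_eq0 => /eqP e3.
rewrite e3 !mul0r ?add0r ?addr0 in e0 e1 e2.
rewrite e2 !mul0r !add0r in e0 e1.
rewrite e1 mul0r add0r in e0.
case=> [[|[|[|[|//]]]] hj].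
- by rewrite -e2; congr b; exact: val_inj.
- by rewrite -e3; congr b; exact: val_inj.
- by rewrite -e1; congr b; exact: val_inj.
- by rewrite -e0; congr b; exact: val_inj.
Qed.

End Solutions.

Import (canonicals) mpoly.

(** * Differential polynomials as multivariate polynomials *)

Section ToMpoly.
Variable C : numClosedFieldType.

Fixpoint dpoly_mpoly (e : dpoly C) : mpoly.mpoly (3 * 4) C := match e with
  | DVar i k => mpoly.mpolyX C (mpoly.mnm1 (mxvec_index (inord i : 'I_3) (inord k : 'I_4)))
  | DCst c => mpoly.mpolyC (3 * 4) c
  | DAdd e f => dpoly_mpoly e + dpoly_mpoly f
  | DMul e f => dpoly_mpoly e * dpoly_mpoly f
  end.

(** Keeps all indices in the range where [inord] is faithful; outside it returns 0. *)
Fixpoint dpoly_wf (e : dpoly C) := match e with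
  | DVar i k => (i < 3) && (k < 4)
  | DCst _ => true
  | DAdd e f | DMul e f => dpoly_wf e && dpoly_wf f
  end%N.

Lemma diff_poly_evalE e (p : 'I_3 -> C -> C) x : dpoly_wf e ->
  diff_poly_eval (dpoly_mpoly e) p x =
  deval (fun i k => iter k theta (p (inord i)) x) e.
Proof.
rewrite /diff_poly_eval; elim: e => [i k|c|e IHe f IHf|e IHe f IHf] /=.
- move=> /andP[hi hk]; rewrite mpoly.mevalXU mxvecE mxE.
  by rewrite inordK.
- by rewrite mpoly.mevalC.
- by move=> /andP[/IHe <- /IHf <-]; rewrite mpoly.mevalD.
- by move=> /andP[/IHe <- /IHf <-]; rewrite mpoly.mevalM.
Qed.

Lemma ode_wf k : (k < 4)%N -> dpoly_wf (ode C k).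
Proof. by case: k => [|[|[|[|//]]]]. Qed.

End ToMpoly.

(** * The equation at a regular point *)

Section LocalEquation.
Variable R : realType.
Local Notation C := (cplx R).
Variables (t : C -> C) (CC : set 'M[C]_2) (z w : 'M[C]_2 -> C).
Variables (T0 : 'M[C]_2) (F : C -> 'M[C]_2) (phi : C -> C).
Hypothesis reg : regular_point t CC z w T0 F phi.
Hypothesis t_an : analytic_at t (T0 0 0).

Local Notation zF := (z \o F).
Local Notation wF := (w \o F).
Local Notation a := (z T0).
Local Notation gam := (G1 zF \o phi).
Local Notation om := (wF \o phi).
Local Notation nu := (v t \o phi).

Definition p_at (i : 'I_3) : C -> C := pfun zF wF t i \o phi.
Definition c_at (k : 'I_4) : C -> C := diff_poly_eval (dpoly_mpoly (ode C k)) p_at.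

Lemma p_at_near i : \forall y \near a, p_at (inord i) y = dfun (abase gam om nu) (dpi C i) y.
Proof.
(* For i >= 3 the two defaults agree: [inord] returns 0 and [dpi] returns [dp1]. *)
have -> : dpi C i = dpi C (inord i : 'I_3).
  case: i => [|[|[|i]]]; [by rewrite inordK|by rewrite inordK|by rewrite inordK|].
  have -> : inord i.+3 = ord0 :> 'I_3 by apply: val_inj; rewrite /inord val_insubd.
  by rewrite /dpi nth_default.
exact: (pfun_pull reg t_an).
Qed.

Lemma c_atE k y : c_at k y = dfun (fun i => p_at (inord i)) (ode C k) y.
Proof. exact: (diff_poly_evalE p_at y (@ode_wf C k (ltn_ord k))). Qed.

Lemma c_analytic k : analytic_at (c_at k) a.
Proof.
have b := B_near reg t_an.
have E := dfun_dsubst (ode C k) b p_at_near.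
apply: analytic_near_eq (dfun_analytic (dsubst (dpi C) (ode C k)) (near_self b)).
by apply: nearS E => y Ey; rewrite c_atE Ey.
Qed.

Lemma Y_solves s (j : 'I_4) : sqrt_factor F z w T0 phi s ->
  solves_lde c_at (fun y => s y * Uf t F j (phi y)) a.
Proof.
move=> sf; have := chain_solution (gam_analytic reg) (om_analytic reg)
  (nu_analytic reg t_an) (gam_neq0 reg) (om_neq0 reg) (nu_neq0 reg)
  (chain_at reg t_an j sf) p_at_near.
apply: nearS => y h; rewrite -[RHS]h; congr (_ + _).
by apply: eq_bigr => k _; rewrite c_atE.
Qed.

Lemma solves_near (c : 'I_4 -> C -> C) y y' b : (\forall x \near b, y x = y' x) ->
  solves_lde c y b -> solves_lde c y' b.
Proof.
move=> E h; have A : \forall x \near b, forall k : 'I_4, iter k theta y x = iter k theta y' x.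
  apply: (@filter_forall _ _ (fun (k : 'I_4) x => _) (nbhs b) _) => k.
  exact: near_iter_theta.
have := nearI h (nearI A (near_iter_theta 4 E)).
apply: nearS => x [hx [Ax A4]]; rewrite -A4 -[RHS]hx; congr (_ + _).
by apply: eq_bigr => k _; rewrite Ax.
Qed.

Lemma iter_thetaZ k (b : C) f x : analytic_at f x ->
  \forall y \near x, iter k theta (fun y => b * f y) y = b * iter k theta f y.
Proof.
move=> hf; elim: k => [|k IHk]; first by apply: nearS (analytic_near hf).
have := nearI (near_theta IHk) (analytic_near (analytic_iter_theta k hf)).
by apply: nearS => y [/= -> h]; exact: thetaZ.
Qed.

Lemma solvesZ (c : 'I_4 -> C -> C) (b : C) f x : analytic_at f x ->
  solves_lde c f x -> solves_lde c (fun y => b * f y) x.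
Proof.
move=> hf h; have A : \forall y \near x, forall k : 'I_4,
    iter k theta (fun y => b * f y) y = b * iter k theta f y.
  apply: (@filter_forall _ _ (fun (k : 'I_4) x => _) (nbhs x) _) => k.
  exact: iter_thetaZ.
have := nearI h (nearI A (iter_thetaZ 4 b hf)).
apply: nearS => y [hy [Ay A4]]; rewrite A4 -[RHS](mulr0 b) -[in RHS]hy mulrDr.
congr (_ + _); rewrite mulr_sumr; apply: eq_bigr => k _.
by rewrite Ay mulrCA.
Qed.

Lemma det_index_inj : injective det_index.
Proof.
by case=> [[|[|[|[|//]]]] hi] [[|[|[|[|//]]]] hj] //= _; exact: val_inj.
Qed.

Definition det_perm : 'S_4 := perm det_index_inj.

Lemma sqrt_branch_solves (i : 'I_4) y : sqrt_branch (det_fun w F phi i) y a ->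
  solves_lde c_at y a.
Proof.
move=> [hy ysq]; have [s sf] := sqrt_factor_exists reg.
have [j ij] : exists j, det_index j = i.
  by exists (perm_inv det_perm i); rewrite -[det_index _](permE det_index_inj) permKV.
have hY := Y_analytic reg t_an j sf; have hS := Y_solves j sf.
have E : \forall x \near a, y x ^+ 2 = (s x * Uf t F j (phi x)) ^+ 2.
  have := nearI ysq (det_fun_sqr reg j sf); rewrite ij.
  by apply: nearS => x [-> ->].
have [h|h] := analytic_sqr_eq hy hY E.
  by apply: (solves_near _ hS); apply: nearS h => x ->.
apply: (solves_near _ (solvesZ (-1) hY hS)).
by apply: nearS h => x ->; rewrite mulN1r.
Qed.

(** The difference of two such equations has order at most three and holds for all four solutions,
    which [chains_independent] excludes at each point. So coefficients can be continued by looking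
    at the solutions alone. *)
Lemma coefficients_unique (c : 'I_4 -> C -> C) s : sqrt_factor F z w T0 phi s ->
  (forall j : 'I_4, solves_lde c (fun y => s y * Uf t F j (phi y)) a) ->
  \forall y \near a, forall k, c k y = c_at k y.
Proof.
move=> sf hc.
have I := chains_independent (gam_analytic reg) (om_analytic reg) (nu_analytic reg t_an)
  (gam_neq0 reg) (om_neq0 reg) (nu_neq0 reg) (fun j : 'I_4 => chain_at reg t_an j sf).
have A : \forall y \near a, forall j : 'I_4,
    iter 4 theta (fun y => s y * Uf t F j (phi y)) y
      + \sum_(k < 4) c k y * iter k theta (fun y => s y * Uf t F j (phi y)) y = 0 /\
    iter 4 theta (fun y => s y * Uf t F j (phi y)) y
      + \sum_(k < 4) c_at k y * iter k theta (fun y => s y * Uf t F j (phi y)) y = 0.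
  apply: (@filter_forall _ _ (fun (j : 'I_4) x => _) (nbhs a) _) => j.
  exact: nearI (hc j) (Y_solves j sf).
have := nearI I A; apply: nearS => y [Iy Ay].
have {Iy} := Iy (fun v => @chain_nondeg R t F (phi y) v) => Iy.
pose d k := c (inord k) y - c_at (inord k) y.
have d0 i : (i < 4)%N -> d i = 0.
  move: i; apply: Iy => j; have [e1 e2] := Ay j.
  pose f k := d k * iter k theta (fun y => s y * Uf t F j (phi y)) y.
  have : \sum_(k < 4) f k = 0.
    transitivity (\sum_(k < 4) c k y * iter k theta (fun y => s y * Uf t F j (phi y)) y
      - \sum_(k < 4) c_at k y * iter k theta (fun y => s y * Uf t F j (phi y)) y).
      by rewrite -sumrB; apply: eq_bigr => k _; rewrite /f /d inord_val mulrBl.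
    by apply/eqP; rewrite subr_eq0; apply/eqP; apply: (addrI (iter 4 theta
      (fun y => s y * Uf t F j (phi y)) y)); rewrite e1 e2.
  by rewrite sum4E.
by move=> k; apply/eqP; rewrite -subr_eq0 -(inord_val k); apply/eqP; exact: d0.
Qed.

End LocalEquation.

(** * Analytic continuation and monodromy *)

Section Continuation.
Variables (R : realType) (J : finType).
Local Notation C := (cplx R).
Implicit Types (b : C) (f g : J -> C -> C).

Definition germ_eq b f g := forall i, \forall x \near b, f i x = g i x.

Lemma germ_eq_all b f g : germ_eq b f g -> \forall x \near b, germ_eq x f g.
Proof.
move=> h; apply: (@filter_forall _ _ (fun (i : J) x => _) (nbhs b) _) => i.
exact: near_near (h i).
Qed.

Lemma germ_eq_sym b f g : germ_eq b f g -> germ_eq b g f.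
Proof. by move=> h i; apply: nearS (h i) => x ->. Qed.

Lemma germ_eq_trans b f g h : germ_eq b f g -> germ_eq b g h -> germ_eq b f h.
Proof. by move=> h1 h2 i; have := nearI (h1 i) (h2 i); apply: nearS => x [-> ->]. Qed.

Lemma germ_eq_refl b f : germ_eq b f f.
Proof. by move=> i; apply/near_nrm; exists 1. Qed.

(** Neighbourhoods in the space of germs: the same functions, taken at the nearby points. *)
Definition nb_germ (p : C * (J -> C -> C)) (U : C * (J -> C -> C) -> Prop) :=
  \forall y \near p.1, forall g, germ_eq y g p.2 -> U (y, g).

(** The path is hidden, which makes continuation a transitive relation between germs; the index [J]
    lets one path serve a whole family. *)
Definition continues b f b' g := exists c : R -> C * (J -> C -> C),
  [/\ nbpath nb_germ c,
      forall s, 0 <= s <= 1 -> (c s).1 != 0 /\ forall i, analytic_at ((c s).2 i) (c s).1,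
      (c 0).1 = b /\ germ_eq b (c 0).2 f &
      (c 1).1 = b' /\ germ_eq b' (c 1).2 g].

Lemma continues_trans b f b' g b'' h :
  continues b f b' g -> continues b' g b'' h -> continues b f b'' h.
Proof.
move=> [c [pc ac [c0 cf] [c1 cg]]] [d [pd ad [d0 dg] [d1 dh]]].
exists (cat_path c d); split.
- apply: nbpath_cat; [exact: pc|exact: pd|] => U; rewrite /nb_germ c1 d0 => hU.
  have E : germ_eq b' (d 0).2 (c 1).2 := germ_eq_trans dg (germ_eq_sym cg).
  have := nearI hU (germ_eq_all E); apply: nearS => y [hy Ey] k hk.
  by apply: hy; exact: germ_eq_trans hk Ey.
- exact: (@cat_path_all _ _ (fun p => p.1 != 0 /\ forall i, analytic_at (p.2 i) p.1) c d ac ad).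
- by rewrite cat_path0; split; [exact: c0|exact: cf].
- by rewrite cat_path1; split; [exact: d1|exact: dh].
Qed.

Lemma continues_eq b f f' b' g g' : germ_eq b f f' -> germ_eq b' g g' ->
  continues b f b' g -> continues b f' b' g'.
Proof.
move=> hf hg [c [pc ac [c0 cf] [c1 cg]]]; exists c; split; [exact: pc|exact: ac| |].
  by split; [exact: c0|exact: germ_eq_trans cf hf].
by split; [exact: c1|exact: germ_eq_trans cg hg].
Qed.

(** The path is the image of a segment under [u]. With [u = z \o F], moving along the curve moves
    the base point of the germs. *)
Lemma continues_local (u : C -> C) a f : analytic_at u a -> u a != 0 ->
  (forall i, analytic_at (f i) (u a)) ->
  exists2 e : R, 0 < e & forall x y, nrm (x - a) < e -> nrm (y - a) < e ->
    continues (u x) f (u y) f.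
Proof.
move=> hu u0 hf.
have A : \forall y \near u a, forall i, analytic_at (f i) y.
  exact: (@filter_forall _ _ (fun (i : J) y => analytic_at (f i) y) (nbhs (u a)) _
    (fun i => analytic_near (hf i))).
have := nearI (nearI (analytic_near hu) (near_neq0 hu u0))
  (near_analytic (P := fun y => forall i, analytic_at (f i) y) hu A).
move=> /near_nrm[e e0 H]; exists e; first exact: e0.
move=> x y xe ye; exists (fun s => (u (seg x y s), f)); split.
- move=> s hs U hU; have [[us _] _] := H _ (seg_ball hs xe ye).
  have h := near_analytic (P := fun v => forall g, germ_eq v g f -> U (v, g)) us hU.
  have [d d0 hd] := seg_near h; exists d; first exact: d0.
  by move=> s' hs' _; apply: (hd s' hs'); exact: germ_eq_refl.
- by move=> s hs; have [[_ us] af] := H _ (seg_ball hs xe ye); split; [exact: us|exact: af].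
- by rewrite /= seg0; split; [|exact: germ_eq_refl].
- by rewrite /= seg1; split; [|exact: germ_eq_refl].
Qed.

Lemma continues_path b f b' g : continues b f b' g -> exists beta : R -> C,
  [/\ path_in [set x | x != 0] beta, beta 0 = b, beta 1 = b' &
      forall i, continues_along beta (f i) (g i)].
Proof.
move=> [c [pc ac [c0 cf] [c1 cg]]]; exists (fun s => (c s).1); split; [|exact: c0|exact: c1|].
- split; last by move=> s /ac[].
  apply/subspace_continuousP => s; rewrite /= in_itv /= => hs Q hQ.
  have nQ : nb_germ (c s) (fun p => Q p.1) by apply: nearS hQ => y Qy g' _.
  have [e e0 He] := pc s hs _ nQ.
  rewrite /within /=; apply/near_R; exists e; first exact: e0.
  by move=> v ve; rewrite in_itv; exact: He.
- move=> i; exists (fun s => (c s).2 i); split.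
  + by rewrite c0; exact: cf.
  + by rewrite c1; exact: cg.
  + move=> s hs; split; first by have [_] := ac s hs; exact.
    have nU : nb_germ (c s) (fun p => \forall x \near p.1, p.2 i x = (c s).2 i x).
      have := germ_eq_all (germ_eq_refl (c s).1 (c s).2).
      by apply: nearS => y _ g' hg'; exact: hg'.
    by apply/near_R; exact: pc s hs _ nU.
Qed.

End Continuation.

(** * Meromorphic functions *)

Section Meromorphic.
Variable R : realType.
Local Notation C := (cplx R).
Implicit Types (f g : C -> C) (a x : C).

Lemma dnearE (P : C -> Prop) a :
  (\forall x \near a^', P x) <-> (\forall x \near a, x != a -> P x).
Proof. by []. Qed.

Lemma dnearS (P Q : C -> Prop) a : (forall x, P x -> Q x) ->
  (\forall x \near a^', P x) -> \forall x \near a^', Q x.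
Proof. by move=> PQ; apply: filterS. Qed.

Lemma dnearI (P Q : C -> Prop) a : (\forall x \near a^', P x) ->
  (\forall x \near a^', Q x) -> \forall x \near a^', P x /\ Q x.
Proof. by move=> hP hQ; apply: filterS2 hP hQ. Qed.

Lemma dnear_ex (P : C -> Prop) a : (\forall x \near a^', P x) -> exists x, P x.
Proof.
move=> h; apply: contrapT => no; apply: (@dnear_absurd _ a).
by apply: dnearS h => x Px; apply: no; exists x.
Qed.

Lemma dnear_near (P : C -> Prop) a : (\forall x \near a^', P x) ->
  \forall x \near a^', \forall y \near x, P y.
Proof.
move=> /dnearE /near_near h; apply/dnearE; apply: nearS h => x hx xa.
by have := nearI hx (near_neq xa); apply: nearS => y [h ya]; exact: h.
Qed.

Lemma meromorphic_analytic f a : meromorphic_at f a -> \forall x \near a^', analytic_at f x.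
Proof.
case=> [hf|[[n [g [n0 hg g0 fg]]] _]]; first exact: (nearW_dnear (analytic_near hf)).
have := dnearI (dnearI (dnear_near fg) (dnear_neq a)) (nearW_dnear (analytic_near hg)).
apply: dnearS => x [[fgx xa] gx].
have q : analytic_at (fun y => g y / (y - a) ^+ n) x.
  apply: analytic_div; [exact: gx| |by rewrite expf_neq0// subr_eq0].
  by apply: analyticX; apply: analyticB; [exact: analytic_id|exact: analytic_cst].
by apply: analytic_near_eq q; apply: nearS fgx => y ->.
Qed.

(** At a pole f = g / (x - a)^n the derivative is k / (x - a)^(n+1) with k = g' (x - a) - n g, and k
    a = - n g a is nonzero. *)
Lemma meromorphic_const f a : meromorphic_at f a ->
  (exists c, \forall x \near a, f x = c) \/ (\forall x \near a^', derive1 f x != 0).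
Proof.
case=> [hf|[[n [g [n0 hg g0 fg]]] _]].
  have [h|h] := analytic_isolated (analytic_derive1 hf); last by right.
  by left; exists (f a); exact: analytic_const.
right.
have hs x : analytic_at (fun y : C => y - a) x.
  by apply: analyticB; [exact: analytic_id|exact: analytic_cst].
pose k x := derive1 g x * (x - a) - n%:R * g x.
have hk : analytic_at k a.
  apply: analyticB.
    by apply: analyticM; [exact: analytic_derive1|exact: hs].
  by apply: analyticM; [exact: analytic_cst|exact: hg].
have k0 : k a != 0.
  by rewrite /k subrr mulr0 sub0r oppr_eq0 mulf_neq0// pnatr_eq0 -lt0n.
have := dnearI (dnearI (dnear_near fg) (dnear_neq a))
  (nearW_dnear (nearI (analytic_near hg) (near_neq0 hk k0))).
apply: dnearS => x [[fgx xa] [gx kx]].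
have x0 : x - a != 0 by rewrite subr_eq0.
have xn : (x - a) ^+ n != 0 by rewrite expf_neq0.
rewrite (derive1_near fgx) (derive1_div gx (analyticX n (hs x)) xn) derive1X_id.
have -> : derive1 g x * (x - a) ^+ n - g x * ((x - a) ^+ n.-1 *+ n) = (x - a) ^+ n.-1 * k x.
  rewrite /k; case: n n0 {fg k hk k0 kx fgx xn} => [//|n] _.
  by rewrite /= exprS -mulr_natl; move: (derive1 g x) ((x - a) ^+ n) (g x) => p q r; ring.
by rewrite mulf_neq0 ?invr_eq0 ?expf_neq0// mulf_neq0 ?expf_neq0.
Qed.

(** The identity theorem in the form that the inductions over connected sets require: being
    constantly c near a point is a locally constant property. *)
Lemma meromorphic_const_germ f a : meromorphic_at f a -> \forall x \near a, forall c,
  (\forall y \near a, f y = c) <-> (\forall y \near x, f y = c).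
Proof.
move=> hf; have [[c fc]|df] := meromorphic_const hf.
  apply: nearS (near_near fc) => x fx c'; split=> h.
    have E : c' = c by rewrite -(near_self h) (near_self fc).
    by rewrite E.
  have E : c' = c by rewrite -(near_self h) (near_self fx).
  by rewrite E.
have nc c : ~ \forall y \near a, f y = c.
  move=> h; apply: (@dnear_absurd _ a).
  have := dnearI df (nearW_dnear (near_derive1 h)).
  by apply: dnearS => y []; rewrite derive1_cst_fun => /eqP.
move/dnearE: df => df; apply: nearS df => x df c.
have [->|xa] := eqVneq x a; first by [].
split=> h; exfalso; first exact: nc h.
by have := df xa; rewrite (derive1_near h) derive1_cst_fun eqxx.
Qed.

Lemma meromorphic_neq0 f a : meromorphic_at f a ->
  (\forall x \near a^', derive1 f x != 0) -> \forall x \near a^', f x != 0.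
Proof.
move=> hf df; have [hf'|[[n [g [n0 hg g0 fg]]] _]] := hf.
  have [h|//] := analytic_isolated hf'; exfalso; apply: (@dnear_absurd _ a).
  have := dnearI df (nearW_dnear (near_derive1 h)).
  by apply: dnearS => y []; rewrite derive1_cst_fun => /eqP.
have := dnearI (dnearI fg (dnear_neq a)) (nearW_dnear (near_neq0 hg g0)).
apply: dnearS => x [[-> xa] gx].
by rewrite mulf_neq0// invr_eq0 expf_neq0// subr_eq0.
Qed.

End Meromorphic.

(** * Regular points are generic *)

Section GenericPoints.
Variable R : realType.
Local Notation C := (cplx R).
Variables (H : set C) (t : C -> C) (c1 k3 : C) (z w : 'M[C]_2 -> C).
Local Notation CC := (curve R H t c1 k3).
Hypothesis H_open : open H.
Hypothesis H_connected : connected H.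
Hypothesis t_mero : forall a, H a -> meromorphic_at t a.
Hypothesis t_noncst : exists x y, [/\ H x, H y & t x != t y].
Hypothesis z_mero : meromorphic_on_curve t CC z.
Hypothesis w_mero : meromorphic_on_curve t CC w.
Hypothesis z_noncst : nonconstant_on CC z.
Hypothesis w_noncst : nonconstant_on CC w.
Implicit Types (T : 'M[C]_2) (F : C -> 'M[C]_2).

Lemma t_derive1_neq0 a : H a -> \forall x \near a^', derive1 t x != 0.
Proof.
move=> Ha; have [[c tc]|//] := meromorphic_const (t_mero Ha); exfalso.
have [x [y [Hx Hy]]] := t_noncst; apply/negP; rewrite negbK.
have all u : H u -> \forall v \near u, t v = c.
  move=> Hu; apply: (connected_ind (P := fun u => \forall v \near u, t v
    = c) H_connected _ Ha Hu tc) => v Hv.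
  by apply: nearS (meromorphic_const_germ (t_mero Hv)) => b hb _; exact: hb.
by rewrite (near_self (all x Hx)) (near_self (all y Hy)).
Qed.

(** By the identity theorem on the connected curve: if [f] were constant near one point, it would be
    constant everywhere. *)
Lemma curve_derive1_neq0 (f : 'M[C]_2 -> C) T F : meromorphic_on_curve t CC f ->
  nonconstant_on CC f -> CC T -> branch_at t T F ->
  \forall x \near (T 0 0)^', derive1 (f \o F) x != 0.
Proof.
move=> f_mero [T1 [T2 [h1 h2 f12]]] hT hF.
have [[c fc]|//] := meromorphic_const (f_mero T F hT hF); exfalso.
(* All branches through [T'] are allowed, to obtain a property of the point alone. *)
pose K T' := forall F', branch_at t T' F' -> \forall x \near T' 0 0, f (F' x) = c.
have KT : K T.
  move=> F' hF'; have := nearI fc (branch_unique hF hF').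
  by apply: nearS => x [/= + E]; rewrite E.
have all T' : CC T' -> K T'.
  move=> hT'; apply: (curve_ind (P := K) _ hT hT' KT) => {hT' T'}T' F' hT' hF'.
  have := nearI (meromorphic_const_germ (f_mero T' F' hT' hF'))
    (nearI (branch_near hF') (branch_sym hF')).
  apply: nearS => x [iff [hFx [Fx _]]].
  have e1 : K T' <-> \forall y \near T' 0 0, (f \o F') y = c.
    split=> [h|h F'' hF'']; first exact: h.
    have := nearI h (branch_unique hF' hF'').
    by apply: nearS => y [/= + E]; rewrite E.
  have e2 : K (F' x) <-> \forall y \near x, (f \o F') y = c.
    rewrite /K Fx; split=> [h|h F'' hF'']; first exact: h.
    have := branch_unique hFx hF''; rewrite Fx => E.
    by have := nearI h E; apply: nearS => y [/= + E2]; rewrite E2.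
  by split=> [/e1/iff/e2|/e2/iff/e1].
have val T' : CC T' -> f T' = c.
  move=> hT'; have [F' hF'] := curve_branch hT'.
  have := near_self (all T' hT' F' hF').
  by have [-> _ _ _] := hF'.
by move: f12; rewrite (val T1 h1) (val T2 h2) eqxx.
Qed.

Lemma near_regular T F : CC T -> branch_at t T F ->
  \forall x \near (T 0 0)^', exists phi, regular_point t CC z w (F x) F phi.
Proof.
move=> hT hF; have [HT _ _] := curve_regular hT.
have hz := z_mero hT hF; have hw := w_mero hT hF.
have dz := curve_derive1_neq0 z_mero z_noncst hT hF.
have dw := curve_derive1_neq0 w_mero w_noncst hT hF.
have A := dnearI (dnearI (meromorphic_analytic hz) (meromorphic_analytic hw))
  (dnearI (meromorphic_neq0 hz dz) (meromorphic_neq0 hw dw)).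
have B := dnearI (dnearI dz (t_derive1_neq0 HT))
  (nearW_dnear (nearI (nearI (curve_near H_open hT hF) (branch_near hF)) (branch_sym hF))).
apply: dnearS (dnearI A B) => x [[[az aw] [z0 w0]] [[dzx dtx] [[CFx hFx] [Fx _]]]].
have [phi [p1 p2 p3 _]] := inverse_function az dzx.
exists phi; rewrite /regular_point Fx.
split; [exact: CFx|exact: hFx|by split|by split|].
by split; [exact: p1|exact: p2|exact: p3].
Qed.

End GenericPoints.

(** * Continuation between regular points of the curve *)

Section Reachability.
Variable R : realType.
Local Notation C := (cplx R).
Variables (H : set C) (t : C -> C) (c1 k3 : C) (z w : 'M[C]_2 -> C).
Local Notation CC := (curve R H t c1 k3).
Hypothesis H_open : open H.
Hypothesis near_reg : forall T F, CC T -> branch_at t T F ->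
  \forall x \near (T 0 0)^', exists phi, regular_point t CC z w (F x) F phi.
Implicit Types (T : 'M[C]_2) (F : C -> 'M[C]_2) (phi s : C -> C).
Local Notation regular := (regular_point t CC z w).

(** Coefficients and solutions form one family, because the same loop has to continue both. *)
Definition fam F phi s (i : 'I_4 + 'I_4) : C -> C := match i with
  | inl k => c_at t z w F phi k
  | inr j => fun y => s y * Uf t F j (phi y)
  end.

Lemma regular_curve T F phi : regular T F phi -> CC T. Proof. by case. Qed.

Lemma regular_t T F phi : regular T F phi -> analytic_at t (T 0 0).
Proof. by move=> /regular_curve /curve_regular[]. Qed.

Lemma regular_move T F phi : regular T F phi ->
  \forall x \near T 0 0, regular (F x) F phi.
Proof.
move=> reg; have [hT hF [az aw] [z0 w0 dz dt] _] := reg.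
have [hp p0 zp pz] := reg_inverse reg.
have h4 := near_analytic (P := fun y => \forall v \near y, z (F (phi v)) = v) az (near_near zp).
have A := nearI (nearI (curve_near H_open hT hF) (branch_near hF))
  (nearI (branch_sym hF) (nearI (analytic_near az) (analytic_near aw))).
have FT : F (T 0 0) = T by case: hF.
have z0' : (z \o F) (T 0 0) != 0 by rewrite /= FT.
have w0' : (w \o F) (T 0 0) != 0 by rewrite /= FT.
have tT := regular_t reg.
have B := nearI (nearI (near_neq0 az z0') (near_neq0 aw w0'))
  (nearI (near_neq0 (analytic_derive1 az) dz) (near_neq0 (analytic_derive1 tT) dt)).
have D := near_analytic (P := fun y => analytic_at phi y) az (analytic_near hp).
have := nearI (nearI A B) (nearI pz (nearI D h4)).
apply: nearS => x [[[[a1 a2] [[Fx _] [a3 a4]]] [[b1 b2] [b3 b4]]] [p1 [p2 p3]]].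
rewrite /regular_point Fx.
exact: (And5 a1 a2 (conj a3 a4) (And4 b1 b2 b3 b4) (And3 p2 p1 p3)).
Qed.

Lemma sqrt_move T F phi s : regular T F phi -> sqrt_factor F z w T phi s ->
  \forall x \near T 0 0, sqrt_factor F z w (F x) phi s.
Proof.
move=> reg [hs s0 ss]; have [_ hF [az _] _ _] := reg.
have FT : F (T 0 0) = T by case: hF.
have h : \forall y \near z T, [/\ analytic_at s y, s y != 0 &
    \forall v \near y, s v ^+ 2 = ((w \o F) \o phi) v ^+ 2 / (G1 (z \o F) \o phi) v].
  have := nearI (analytic_near hs) (nearI (near_neq0 hs s0) (near_near ss)).
  by apply: nearS => y [k1 [k2 k3']]; split.
rewrite -{1}FT in h.
exact: (near_analytic (f := z \o F) (P := fun y => [/\ analytic_at s y, s y != 0 &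
    \forall v \near y, s v ^+ 2 = ((w \o F) \o phi) v ^+ 2 / (G1 (z \o F) \o phi) v]) az h).
Qed.

Lemma fam_analytic T F phi s : regular T F phi -> sqrt_factor F z w T phi s ->
  forall i, analytic_at (fam F phi s i) (z T).
Proof.
move=> reg sf [k|j]; have tT := regular_t reg.
  exact: (c_analytic reg tT).
exact: (Y_analytic reg tT j sf).
Qed.

Lemma sqrt_factorN T F phi s : sqrt_factor F z w T phi s ->
  sqrt_factor F z w T phi (fun y => - s y).
Proof.
move=> [hs s0 ss]; split; [exact: analyticN|by rewrite oppr_eq0|].
by apply: nearS ss => y <-; rewrite sqrrN.
Qed.

Lemma phi_unique T F F' phi phi' : regular T F phi -> regular T F' phi' ->
  \forall y \near z T, phi y = phi' y.
Proof.
move=> reg reg'; have [_ hF _ _ _] := reg; have [_ hF' _ _ _] := reg'.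
have [_ _ _ p'z] := reg_inverse reg'; have [_ _ zp _] := reg_inverse reg.
rewrite (reg_zF reg) in zp.
have := nearI zp (near_pull reg (nearI (branch_unique hF hF') p'z)).
apply: nearS => y [zy [Fy p'y]]; rewrite -[LHS]p'y /= -Fy.
by move: zy => /= ->.
Qed.

Lemma gam_inv T F phi : regular T F phi ->
  \forall y \near z T, theta phi y = ((G1 (z \o F) \o phi) y)^-1.
Proof.
move=> reg; have := theta_pull reg (analytic_id (T 0 0)).
by apply: nearS => y; rewrite derive1_id_fun div1r.
Qed.

Lemma fam_unique T F F' phi phi' s s' : regular T F phi -> regular T F' phi' ->
  sqrt_factor F z w T phi s -> sqrt_factor F' z w T phi' s' ->
  germ_eq (z T) (fam F phi s) (fam F' phi' s') \/
  germ_eq (z T) (fam F phi (fun y => - s y)) (fam F' phi' s').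
Proof.
move=> reg reg' sf sf'; have [_ hF _ _ _] := reg; have [_ hF' _ _ _] := reg'.
have tT := regular_t reg.
have pp := phi_unique reg reg'.
have FF := near_pull reg (branch_unique hF hF').
have concl s1 : sqrt_factor F z w T phi s1 -> (\forall y \near z T, s1 y = s' y) ->
    germ_eq (z T) (fam F phi s1) (fam F' phi' s').
  move=> sf1 ss1.
  have UU (j : 'I_4) : \forall y \near z T, s1 y * Uf t F j (phi y) = s' y * Uf t F' j (phi' y).
    have := nearI ss1 (nearI FF pp); apply: nearS => y [-> [Fy <-]].
    by rewrite /Uf; case: j => [[|[|[|[|//]]]] hj] /=; rewrite ?Fy.
  case=> [k|j]; last exact: UU.
  have sol (j : 'I_4) : solves_lde (c_at t z w F' phi') (fun y => s1 y * Uf t F j (phi y)) (z T).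
    apply: solves_near (Y_solves reg' tT j sf').
    by apply: nearS (UU j) => y ->.
  have := coefficients_unique reg tT sf1 sol.
  by apply: nearS => y /(_ k) /= ->.
have [hs s0 ss] := sf; have [hs' s0' ss'] := sf'.
have E : \forall y \near z T, s' y ^+ 2 = s y ^+ 2.
  have := nearI (nearI ss ss') (nearI (nearI (gam_inv reg) (gam_inv reg'))
    (nearI (near_theta pp) (nearI FF pp))).
  apply: nearS => y [[e1 e2] [[g1 g2] [tp [Fy py]]]].
  by rewrite e1 e2 -g1 -g2 tp /= Fy py.
have [h|h] := analytic_sqr_eq hs' hs E; [left|right].
  by apply: (concl _ sf); apply: nearS h => y ->.
by apply: (concl _ (sqrt_factorN sf)); apply: nearS h => y ->.
Qed.

Variables (b0 : C) (f0 : 'I_4 + 'I_4 -> C -> C).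

(** Branch, inverse and sign at the end are left open, so that this depends on [T] alone. *)
Definition reach T := exists F phi s, [/\ regular T F phi, sqrt_factor F z w T phi s &
  continues b0 f0 (z T) (fam F phi s)].

(** A short path in the tau-disc, mapped by z, prolongs the continuation. Both signs of s are
    carried along, since the given continuation may end with either. *)
Lemma reach_iff T F phi : regular T F phi -> \forall x \near T 0 0, reach T <-> reach (F x).
Proof.
move=> reg; have [hT hF [az _] [z0 _ _ _] _] := reg.
have [FT _ _ _] := hF.
have [s sf] := sqrt_factor_exists reg.
have loc s1 : sqrt_factor F z w T phi s1 -> \forall x \near T 0 0,
    [/\ sqrt_factor F z w (F x) phi s1, continues (z T) (fam F phi s1) (z (F x)) (fam F phi s1) &
       continues (z (F x)) (fam F phi s1) (z T) (fam F phi s1)].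
  move=> sf1; have z0' : (z \o F) (T 0 0) != 0 by rewrite /= FT.
  have fa : forall i, analytic_at (fam F phi s1 i) ((z \o F) (T 0 0)).
    by rewrite /= FT; exact: (fam_analytic reg sf1).
  have [e e0 he] := continues_local az z0' fa.
  have T0 : nrm (T 0 0 - T 0 0) < e by rewrite subrr nrm0.
  have ne : \forall x \near T 0 0, nrm (x - T 0 0) < e by apply/near_nrm; exists e.
  have := nearI ne (sqrt_move reg sf1); apply: nearS => x [xe sx].
  split; [exact: sx| |].
    by have := he _ _ T0 xe; rewrite /= FT.
  by have := he _ _ xe T0; rewrite /= FT.
have lN := loc _ (sqrt_factorN sf).
have lP := loc _ sf.
have := nearI (regular_move reg) (nearI lP lN).
apply: nearS => x [regx [[sx cf cb] [sxN cfN cbN]]].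
split=> [[F' [phi' [s' [reg' sf' ct]]]]|[F' [phi' [s' [reg' sf' ct]]]]].
- have [ge|ge] := fam_unique reg reg' sf sf'.
    exists F, phi, s; split; [exact: regx|exact: sx|].
    apply: continues_trans (continues_eq (germ_eq_refl _ _) (germ_eq_sym ge) ct) cf.
  exists F, phi, (fun y => - s y); split; [exact: regx|exact: sxN|].
  exact: continues_trans (continues_eq (germ_eq_refl _ _) (germ_eq_sym ge) ct) cfN.
- have [ge|ge] := fam_unique regx reg' sx sf'.
    exists F, phi, s; split; [exact: reg|exact: sf|].
    exact: continues_trans (continues_eq (germ_eq_refl _ _) (germ_eq_sym ge) ct) cb.
  exists F, phi, (fun y => - s y); split; [exact: reg|exact: sqrt_factorN|].
  exact: continues_trans (continues_eq (germ_eq_refl _ _) (germ_eq_sym ge) ct) cbN.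
Qed.

Lemma reach_all T T' F phi F' phi' : regular T F phi -> regular T' F' phi' ->
  reach T -> reach T'.
Proof.
move=> reg reg' rT.
(* [reach] cannot hold at points that are not regular, so [curve_ind] is applied to its version on
   punctured neighbourhoods, which is equivalent to it at regular points. *)
pose P T := forall F, branch_at t T F -> \forall x \near (T 0 0)^', reach (F x).
have one T1 F1 F2 : branch_at t T1 F1 -> branch_at t T1 F2 ->
    (\forall x \near (T1 0 0)^', reach (F1 x)) -> \forall x \near (T1 0 0)^', reach (F2 x).
  move=> h1 h2 h; have := dnearI h (nearW_dnear (branch_unique h1 h2)).
  by apply: dnearS => x [+ <-].
have regP T1 F1 phi1 : regular T1 F1 phi1 -> reach T1 <-> P T1.
  move=> reg1; have iff := reach_iff reg1; have [_ hF1 _ _ _] := reg1; split.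
    move=> r F2 hF2; apply: (one T1 F1 F2 hF1 hF2).
    by apply: dnearS (nearW_dnear iff) => x [+ _]; apply.
  move=> /(_ F1 hF1) h; have [x [rx [_ back]]] := dnear_ex (dnearI h (nearW_dnear iff)).
  exact: (back rx).
apply/(regP _ _ _ reg').
apply: (curve_ind (P := P) _ (regular_curve reg) (regular_curve reg')); last first.
  exact/(regP _ _ _ reg).
move=> T1 F1 hT1 hF1.
have := nearI (branch_sym hF1) (branch_near hF1).
have /dnearE N := near_reg hT1 hF1.
move=> /(nearI N) /near_nrm[e e0 he].
(* All points of the punctured disc are regular and it is connected: the exceptional centre is
   bypassed here. *)
have ind x y : 0 < nrm (x - T1 0 0) < e -> 0 < nrm (y - T1 0 0) < e ->
    reach (F1 x) -> reach (F1 y).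
  apply: (@pball_ind R (fun x => reach (F1 x)) (T1 0 0) e) => u /andP[u0 ue].
  have uT : u != T1 0 0 by rewrite -subr_eq0 -nrm_gt0.
  have [/(_ uT)[phiu regu] [[Fu _] _]] := he u ue.
  by have := reach_iff regu; rewrite Fu.
apply/near_nrm; exists e; first exact: e0.
move=> x xe; have [regx [[Fx _] hFx]] := he x xe.
have [->|xT] := eqVneq x (T1 0 0); first by have [-> _ _ _] := hF1.
have xr : 0 < nrm (x - T1 0 0) < e by rewrite xe nrm_gt0 subr_eq0 xT.
have all_P : reach (F1 x) <-> P (F1 x).
  by have [phix regx'] := regx xT; exact: regP regx'.
have ball_T : \forall y \near (T1 0 0)^', 0 < nrm (y - T1 0 0) < e.
  by apply/dnear_nrm; exists e.
have PT : P T1 <-> reach (F1 x).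
  split=> [/(_ F1 hF1) h|rx F2 hF2].
    have [y [ry yr]] := dnear_ex (dnearI h ball_T).
    exact: ind yr xr ry.
  apply: (one T1 F1 F2 hF1 hF2).
  by apply: dnearS ball_T => y yr; exact: ind xr yr rx.
by split=> [/PT/all_P|/all_P/PT].
Qed.

End Reachability.

(** * Linear action on the vector (T e; e) *)

Section LinearAction.
Variable R : realType.
Local Notation C := (cplx R).
Local Notation iota := (RtoC R).
Implicit Types (T N : 'M[C]_2) (t : C) (g : 'M[R]_(2 + 2)).

Definition evec t0 : 'cV[C]_2 := \col_i [:: t0; 1]`_i.
Definition Vvec T t0 : 'cV[C]_(2 + 2) := col_mx (T *m evec t0) (evec t0).

Lemma evecE t0 i : evec t0 i 0 = [:: t0; 1]`_i.
Proof. exact: mxE. Qed.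

Lemma mulmx_evec T t0 i : (T *m evec t0) i 0 = T i 0 * t0 + T i 1.
Proof.
rewrite mxE !big_ord_recl big_ord0 addr0 !mxE /=.
by rewrite (_ : lift ord0 ord0 = 1) ?mulr1 //; exact: val_inj.
Qed.

(** The block identity g (T; 1) = (N; 1) M with M = C T + D, applied to e. *)
Lemma Vvec_act g T N (la t0 t1 : C) :
  N *m aut_den iota g T = aut_num g T ->
  aut_den iota g T *m evec t0 = la *: evec t1 ->
  la *: Vvec N t1 = toC iota g *m Vvec T t0.
Proof.
move=> NM Me; rewrite -[g in RHS]submxK /toC map_block_mx mul_block_col.
rewrite /Vvec scale_col_mx scalemxAr -Me (mulmxA N) NM.
by rewrite /aut_num /aut_den !mulmxDl -!mulmxA.
Qed.

Lemma Uf_Vvec (t : C -> C) (F : C -> 'M[C]_2) x (j : 'I_4) : F x 0 0 = x -> is_sym (F x) ->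
  Uf t F j x = Vvec (F x) (t x) j 0.
Proof.
move=> Fx sF.
have u k : Vvec (F x) (t x) (lshift 2 k) 0 = F x k 0 * t x + F x k 1.
  by rewrite /Vvec col_mxEu mulmx_evec.
have d (k : 'I_2) : Vvec (F x) (t x) (rshift 2 k) 0 = [:: t x; 1]`_k.
  by rewrite /Vvec col_mxEd mxE.
case: j => [[|[|[|[|//]]]] hj].
- have -> : Ordinal hj = lshift 2 0 :> 'I_(2 + 2) by exact: val_inj.
  by rewrite u Fx /Uf /= mulrC.
- have -> : Ordinal hj = lshift 2 1 :> 'I_(2 + 2) by exact: val_inj.
  by rewrite u sF /Uf /= mulrC.
- have -> : Ordinal hj = rshift 2 0 :> 'I_(2 + 2) by exact: val_inj.
  by rewrite d.
- have -> : Ordinal hj = rshift 2 1 :> 'I_(2 + 2) by exact: val_inj.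
  by rewrite d.
Qed.

End LinearAction.

(** * Monodromy of the solutions *)

Section Monodromy.
Variable R : realType.
Local Notation C := (cplx R).
Local Notation iota := (RtoC R).
Variables (H : set C) (t : C -> C) (c1 k3 : C) (z w : 'M[C]_2 -> C).
Local Notation CC := (curve R H t c1 k3).
Hypothesis H_open : open H.
Hypothesis near_reg : forall T F, CC T -> branch_at t T F ->
  \forall x \near (T 0 0)^', exists phi, regular_point t CC z w (F x) F phi.
Variables (g : 'M[R]_(2 + 2)) (cg : C).
Hypothesis g_Sp4 : Sp4 g.
Hypothesis g_acts : forall T, CC T ->
  aut_den iota g T \in unitmx /\ CC (aut_act iota g T).
Hypothesis cg0 : cg != 0.
Hypothesis z_inv : forall T, CC T -> z (aut_act iota g T) = z T.
Hypothesis w_inv : forall T, CC T ->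
  w (aut_act iota g T) = cg * \det (aut_den iota g T) * w T.
Implicit Types (T : 'M[C]_2) (F : C -> 'M[C]_2) (phi s : C -> C).
Local Notation regular := (regular_point t CC z w).
Local Notation act T := (aut_act iota g T).
Local Notation den T := (aut_den iota g T).

Lemma branch_act T F F1 : CC T -> branch_at t T F -> branch_at t (act T) F1 ->
  let h x := act (F x) 0 0 in
  [/\ analytic_at h (T 0 0), h (T 0 0) = act T 0 0 &
  \forall x \near T 0 0, [/\ act (F x) = F1 (h x), branch_at t (act (F x)) F1,
    CC (F x), branch_at t (F x) F & F x 0 0 = x]].
Proof.
move=> hT hF hF1 h; have [FT _ _ _] := hF.
have hh : analytic_at h (T 0 0) by exact: (act_analytic g_acts hT hF).
have h0 : h (T 0 0) = act T 0 0 by rewrite /h FT.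
split; [exact: hh|exact: h0|].
have nF1 : \forall y \near h (T 0 0), branch_at t (F1 y) F1 by rewrite h0; exact: branch_near.
have := nearI (nearI (action_branch H_open g_acts hT hF hF1)
  (near_analytic (P := fun y => branch_at t (F1 y) F1) hh nF1))
  (nearI (nearI (curve_near H_open hT hF) (branch_near hF)) (branch_sym hF)).
apply: nearS => x [[e1 e2] [[e3 e4] [e5 _]]].
by split; [exact: e1|rewrite e1; exact: e2|exact: e3|exact: e4|exact: e5].
Qed.

(** The second entry of (C T + D) e for e = (t, 1); since e has second entry 1 at every point, it is
    the factor by which e is multiplied. *)
Definition lam (F : C -> 'M[C]_2) x := den (F x) 1 0 * t x + den (F x) 1 1.

Lemma lam_act T F F1 : CC T -> branch_at t T F -> branch_at t (act T) F1 ->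
  let h x := act (F x) 0 0 in
  \forall x \near T 0 0, lam F x ^+ 2 = \det (den (F x)) ^+ 2 * derive1 h x /\
    forall i : 'I_4, lam F x * Uf t F1 i (h x) =
      \sum_(j < 4) toC iota g i j * Uf t F j x.
Proof.
move=> hT hF hF1 h; have [_ _ N] := branch_act hT hF hF1.
apply: nearS N => x [e1 e2 e3 e4 e5].
have [] := action_tangent H_open g_Sp4 g_acts e3 e4 e2; rewrite e5 -/(lam F x) => k1 k2.
split; first exact: k2.
have [uM gC] := g_acts e3; have [_ _ sF] := curve_regular e3.
have [_ _ sG] := curve_regular gC.
have Me : den (F x) *m evec (t x) = lam F x *: evec (t (h x)).
  apply/matrixP => i j; rewrite (ord1 j) mulmx_evec [RHS]mxE evecE.
  case: i => [[|[|//]] hi] /=.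
    have -> : Ordinal hi = 0 :> 'I_2 by exact: val_inj.
    exact: k1.
  have -> : Ordinal hi = 1 :> 'I_2 by exact: val_inj.
  by rewrite mulr1.
have V := Vvec_act (aut_act_den uM) Me.
have e5' : F1 (h x) 0 0 = h x by rewrite -e1.
have sF1 : is_sym (F1 (h x)) by rewrite -e1.
move=> i; rewrite (Uf_Vvec t i e5' sF1) -e1.
have /matrixP /(_ i 0) := V; rewrite mxE => ->; rewrite mxE.
by apply: eq_bigr => j _; rewrite (Uf_Vvec t j e5 sF).
Qed.

(** What the loop of g must produce: the same coefficients, and the solutions transformed by b g. *)
Definition gact (b : C) (f : 'I_4 + 'I_4 -> C -> C) (i : 'I_4 + 'I_4) : C -> C :=
  match i with
  | inl k => f (inl k)
  | inr i => fun y => \sum_(j < 4) (b *: toC iota g) i j * f (inr j) y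
  end.

Lemma gact_germ b y f f' : germ_eq y f f' -> germ_eq y (gact b f) (gact b f').
Proof.
move=> ff; case=> [k|i]; first exact: ff.
have A : \forall x \near y, forall j : 'I_4, f (inr j) x = f' (inr j) x.
  exact: (@filter_forall _ _ (fun (j : 'I_4) x => f (inr j) x = f' (inr j) x) (nbhs y) _
    (fun j => ff (inr j))).
by apply: nearS A => x Ax; apply: eq_bigr => j _; rewrite Ax.
Qed.

Lemma gact_analytic b y f : (forall i, analytic_at (f i) y) ->
  forall i, analytic_at (gact b f i) y.
Proof.
move=> hf [k|i]; first exact: hf.
by apply: analytic_sum => j; apply: analyticM; [exact: analytic_cst|exact: hf].
Qed.

Lemma continues_gact b x f y f' : continues x f y f' -> continues x (gact b f) y (gact b f').
Proof.
move=> [c [pc ac [c0 cf] [d0 cd]]]; exists (fun v : R => ((c v).1, gact b (c v).2)); split.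
- move=> s hs U hU; apply: (pc s hs (fun p : C * ('I_4 + 'I_4 -> C -> C) => U (p.1, gact b p.2))).
  by apply: nearS hU => v hv k hk; apply: hv; exact: gact_germ.
- move=> s hs; have [h1 h2] := ac s hs; split; [exact: h1|exact: gact_analytic].
- by split; [exact: c0|exact: gact_germ].
- by split; [exact: d0|exact: gact_germ].
Qed.

Lemma g_unitmx : toC iota g \in unitmx.
Proof.
rewrite map_unitmx; apply: (proj2 (@mulmx1_unit _ _ (- Jmx R *m g^T *m Jmx R) g _)).
rewrite -!mulmxA (mulmxA g^T) g_Sp4 mulNmx /Jmx mulmx_block.
by rewrite !(mulmx0, mul0mx, mulmx1, mul1mx, mulmxN, mulNmx, addr0, add0r) opp_block_mx
  !oppr0 !opprK -scalar_mx_block.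
Qed.

Lemma comb_inverse n (G : 'M[C]_n) (Y Y2 : 'I_n -> C) : G \in unitmx ->
  (forall i, Y2 i = \sum_j G i j * Y j) -> forall j, \sum_i invmx G j i * Y2 i = Y j.
Proof.
move=> uG E j.
have -> : Y j = (\col_k Y k) j 0 by rewrite mxE.
rewrite -[\col_k Y k](mulKmx uG) mxE; apply: eq_bigr => i _; congr (_ * _).
by rewrite E mxE; apply: eq_bigr => k _; rewrite mxE.
Qed.

Lemma solves_comb (c : 'I_4 -> C -> C) (b : 'I_4 -> C) (f : 'I_4 -> C -> C) x :
  (forall i, analytic_at (f i) x) -> (forall i, solves_lde c (f i) x) ->
  solves_lde c (fun y => \sum_(i < 4) b i * f i y) x.
Proof.
move=> hf hc.
have af : \forall y \near x, forall i, analytic_at (f i) y.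
  exact: (@filter_forall _ _ (fun (i : 'I_4) y => analytic_at (f i) y) (nbhs x) _
    (fun i => analytic_near (hf i))).
have it k : \forall y \near x, iter k theta (fun y => \sum_(i < 4) b i * f i y) y =
    \sum_(i < 4) b i * iter k theta (f i) y.
  elim: k => [|k IHk]; first by apply: nearS af.
  have := nearI af (near_theta IHk); apply: nearS => y [ay /= ->].
  have ak i := analytic_iter_theta k (ay i).
  rewrite /theta derive1_sum; last first.
    by move=> i; apply: analyticM; [exact: analytic_cst|exact: ak].
  rewrite mulr_sumr; apply: eq_bigr => i _.
  by rewrite (derive1Z (b i) (ak i)) mulrCA.
have A : \forall y \near x, forall k : 'I_4, iter k theta (fun y => \sum_(i < 4) b i * f i y) y =
    \sum_(i < 4) b i * iter k theta (f i) y.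
  exact: (@filter_forall _ _ (fun (k : 'I_4) y => iter k theta
    (fun y => \sum_(i < 4) b i * f i y) y =
    \sum_(i < 4) b i * iter k theta (f i) y) (nbhs x) _ (fun k : 'I_4 => it k)).
have B : \forall y \near x, forall i : 'I_4,
    iter 4 theta (f i) y + \sum_(k < 4) c k y * iter k theta (f i) y = 0.
  exact: (@filter_forall _ _ (fun (i : 'I_4) y => iter 4 theta (f i) y +
    \sum_(k < 4) c k y * iter k theta (f i) y = 0) (nbhs x) _ hc).
have := nearI (it 4) (nearI A B); apply: nearS => y [-> [Ay By]].
under [X in _ + X]eq_bigr => k _ do rewrite Ay mulr_sumr.
rewrite exchange_big -big_split big1 //= => i _.
under [X in _ + X]eq_bigr => k _ do rewrite mulrCA.
by rewrite -mulr_sumr -mulrDr By mulr0.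
Qed.

Lemma local_monodromy T F phi s F1 phi1 : regular T F phi ->
  sqrt_factor F z w T phi s -> regular (act T) F1 phi1 ->
  exists2 b : C, b != 0 & continues (z T) (fam t z w F phi s) (z T) (gact b (fam t z w F phi s)).
Proof.
move=> reg sf reg1; have [hT hF [az _] [z0 _ _ _] _] := reg.
have [FT _ _ _] := hF; have tT := regular_t reg.
have rT : reach H t c1 k3 z w (z T) (fam t z w F phi s) T.
  exists F, phi, s; split; [exact: reg|exact: sf|].
  have z0' : (z \o F) (T 0 0) != 0 by rewrite /= FT.
  have fa : forall i, analytic_at (fam t z w F phi s i) ((z \o F) (T 0 0)).
    by rewrite /= FT; exact: (fam_analytic reg sf).
  have [e e0 he] := continues_local az z0' fa.
  have TT : nrm (T 0 0 - T 0 0) < e by rewrite subrr nrm0.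
  by have := he _ _ TT TT; rewrite /= FT.
(* The continuation may arrive with another branch, inverse and square root than those given at g T;
   since z (g T) = z T it is already a loop. *)
have [F2 [phi2 [s2 [reg2 sf2 ct]]]] := reach_all H_open near_reg reg reg1 rT.
rewrite (z_inv hT) in ct.
have [_ hF2 [az2 _] _ _] := reg2.
have [hh h0 N] := branch_act hT hF hF2.
set h := fun x => act (F x) 0 0 in hh h0 N.
have L := lam_act hT hF hF2; rewrite -/h in L.
have [_ _ zphi _] := reg_inverse reg; rewrite (reg_zF reg) /= in zphi.
have [_ _ _ p2z] := reg_inverse reg2; rewrite -h0 in p2z.
(* g (F (phi y)) lies on [F2] and its z-value is y by invariance, and [phi2] inverts z on [F2]. *)
have E1 : \forall y \near z T, phi2 y = h (phi y).
  have := nearI zphi (near_pull reg (nearI N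
    (near_analytic (P := fun u => phi2 ((z \o F2) u) = u) hh p2z))).
  apply: nearS => y [zy [[e1 _ e3 _ _] e6]].
  by rewrite -[RHS]e6 /= -e1 (z_inv e3) zy.
have alam : analytic_at (lam F) (T 0 0).
  have hM := den_analytic g hF; apply: analyticD; last exact: hM.
  by apply: analyticM; [exact: hM|exact: tT].
have [hs s0 ss] := sf; have [hs2 s20 ss2] := sf2; rewrite (z_inv hT) in hs2 s20 ss2.
have g2 := gam_inv reg2; rewrite (z_inv hT) in g2.
have E2 : \forall y \near z T, s2 y ^+ 2 = (cg * lam F (phi y) * s y) ^+ 2.
  have := nearI (nearI ss ss2) (nearI (nearI g2 (nearI (near_theta E1) (theta_pull reg hh)))
    (nearI E1 (near_pull reg (nearI N L)))).
  apply: nearS => y [[e1 e2] [[k1 [k2 k4]] [k5 [[n1 _ n3 _ _] [l1 _]]]]].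
  have wE : ((w \o F2) \o phi2) y = cg * \det (den (F (phi y))) * ((w \o F) \o phi) y.
    by rewrite /= k5 -n1 (w_inv n3).
  have gE : ((G1 (z \o F2) \o phi2) y)^-1 = derive1 h (phi y) / (G1 (z \o F) \o phi) y.
    by rewrite -k1 k2; exact: k4.
  rewrite e2 wE gE [RHS]exprMn e1 (exprMn 2 cg (lam F (phi y))) l1.
  move: (\det _) (((w \o F) \o phi) y) ((G1 (z \o F) \o phi) y)^-1 (derive1 h (phi y)).
  by move=> *; ring.
have aR : analytic_at (fun y => cg * lam F (phi y) * s y) (z T).
  apply: analyticM; last exact: hs.
  by apply: analyticM; [exact: analytic_cst|exact: (pull_analytic reg alam)].
have [b b0 Eb] : exists2 b, b != 0 & \forall y \near z T, s2 y = b * lam F (phi y) * s y.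
  have [Eb|Eb] := analytic_sqr_eq hs2 aR E2; first by exists cg.
  exists (- cg); first by rewrite oppr_eq0.
  by apply: nearS Eb => y ->; rewrite !mulNr.
exists b; first exact: b0.
apply: (continues_eq (germ_eq_refl _ _) _ ct).
have YE (i : 'I_4) : \forall y \near z T, s2 y * Uf t F2 i (phi2 y) =
    \sum_(j < 4) (b *: toC iota g) i j * (s y * Uf t F j (phi y)).
  have := nearI Eb (nearI E1 (near_pull reg L)).
  apply: nearS => y [-> [-> [_ l2]]].
  have -> : b * lam F (phi y) * s y * Uf t F2 i (h (phi y)) =
      b * s y * (lam F (phi y) * Uf t F2 i (h (phi y))).
    by move: (lam F (phi y)) (Uf t F2 i (h (phi y))) (s y) => *; ring.
  rewrite l2 mulr_sumr; apply: eq_bigr => j _.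
  have -> : (b *: toC iota g) i j = b * toC iota g i j by exact: mxE.
  by move: (toC iota g i j) (Uf t F j (phi y)) (s y) => *; ring.
case=> [k|i]; last exact: YE.
have [G uG GE] : exists2 G : 'M[C]_4, G \in unitmx &
    forall i j, (b *: toC iota g) i j = G i j.
  exists (b *: toC iota g); last by [].
  by rewrite unitmxZ; [exact: g_unitmx|rewrite unitfE].
pose X := invmx G.
(* b g is invertible, so the solutions at T are combinations of those at g T and satisfy the
   equation found there; uniqueness then identifies the coefficients. *)
have sol (j : 'I_4) : solves_lde (c_at t z w F2 phi2) (fun y => s y * Uf t F j (phi y)) (z T).
  have S : solves_lde (c_at t z w F2 phi2) (fun y => \sum_(i < 4) X j i * (s2 y * Uf t F2 i
    (phi2 y))) (z T).
    apply: solves_comb => i.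
      by rewrite -(z_inv hT); exact: (Y_analytic reg2 (regular_t reg2) i sf2).
    by rewrite -(z_inv hT); exact: (Y_solves reg2 (regular_t reg2) i sf2).
  apply: (solves_near _ S).
  have A : \forall y \near z T, forall i : 'I_4, s2 y * Uf t F2 i (phi2 y) =
      \sum_(j < 4) (b *: toC iota g) i j * (s y * Uf t F j (phi y)).
    exact: (@filter_forall _ _ (fun (i : 'I_4) y => s2 y * Uf t F2 i (phi2 y) =
      \sum_(j < 4) (b *: toC iota g) i j * (s y * Uf t F j (phi y))) (nbhs (z T)) _ YE).
  apply: nearS A => y Ay.
  apply: (comb_inverse (Y := fun j : 'I_4 => s y * Uf t F j (phi y)) uG) => i.
  by rewrite Ay; apply: eq_bigr => l _; rewrite GE.
have := coefficients_unique reg tT sf sol.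
by apply: nearS => y /(_ k).
Qed.

(** g T need not be regular for the given T. The loop is built at a nearby point whose image is
    regular, and conjugated with a short path. *)
Lemma monodromy_continues T F phi s : regular T F phi -> sqrt_factor F z w T phi s ->
  exists2 b : C, b != 0 & continues (z T) (fam t z w F phi s) (z T) (gact b (fam t z w F phi s)).
Proof.
move=> reg sf; have [hT hF [az _] [z0 _ dz _] _] := reg.
have [FT _ _ _] := hF; have [_ hgT] := g_acts hT.
have [F1 hF1] := curve_branch hgT.
have [hh h0 N] := branch_act hT hF hF1.
set h := fun x => act (F x) 0 0 in hh h0 N.
have z0' : (z \o F) (T 0 0) != 0 by rewrite /= FT.
have fa : forall i, analytic_at (fam t z w F phi s i) ((z \o F) (T 0 0)).
  by rewrite /= FT; exact: (fam_analytic reg sf).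
have [e e0 he] := continues_local az z0' fa.
have TT : nrm (T 0 0 - T 0 0) < e by rewrite subrr nrm0.
have ne : \forall x \near T 0 0, nrm (x - T 0 0) < e by apply/near_nrm; exists e.
(* [near_reg] says nothing at the centre [h (T 0 0)], so this value must be avoided; if h were
   constant, invariance would make [z \o F] constant near a regular point. *)
have hne : \forall x \near (T 0 0)^', h x != h (T 0 0).
  have hd : analytic_at (fun x => h x - h (T 0 0)) (T 0 0).
    by apply: analyticB; [exact: hh|exact: analytic_cst].
  have [hc|] := analytic_isolated hd; last by apply: dnearS => x; rewrite subr_eq0.
  exfalso; move/eqP: dz; apply.
  rewrite (@derive1_near _ _ (fun=> z (F1 (h (T 0 0))))); first exact: derive1_cst_fun.
  have := nearI hc N; apply: nearS => x [/eqP]; rewrite subr_eq0 => /eqP hx [e1 _ e3 _ _].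
  by rewrite /= -(z_inv e3) -hx; exact: (congr1 z e1).
have /dnearE R1 := near_reg hgT hF1; rewrite -h0 in R1.
have /nearW_dnear R2 := near_analytic (P := fun y => y != h (T 0 0) ->
  exists phi, regular (F1 y) F1 phi) hh R1.
have A := dnearI (dnearI hne R2) (nearW_dnear (nearI (nearI N ne)
  (nearI (regular_move H_open reg) (sqrt_move reg sf)))).
have [x [[hx /(_ hx)[phi1 reg1]] [[[e1 _ e3 _ _] xe] [regx sfx]]]] := dnear_ex A.
have hE : F1 (h x) = act (F x) := esym e1.
rewrite hE in reg1.
have [b b0 ct] := local_monodromy regx sfx reg1.
exists b; first exact: b0.
have c1' := he _ _ TT xe; have c2' := continues_gact b (he _ _ xe TT).
rewrite /= FT in c1' c2'.
exact: continues_trans c1' (continues_trans ct c2').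
Qed.

End Monodromy.

Theorem theorem5 (R : realType)
    (Gamma : set 'M[R]_(2 + 2)) (H : set (cplx R)) (t : cplx R -> cplx R)
    (c1 c2 : cplx R) (delta : R -> cplx R) (k3 : cplx R)
    (z w : 'M[cplx R]_2 -> cplx R) (chi : 'M[R]_(2 + 2) -> cplx R) :
  standing_assumptions (RtoC R) Gamma H t c1 c2 delta k3 ->
  let CC := curve R H t c1 k3 in
  meromorphic_on_curve t CC z ->
  meromorphic_on_curve t CC w ->
  nonconstant_on CC z ->
  nonconstant_on CC w ->
  is_character Gamma chi ->
  (forall g T, Gamma g -> CC T -> z (aut_act (RtoC R) g T) = z T) ->
  (forall g T, Gamma g -> CC T ->
     w (aut_act (RtoC R) g T) = chi g * \det (aut_den (RtoC R) g T) * w T) ->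
  (exists T0 F phi, regular_point t CC z w T0 F phi) /\
  exists (N : nat) (P : 'I_4 -> mpoly.mpoly (3 * N) (cplx R)) (sigma : 'S_4),
  forall (T0 : 'M[cplx R]_2) (F : cplx R -> 'M[cplx R]_2) (phi : cplx R -> cplx R),
  regular_point t CC z w T0 F phi ->
  let p (i : 'I_3) := pfun (z \o F) (w \o F) t i \o phi in
  let c (k : 'I_4) := diff_poly_eval (P k) p in
  (forall (i : 'I_4) (y : cplx R -> cplx R),
     sqrt_branch (det_fun w F phi i) y (z T0) -> solves_lde c y (z T0)) /\
  (exists Y : 'I_4 -> cplx R -> cplx R,
     [/\ forall i, sqrt_branch (det_fun w F phi (sigma i)) (Y i) (z T0),
         lin_indep_at Y (z T0)
       & projective_monodromy_contains (RtoC R) c Y (z T0) Gamma]).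
Proof.
move=> SA CC z_mero w_mero z_nc w_nc [chi0 _] z_inv w_inv.
have [[GSp4 _ _ _ _] _ H_open H_conn _ t_mero t_nc _ _ _ _ _ _ acts] := SA.
have near_reg T F (hT : CC T) (hF : branch_at t T F) :=
  near_regular H_open H_conn t_mero t_nc z_mero w_mero z_nc w_nc hT hF.
split.
  have [T [_ [hT _ _]]] := z_nc; have [F hF] := curve_branch hT.
  have [x [phi reg]] := dnear_ex (near_reg T F hT hF).
  by exists (F x), F, phi.
(* The coefficients involve derivatives theta^k p_i only for k < 4. *)
exists 4%N, (fun k => dpoly_mpoly (ode (cplx R) k)), det_perm.
move=> T0 F phi reg p c; have tT := regular_t reg.
split; first by move=> i y; exact: sqrt_branch_solves reg tT i y.
have [s sf] := sqrt_factor_exists reg.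
exists (fun j y => s y * Uf t F j (phi y)); split.
- move=> j; split; first exact: (Y_analytic reg tT j sf).
  have -> : det_perm j = det_index j by exact: permE.
  by apply: nearS (det_fun_sqr reg j sf) => y ->.
- exact: Y_lin_indep reg tT s sf.
- move=> g Gg.
  have [b b0 ct] := monodromy_continues H_open near_reg (GSp4 g Gg)
    (fun T hT => acts g T Gg hT) (chi0 g Gg) (fun T hT => z_inv g T Gg hT)
    (fun T hT => w_inv g T Gg hT) reg sf.
  exists b; first exact: b0.
  have [beta [pb b1 b2 cb]] := continues_path ct.
  exists beta; split; [exact: pb|exact: b1|exact: b2| |].
    by move=> k; exact: (cb (inl k)).
  by move=> i; exact: (cb (inr i)).
Qed.
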